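(* Let $\phi$ be the limiting augmentation objective function (depending on $d,\lambda_1,\ldots,\lambda_d,\sigma^2,\gamma_p,\gamma_r$), considered for parameter values satisfying $\lambda_d > \sigma^2\sqrt{\gamma_p+\gamma_r}$. The following statements hold, where in each of them the parameters $d$, $\sigma^2$ and $\lambda_1>\cdots>\lambda_{d-1}$ not mentioned are arbitrary and fixed (subject to the model constraint $\lambda_1>\cdots>\lambda_d>0$). (i) Given any $\lambda_d>0$ and $\gamma_p>0$ (with $\lambda_d>\sigma^2\sqrt{\gamma_p}$), there exists $\gamma_r^0 \in (0,\lambda_d^2\sigma^{-4}-\gamma_p)$ such that $\phi(d)>\phi(d+1)$ for every $\gamma_r\in(0,\gamma_r^0)$. (ii) Given any $\gamma_p>0$ (with $\lambda_{d-1}>\sigma^2\sqrt{\gamma_p}$ if $d\ge2$), there exists $\lambda_d>\sigma^2\sqrt{\gamma_p}$ small enough (in particular $\lambda_d<\lambda_{d-1}$ if $d \ge 2$) such that for all $\gamma_r\in(0,\lambda_d^2\sigma^{-4}-\gamma_p)$ we have $\phi(d)>\phi(d+1)$. (iii) Given any $\lambda_d>0$, there exists $\gamma_p\in(0,\lambda_d^2\sigma^{-4})$ large enough such that for all $\gamma_r\in(0,\lambda_d^2\sigma^{-4}-\gamma_p)$ we have $\phi(d)>\phi(d+1)$.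
   Context: Model. The integer $d \ge 1$ and the constants $\lambda_1 > \cdots > \lambda_d > 0$ and $\sigma^2 > 0$ do not depend on $n$. The integer sequences $p_n, r_n$ satisfy $p_n/n \to \gamma_p \in (0,\infty)$ and $r_n/n \to \gamma_r \in (0,\infty)$ as $n \to \infty$. For each $n$, $x_{1,n},\ldots,x_{n,n}$ is an i.i.d. sample from the $p_n$-variate normal distribution $\mathcal{N}_{p_n}(\mu_n,\Sigma_n)$, where the $p_n$ eigenvalues of $\Sigma_n$ are $\lambda_1+\sigma^2 > \cdots > \lambda_d + \sigma^2 > \sigma^2 = \cdots = \sigma^2$. Augmentation. The noise variance $\sigma^2$ is assumed known. The augmented sample is $z_{i,n} = (x_{i,n}', \sigma s_{i,n}')' \in \mathbb{R}^{p_n+r_n}$, $i=1,\ldots,n$, where $s_{1,n},\ldots,s_{n,n}$ are i.i.d. $\mathcal{N}_{r_n}(0,I_{r_n})$ and independent of the sample $x_{1,n},\ldots,x_{n,n}$. Let $S_n = \frac{1}{n}\sum_{i=1}^n (z_{i,n}-\bar z_n)(z_{i,n}-\bar z_n)'$, with $\bar z_n = \frac1n\sum_{i=1}^n z_{i,n}$, be the sample covariance matrix of the augmented sample, let $\tau_{1,n}\ge\cdots\ge\tau_{p_n+1,n}$ be its $p_n+1$ largest eigenvalues, and let $u_{1,n},\ldots,u_{p_n,n}$ be any set of orthonormal eigenvectors corresponding to its $p_n$ largest eigenvalues in decreasing order. Let $u_{j,n,C}$ denote the subvector of the last $r_n$ coordinates of $u_{j,n}$, and set $\|u_{0,n,C}\|^2=0$.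 The augmentation objective function is $\phi_n:\{0,\ldots,p_n\}\to\mathbb{R}$, $$\phi_n(k)=\sum_{j=0}^k\|u_{j,n,C}\|^2+\frac{\tau_{k+1,n}}{1+\sum_{j=1}^{k+1}\tau_{j,n}}.$$ (The predictor augmentation estimator of $d$ is the minimizer of $\phi_n$.) Under $\lambda_d > \sigma^2\sqrt{\gamma_p+\gamma_r}$, $\phi$ denotes the pointwise limit in probability of $\phi_n$: $\phi_n(k)\to_p\phi(k)$ as $n\to\infty$ for each fixed $k\ge0$. *)

(* Defs.v *)
From HB Require Import structures.
From mathcomp Require Import all_boot all_order all_algebra.
From mathcomp Require Import all_classical all_reals all_analysis.

Set Implicit Arguments.
Unset Strict Implicit.
Unset Printing Implicit Defensive.

Import Order.TTheory GRing.Theory Num.Theory.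
Import numFieldNormedType.Exports.

Local Open Scope classical_set_scope.
Local Open Scope ring_scope.

Section linear_algebra.
Context {R : realType}.

Definition inner {m} (v w : 'cV[R]_m) : R := \sum_i v i 0 * w i 0.

(* s lists the eigenvalues of A, with algebraic multiplicity, in decreasing
   order; as s is 0-based, s`_j is the (j+1)-st largest eigenvalue. *)
Definition eigenvalues_of {m} (A : 'M[R]_m) (s : seq R) : Prop :=
  sorted >=%R s /\ char_poly A = \prod_(t <- s) ('X - t%:P).

Definition sample_mean {n m} (z : 'I_n -> 'cV[R]_m) : 'cV[R]_m :=
  n%:R^-1 *: \sum_i z i.

Definition sample_cov {n m} (z : 'I_n -> 'cV[R]_m) : 'M[R]_m :=
  n%:R^-1 *: \sum_i (z i - sample_mean z) *m (z i - sample_mean z)^T.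

End linear_algebra.

Section probability.
Context {R : realType} {dT : measure_display} {T : measurableType dT}.
Variable P : probability T R.

(* Mutual independence of a finite family of sub-sigma-algebras. *)
Definition mutually_independent {I : finType} (F : I -> set (set T)) : Prop :=
  forall (J : {set I}) (E : I -> set T), (forall i, i \in J -> F i (E i)) ->
    P (\bigcap_(i in [set` J]) E i) = (\prod_(i in J) fine (P (E i)))%:E.

Definition independent_systems (F G : set (set T)) : Prop :=
  forall A B, F A -> G B -> P (A `&` B) = (P A * P B)%E.

Definition sigma_rv (X : T -> R) : set (set T) :=
  preimage_set_system setT X measurable.

Definition sigma_rvec {m} (X : T -> 'cV[R]_m) : set (set T) :=
  <<s \bigcup_(i in [set: 'I_m]) sigma_rv (fun t => X t i 0) >>.

Definition sigma_sample {n m} (X : 'I_n -> T -> 'cV[R]_m) : set (set T) :=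
  <<s \bigcup_(i in [set: 'I_n]) sigma_rvec (X i) >>.

Definition std_normal {m} (W : T -> 'cV[R]_m) : Prop :=
  [/\ forall i, measurable_fun setT (fun t => W t i 0),
      forall i (B : set R), measurable B ->
        P ((fun t => W t i 0) @^-1` B) = normal_prob 0 1 B
    & mutually_independent (fun i => sigma_rv (fun t => W t i 0))].

(* X ~ N(mu, Sigma): an affine image of a standard normal vector. *)
Definition multivariate_normal {m} (mu : 'cV[R]_m) (Sigma : 'M[R]_m)
    (X : T -> 'cV[R]_m) : Prop :=
  exists (A : 'M[R]_m) (W : T -> 'cV[R]_m),
    [/\ A *m A^T = Sigma, std_normal W & forall t, X t = mu + A *m W t].

Definition iid_normal {n m} (mu : 'cV[R]_m) (Sigma : 'M[R]_m)
    (X : 'I_n -> T -> 'cV[R]_m) : Prop :=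
  (forall i, multivariate_normal mu Sigma (X i)) /\
  mutually_independent (fun i => sigma_rvec (X i)).

(* Convergence in probability to a constant.  The outer measure [mu_ext P]
   agrees with P on measurable sets; it is used because no measurability is
   imposed on the choice of the sample eigenvectors below. *)
Definition cvg_in_probability (Y : nat -> T -> R) (c : R) : Prop :=
  forall eps : R, 0 < eps ->
    (fun n => mu_ext P [set t | eps < `|Y n t - c|]) @ \oo --> 0%E.

End probability.

(* The signal eigenvalues lambda_1, ..., lambda_d are the items of [lam], so
   d = size lam; [sigma2], [gp] and [gr] are sigma^2, gamma_p and gamma_r.
   The sequences are indexed by all of nat, but only n > 0 is constrained. *)
Record augmented_model {R : realType} (lam : seq R) (sigma2 gp gr : R) :=
  AugmentedModel {
  am_disp : measure_display;
  am_T : measurableType am_disp;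
  am_P : probability am_T R;
  am_p : nat -> nat;
  am_r : nat -> nat;
  am_p_lim : (fun n => (am_p n)%:R / n%:R : R) @ \oo --> gp;
  am_r_lim : (fun n => (am_r n)%:R / n%:R : R) @ \oo --> gr;
  am_mu : forall n, 'cV[R]_(am_p n);
  am_Sigma : forall n, 'M[R]_(am_p n);
  am_Sigma_sym : forall n, (0 < n)%N -> (am_Sigma n)^T = am_Sigma n;
  (* the size of the list forces d <= p_n *)
  am_Sigma_eig : forall n, (0 < n)%N ->
    eigenvalues_of (am_Sigma n)
      ([seq l + sigma2 | l <- lam] ++ nseq (am_p n - size lam) sigma2);
  am_x : forall n, 'I_n -> am_T -> 'cV[R]_(am_p n);
  am_x_normal : forall n, (0 < n)%N ->
    iid_normal am_P (am_mu n) (am_Sigma n) (@am_x n);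
  am_s : forall n, 'I_n -> am_T -> 'cV[R]_(am_r n);
  am_s_normal : forall n, (0 < n)%N -> iid_normal am_P 0 1%:M (@am_s n);
  am_xs_indep : forall n, (0 < n)%N ->
    independent_systems am_P (sigma_sample (@am_x n)) (sigma_sample (@am_s n));
  am_z := fun n (i : 'I_n) t =>
    col_mx (am_x i t) (Num.sqrt sigma2 *: am_s i t);
  am_S := fun n t => sample_cov (fun i : 'I_n => am_z i t);
  (* 0-based: (am_tau n t)`_j is tau_{j+1,n} and am_u n t j is u_{j+1,n} *)
  am_tau : nat -> am_T -> seq R;
  am_tau_eig : forall n t, (0 < n)%N -> eigenvalues_of (am_S n t) (am_tau n t);
  am_u : forall n, am_T -> nat -> 'cV[R]_(am_p n + am_r n);
  am_u_orthonormal : forall n t, (0 < n)%N ->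
    forall i j, (i < am_p n)%N -> (j < am_p n)%N ->
      inner (am_u n t i) (am_u n t j) = (i == j)%:R;
  am_u_eig : forall n t, (0 < n)%N -> forall j, (j < am_p n)%N ->
    am_S n t *m am_u n t j = (am_tau n t)`_j *: am_u n t j
}.

Arguments am_tau {R lam sigma2 gp gr} M n t : rename.
Arguments am_u {R lam sigma2 gp gr} M n t j : rename.

Section objective.
Context {R : realType} {lam : seq R} {sigma2 gp gr : R}.
Variable M : augmented_model lam sigma2 gp gr.

(* ||u_{j,n,C}||^2 for 1-based j, with the convention that it is 0 at j = 0 *)
Definition aug_norm2 (n : nat) (t : am_T M) (j : nat) : R :=
  if j is j'.+1 then inner (dsubmx (am_u M n t j')) (dsubmx (am_u M n t j'))
  else 0.

(* phi_n(k); only meaningful for k <= p_n, which for fixed k holds for all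
   large n. *)
Definition objective (k n : nat) (t : am_T M) : R :=
  \sum_(0 <= j < k.+1) aug_norm2 n t j +
  (am_tau M n t)`_k / (1 + \sum_(1 <= j < k.+2) (am_tau M n t)`_j.-1).

End objective.

Arguments objective {R lam sigma2 gp gr} M k n t.

(* The limit depends on the parameters only, so asking for a single realisation
   of the model makes "for all phi, limiting_objective ... phi -> ..." a
   statement about the limit along every realisation. *)
Definition limiting_objective {R : realType} (lam : seq R) (sigma2 gp gr : R)
    (phi : nat -> R) : Prop :=
  exists M : augmented_model lam sigma2 gp gr,
    forall k, cvg_in_probability (am_P M) (objective M k) (phi k).

(* Main.v *)
Require Import Defs.
From mathcomp Require Import all_boot all_order all_algebra fingroup perm.
From mathcomp Require Import all_classical all_reals all_analysis.
From mathcomp Require Import measurable_realfun ring lra zify.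
(** The theorem is about small [gr]: in each of the three statements the
    admissible values of [gr] lie, or are chosen, in a short interval next to 0,
    while [gp] and the signal eigenvalues stay in a compact set
    ([objective_decreases]).

    Let a >= b be the sample eigenvalues of rank d + 1 and d + 2, S the sum of the
    d + 1 largest ones and u a unit eigenvector for a.  The decrease of the
    objective function from d to d + 1 is
      a / (1 + S) - b / (1 + S + b) - |u_C|^2   ([objective_step]),
    and as b <= a the first two terms differ by at least
    a^2 / ((1 + S) (1 + S + a)) ([eigen_gap_le]).  Hence it suffices that, with a
    probability bounded away from 0, S is bounded above, a is bounded below and
    |u_C|^2 is small: the limits in probability are constants, so they inherit an
    inequality that holds on events of non-vanishing probability.

    In coordinates that diagonalise the population covariance and leave the
    augmentation alone, the sample is a matrix y of independent standard normal
    variables with rescaled columns ([model_normal]).  The operator norm of y is of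
    order sqrt n by an epsilon-net argument ([op_bound_probability]), which bounds
    S.  The total sample variance is at least of order n with probability 1/3
    ([energy_probability]); being spread over all the eigenvalues, of which the
    first d are bounded, it forces a to be bounded below ([eigenvalue_ge]).

    The mass |u_C|^2 is small because of exchangeability.  The augmentation is
    distributed like any block of r noise coordinates of the predictor; as there
    are at least m disjoint blocks of this kind, with m of order gp / gr, and u has
    norm 1, the block C typically receives no more than about 1/m of the mass.
    The eigenvectors are however an arbitrary choice, neither measurable nor
    equivariant, so the argument is carried out for a function of y instead.  The
    square root N y of the sum of the d + 1 largest eigenvalues is a seminorm by
    Ky Fan's principle ([ky_fan], [seminorm_ky_fan]); it is invariant under the
    exchange of noise columns ([ky_fan_norm_perm]); and every choice of
    eigenvectors yields a subgradient of N at y, which pairs with the restriction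
    of y to the columns in C as (sum_j tau_j |u_(j,C)|^2) / N y
    ([supports_eigenframe]).  A seminorm is differentiable at almost every point for
    the normal law ([kinks_null]), and there the subgradient is the gradient
    ([off_kinks_derivative]).  The event that N increases at a rate at least e when
    the columns in C are inflated is therefore measurable, as likely as the
    analogous events for the m blocks, and outside a null set it contradicts the
    bound N y on the total mass if it happens for too many blocks at once
    ([sensitive_rare]). *)

Set Implicit Arguments.
Unset Strict Implicit.
Unset Printing Implicit Defensive.
Import Order.TTheory GRing.Theory Num.Theory.
Import numFieldNormedType.Exports.
Local Open Scope classical_set_scope.
Local Open Scope ring_scope.

(** * Families of independent standard normal variables *)

Section boxes.
Context {R : realType} {I : finType}.

Definition box (B : I -> set R) : set (I -> R) := [set y | forall i, B i (y i)].

Definition boxes : set (set (I -> R)) :=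
  [set box B | B in [set B : I -> set R | forall i, measurable (B i)]].

Definition borel_vec := g_sigma_algebraType boxes.

Lemma boxes_setI : setI_closed boxes.
Proof.
move=> _ _ [A mA <-] [B mB <-]; exists (fun i => A i `&` B i).
  by move=> i; exact: measurableI.
apply/seteqP; split=> [y yAB|y [yA yB] i]; last by split; [exact: yA|exact: yB].
by split=> i; have [] := yAB i.
Qed.

Lemma measurable_box (B : I -> set R) :
  (forall i, measurable (B i)) -> measurable (box B : set borel_vec).
Proof. by move=> mB; apply: sub_sigma_algebra; exists B. Qed.

Lemma measurable_coord (i : I) :
  measurable_fun setT (fun y : borel_vec => y i : R).
Proof.
move=> _ B mB; rewrite setTI.
have -> : (fun y : borel_vec => y i) @^-1` B
          = box (fun j => if j == i then B else setT).
  apply/seteqP; split=> [y /= yB j|y /= /(_ i)]; last by rewrite eqxx.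
  by case: eqP => [->|].
by apply: measurable_box => j; case: ifP.
Qed.

Context {d : measure_display} {T : measurableType d}.

Lemma box_preimage (Y : I -> T -> R) (B : I -> set R) :
  (fun t i => Y i t) @^-1` box B = \bigcap_(i in [set: I]) (Y i @^-1` B i).
Proof.
by apply/seteqP; split=> t /= h; [move=> i _; exact: h|move=> i; exact: h].
Qed.

Lemma measurable_vec (Y : I -> T -> R) :
  (forall i, measurable_fun setT (Y i)) ->
  measurable_fun setT ((fun t i => Y i t) : T -> borel_vec).
Proof.
move=> mY; apply: (@measurability _ _ _ borel_vec _ _ boxes) => //.
move=> _ [_ [B mB <-] <-]; rewrite setTI box_preimage.
apply: fin_bigcap_measurable; first exact: finite_finset.
by move=> i _; rewrite -[X in measurable X]setTI; exact: mY.
Qed.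

End boxes.

Section iid_normal.
Context {R : realType}.
Local Notation N01 := (@normal_prob R 0 1).

(** The joint law of a family of independent standard normal variables is
    recorded through its values on boxes, which determine it. *)
Definition iidN {d} {T : measurableType d} (P : probability T R) {I : finType}
    (Y : I -> T -> R) : Prop :=
  (forall i, measurable_fun setT (Y i)) /\
  forall B : I -> set R, (forall i, measurable (B i)) ->
    P [set t | forall i, B i (Y i t)] = (\prod_i fine (N01 (B i)))%:E.

(** Boxes form a pi-system generating [borel_vec], so the joint law is determined;
    this transports measurable events between different families. *)
Lemma iidN_law {d d'} {T : measurableType d} {T' : measurableType d'}
    (P : probability T R) (P' : probability T' R) {I : finType}
    (Y : I -> T -> R) (Y' : I -> T' -> R) (E : set (@borel_vec R I)) :
  iidN P Y -> iidN P' Y' -> measurable E ->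
  P [set t | E (fun i => Y i t)] = P' [set t | E (fun i => Y' i t)].
Proof.
move=> [mY PY] [mY' PY'] mE.
have mv := measurable_vec mY; have mv' := measurable_vec mY'.
have mp (S : set (@borel_vec R I)) : measurable S -> measurable [set t | S (fun i => Y i t)].
  by move=> mS; rewrite -[X in measurable X]setTI; exact: mv.
have mp' (S : set (@borel_vec R I)) : measurable S -> measurable [set t | S (fun i => Y' i t)].
  by move=> mS; rewrite -[X in measurable X]setTI; exact: mv'.
apply: (@dynkin_induction _ (@borel_vec R I) boxes (fun S =>
  P [set t | S (fun i => Y i t)] = P' [set t | S (fun i => Y' i t)])) => //.
- exact: boxes_setI.
- by rewrite !probability_setT.
- by move=> _ [B mB <-]; rewrite [LHS]PY ?[RHS]PY'.
- move=> S mS ih.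
  rewrite (_ : [set t | _] = ~` [set t | S (fun i => Y i t)])//.
  rewrite (_ : [set t | (~` S) (fun i => Y' i t)] =
    ~` [set t | S (fun i => Y' i t)])//.
  by rewrite !probability_setC ?ih//; [exact: mp'|exact: mp].
- move=> F mF tF ih.
  have pre (V : Type) (g : V -> I -> R) :
      [set t | (\bigcup_k F k) (g t)] = \bigcup_k [set t | F k (g t)].
    by apply/seteqP; split.
  have tr (V : Type) (g : V -> I -> R) :
      trivIset setT (fun k => [set t | F k (g t)]).
    by move=> i j _ _ [t [/= h1 h2]]; apply: (tF i j) => //; exists (g t).
  rewrite !pre !measure_bigcup//; last 2 first.
    by move=> k _; exact: mp'.
    by move=> k _; exact: mp.
  by apply: eq_eseriesr => k _; exact: ih.
Qed.

Lemma iidN_marginal {d} {T : measurableType d} (P : probability T R)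
    {I : finType} (Y : I -> T -> R) (i : I) (B : set R) :
  iidN P Y -> measurable B -> P (Y i @^-1` B) = N01 B.
Proof.
move=> [mY PY] mB.
have := PY (fun j => if j == i then B else setT).
rewrite (_ : [set t | _] = Y i @^-1` B); last first.
  apply/seteqP; split=> [t /= /(_ i)|t /= h j]; first by rewrite eqxx.
  by case: eqP => [->|].
move=> ->; last by move=> j; case: ifP.
rewrite (bigD1 i)//= eqxx big1 ?mulr1 ?fineK ?fin_num_measure//.
  by move=> j /negbTE ->; rewrite probability_setT.
Qed.

End iid_normal.

(** * Rotation invariance *)

Section plane_rotation.
Context {R : realType}.
Local Notation N01 := (@normal_prob R 0 1).
Local Notation pdf := (@normal_pdf R 0 1).
Local Notation mu := (@lebesgue_measure R).
Local Open Scope ereal_scope.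

Lemma integral_normal_prob (f : R -> \bar R) : N01.-integrable setT f ->
  \int[N01]_x f x = \int[mu]_x (f x * (pdf x)%:E).
Proof.
move=> intf; have mf := measurable_int _ intf.
have dom := @normal_prob_dominates R 0 1.
rewrite -(Radon_Nikodym_change_of_variables dom)//=.
apply: ae_eq_integral => //.
- apply: emeasurable_funM => //; exact: (measurable_int mu).
- apply: emeasurable_funM => //=; apply/measurable_EFinP.
  exact: measurable_normal_pdf.
- apply: ae_eqe_mul2l; apply: integral_ae_eq => //.
  + exact: Radon_Nikodym_integrable.
  + by apply/measurable_EFinP; exact: measurable_normal_pdf.
  + by move=> E _ mE; rewrite -Radon_Nikodym_integral.
Qed.

(** Translation invariance of the Lebesgue measure follows from its
    characterisation by the lengths of intervals. *)
Lemma ge0_integral_translation (a : R) (f : R -> \bar R) :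
  measurable_fun setT f -> (forall x, 0 <= f x) ->
  \int[mu]_x f (x + a)%R = \int[mu]_x f x.
Proof.
move=> mf f0.
have mT : measurable_fun setT (fun x : R => (x + a)%R : measurableTypeR R).
  exact: measurable_funD.
transitivity (\int[pushforward mu (fun x : R => (x + a)%R : measurableTypeR R)]_x f x).
  by rewrite ge0_integral_pushforward.
apply: eq_measure_integral => //= A mA _; apply/esym.
apply: (@lebesgue_measure_unique R (pushforward mu (fun x : R => (x + a)%R : measurableTypeR R))) => //.
move=> _ [[u v]] _ <-.
rewrite [RHS](_ : _ = mu `](u - a)%R, (v - a)%R]%classic); last first.
  congr (mu _); apply/seteqP; split=> x /=;
    by rewrite !in_itv/= ltrBlDr lerBrDr.
rewrite /= !lebesgue_measure_itv/= !lte_fin ltrD2r; case: ifP => // _.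
by rewrite -!EFinB; congr EFin; lra.
Qed.

Implicit Type f : R * R -> \bar R.

Lemma shear_y (t : R) f : measurable_fun setT f -> (forall z, 0 <= f z) ->
  \int[mu]_x \int[mu]_y f (x, (y + t * x)%R) = \int[mu]_x \int[mu]_y f (x, y).
Proof.
move=> mf f0; apply: eq_integral => x _.
rewrite (@ge0_integral_translation (t * x)%R (fun y => f (x, y)))//.
exact: measurableT_comp.
Qed.

Lemma shear_x (t : R) f : measurable_fun setT f -> (forall z, 0 <= f z) ->
  \int[mu]_x \int[mu]_y f ((x + t * y)%R, y) = \int[mu]_x \int[mu]_y f (x, y).
Proof.
move=> mf f0.
have mg : measurable_fun setT (fun z : R * R => f ((z.1 + t * z.2)%R, z.2)).
  apply: measurableT_comp => //; apply/measurable_fun_pairP; split.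
    by apply: measurable_funD => //; apply: measurable_funM.
  exact: measurable_snd.
apply: etrans; first exact: (@fubini_tonelli _ _ _ _ _ mu mu _ mg (fun z => f0 _)).
apply: etrans; last exact: (esym (@fubini_tonelli _ _ _ _ _ mu mu _ mf f0)).
apply: eq_integral => y _ /=.
apply: (@ge0_integral_translation (t * y)%R (fun x => f (x, y))) => //.
exact: measurableT_comp.
Qed.

(** A rotation other than a half turn is a product of three shears, and shears
    preserve iterated integrals because translations do. *)
Lemma integral_rotation (c s : R) f : (s != 0)%R -> (c ^+ 2 + s ^+ 2 = 1)%R ->
  measurable_fun setT f -> (forall z, 0 <= f z) ->
  \int[mu]_x \int[mu]_y f ((c * x + s * y)%R, (- s * x + c * y)%R)
  = \int[mu]_x \int[mu]_y f (x, y).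
Proof.
move=> s0 cs mf f0.
(* the tangent of half the angle *)
pose t := ((1 - c) / s)%R.
have ts : (t * s = 1 - c)%R by rewrite /t divfK.
have tc : (t * (1 + c) = s)%R.
  apply: (mulfI s0); rewrite mulrA (mulrC s) ts; apply: subr0_eq.
  by transitivity (1 - (c ^+ 2 + s ^+ 2))%R; [ring|rewrite cs subrr].
have mx g : measurable_fun setT g ->
    measurable_fun setT (fun z : R * R => g ((z.1 + t * z.2)%R, z.2) : \bar R).
  move=> mg; apply: measurableT_comp => //; apply/measurable_fun_pairP; split.
    by apply: measurable_funD => //; apply: measurable_funM.
  exact: measurable_snd.
have my g : measurable_fun setT g ->
    measurable_fun setT (fun z : R * R => g (z.1, (z.2 + - s * z.1)%R) : \bar R).
  move=> mg; apply: measurableT_comp => //; apply/measurable_fun_pairP; split.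
    exact: measurable_fst.
  by apply: measurable_funD => //; apply: measurable_funM.
apply: etrans; last exact: (shear_x t mf f0).
apply: etrans; last exact: (shear_y (- s) (mx _ mf) (fun z => f0 _)).
apply: etrans; last exact: (shear_x t (my _ (mx _ mf)) (fun z => f0 _)).
apply: eq_integral => x _; apply: eq_integral => y _ /=.
have ec : (c = 1 - t * s)%R by lra.
have es : (s = 2 * t - t * (t * s))%R by rewrite ts -{1}tc; lra.
congr (f (_, _)).
  transitivity ((1 - t * s) * (x : R) + (2 * t - t * (t * s)) * (y : R))%R.
    by rewrite -es -ec.
  ring.
transitivity (- s * (x : R) + (1 - t * s) * (y : R))%R; first by rewrite -ec.
ring.
Qed.

End plane_rotation.

Section normal_pair.
Context {R : realType}.
Local Notation N01 := (@normal_prob R 0 1).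
Local Notation pdf := (@normal_pdf R 0 1).
Local Notation mu := (@lebesgue_measure R).
Local Open Scope ereal_scope.

Lemma measurable_normal_prob_xsection (E : set (R * R)) : measurable E ->
  measurable_fun setT (fun x => N01 (xsection E x)).
Proof. by move=> mE; exact: (measurable_fun_xsection N01 mE). Qed.

(** Fubini and the density of the normal law turn a probability for two
    independent variables into an iterated Lebesgue integral, to which shears
    apply. *)
Lemma normal_pairE (E : set (R * R)) : measurable E ->
  (N01 \x N01) E = \int[mu]_x \int[mu]_y (pdf x * pdf y * \1_E (x, y))%:E.
Proof.
move=> mE; transitivity (\int[N01]_x N01 (xsection E x)) => //.
have mx := measurable_normal_prob_xsection mE.
rewrite integral_normal_prob; last first.
  apply/integrableP; split => //.
  apply: (@le_lt_trans _ _ (\int[N01]_x cst 1 x)).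
    apply: ge0_le_integral => //=; first exact: measurableT_comp.
    by move=> x _; rewrite gee0_abs// probability_le1//; exact: measurable_xsection.
  by rewrite integral_cst// mul1e [ltLHS](@probability_setT _ _ _ N01) ltry.
apply: eq_integral => x _.
rewrite [N01 _](_ : _ = \int[mu]_y (pdf y * \1_E (x, y))%:E); last first.
  rewrite /normal_prob integral_mkcond; apply: eq_integral => y _.
  rewrite patchE indicE mem_xsection.
  by case: ifP => _ /=; rewrite ?mulr1 ?mulr0.
have m1 : measurable_fun setT (fun y : R => pdf y * \1_E (x, y))%R.
  apply: measurable_funM; first exact: measurable_normal_pdf.
  exact: (measurableT_comp (measurable_indic _) (pair1_measurable x)).
rewrite -ge0_integralZr//=.
- by apply: eq_integral => y _; rewrite -EFinM; congr EFin; lra.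
- by apply/measurable_EFinP.
- by move=> y _; rewrite lee_fin mulr_ge0// normal_pdf_ge0.
- by rewrite lee_fin normal_pdf_ge0.
Qed.

(** The density of two independent standard normal variables depends only on the
    distance to the origin. *)
Lemma normal_pair_rotation (c s : R) (A B : set R) :
  (s != 0)%R -> (c ^+ 2 + s ^+ 2 = 1)%R -> measurable A -> measurable B ->
  (N01 \x N01) [set u | A (c * u.1 + s * u.2)%R /\ B (- s * u.1 + c * u.2)%R]
  = N01 A * N01 B.
Proof.
move=> s0 cs mA mB.
pose rot (u : R * R) := ((c * u.1 + s * u.2)%R, (- s * u.1 + c * u.2)%R).
have mrot : measurable_fun setT rot.
  by apply/measurable_fun_pairP; split; apply: measurable_funD;
    apply: measurable_funM.
have mAB : measurable (A `*` B) by exact: measurableX.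
have mE : measurable (rot @^-1` (A `*` B)).
  by rewrite -[X in measurable X]setTI; exact: mrot.
have -> : [set u | A (c * u.1 + s * u.2)%R /\ B (- s * u.1 + c * u.2)%R]
  = rot @^-1` (A `*` B) by [].
apply: etrans; first exact: (normal_pairE mE).
apply: etrans; last exact: (product_measure1E N01 N01 mA mB).
apply: etrans; last exact: (esym (normal_pairE mAB)).
apply: etrans; last first.
  apply: (@integral_rotation R c s (fun z => (pdf z.1 * pdf z.2 * \1_(A `*` B) z)%:E)) => //.
  - apply/measurable_EFinP; apply: measurable_funM; last exact: measurable_indic.
    by apply: measurable_funM; (apply: measurableT_comp; first exact: measurable_normal_pdf).
  - by move=> z; rewrite lee_fin !mulr_ge0// normal_pdf_ge0.
apply: eq_integral => x _; apply: eq_integral => y _ /=; congr (_ * _)%:E.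
rewrite /normal_pdf oner_eq0 /normal_fun.
rewrite -![(_ * expR _ * (_ * expR _))%R]mulrACA -!expRD; congr (_ * expR _)%R.
move: ((1 ^+ 2 *+ 2)^-1)%R => k; rewrite -[LHS]mul1r -cs.
by rewrite !subr0; ring.
Qed.

End normal_pair.

Section glueing.
Context {R : realType}.
Local Notation N01 := (@normal_prob R 0 1).

(** This allows computing with a few coordinates at a time: those in [K] may live
    on a probability space of their own. *)
Lemma iidN_glue {d d'} {U : measurableType d} {T : measurableType d'}
    (Q : probability U R) (P : probability T R) {I : finType} (K : {set I})
    (Z : I -> U -> R) (Y : I -> T -> R) :
  (forall i, measurable_fun setT (Z i)) ->
  (forall B : I -> set R, (forall i, measurable (B i)) ->
    Q [set u | forall i, i \in K -> B i (Z i u)]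
    = (\prod_(i in K) fine (N01 (B i)))%:E) ->
  iidN P Y ->
  iidN (Q \x P)%E (fun i ut => if i \in K then Z i ut.1 else Y i ut.2).
Proof.
move=> mZ QZ [mY PY]; split=> [i|B mB].
  case: (i \in K) => /=.
    by apply: measurableT_comp; [exact: mZ|exact: measurable_fst].
  by apply: measurableT_comp; [exact: mY|exact: measurable_snd].
pose B' i := if i \in K then setT else B i.
have mB' i : measurable (B' i) by rewrite /B'; case: ifP.
have -> : [set ut | forall i, B i (if i \in K then Z i ut.1 else Y i ut.2)]
  = [set u | forall i, i \in K -> B i (Z i u)] `*`
    [set t | forall i, B' i (Y i t)].
  apply/seteqP; split=> [[u t] /= h|[u t] /= [h1 h2] i].
    split=> i; first by move=> iK; have := h i; rewrite iK.
    by rewrite /B'; case: ifP => // iK; have := h i; rewrite iK.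
  by case: ifP => iK; [exact: h1|have := h2 i; rewrite /B' iK].
have mQ : measurable [set u | forall i, i \in K -> B i (Z i u)].
  rewrite (_ : [set u | _] = \bigcap_(i in [set` K]) (Z i @^-1` B i)); last first.
    by apply/seteqP; split=> u /= h i; exact: h.
  apply: fin_bigcap_measurable; first exact: finite_finset.
  by move=> i _; rewrite -[X in measurable X]setTI; exact: mZ.
have mP : measurable [set t | forall i, B' i (Y i t)].
  have := measurable_vec mY (@measurableT _ _) (measurable_box mB').
  by rewrite setTI.
apply: etrans; first exact: (product_measure1E Q P mQ mP).
rewrite [X in (_ * X)%E](PY B' mB') [X in (X * _)%E](QZ B mB) -EFinM.
congr EFin; rewrite [RHS](bigID (mem K))/=; congr (_ * _).
rewrite (bigID (mem K))/= big1 ?mul1r; last first.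
  by move=> i iK; rewrite /B' iK probability_setT.
by apply: eq_bigr => i /negbTE iK; rewrite /B' iK.
Qed.

Lemma iidN_resample {d} {T : measurableType d} (P : probability T R)
    {I : finType} (Y : I -> T -> R) (i : I) : iidN P Y ->
  iidN (N01 \x P)%E (fun k ut => if k == i then ut.1 else Y k ut.2).
Proof.
move=> nY.
rewrite (_ : (fun k ut => _) = fun k ut =>
    if k \in [set i]%SET then ut.1 else Y k ut.2); last first.
  by apply/funext => k; apply/funext => ut; rewrite finset.in_set1.
apply: (@iidN_glue _ _ _ _ N01 P _ _ (fun _ u => u) Y) => // B mB.
rewrite big_set1 fineK; last by rewrite fin_num_measure//; exact: mB.
rewrite (_ : [set u | _] = B i)//.
by apply/seteqP; split=> u /= h; [exact: (h i (set11 i))|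
  move=> k /set1P ->].
Qed.

(** Two coordinates are glued back from an independent pair, for which the claim
    is the rotation invariance in the plane. *)
Lemma iidN_rotation {d} {T : measurableType d} (P : probability T R)
    {I : finType} (Y : I -> T -> R) (i j : I) (c s : R) :
  i != j -> s != 0 -> c ^+ 2 + s ^+ 2 = 1 -> iidN P Y ->
  iidN P (fun k t => if k == i then c * Y i t + s * Y j t
                     else if k == j then - s * Y i t + c * Y j t else Y k t).
Proof.
move=> ij s0 cs nY; have [mY PY] := nY; split=> [k|B mB].
  case: (k == i); first by apply: measurable_funD; apply: measurable_funM.
  by case: (k == j) => //; apply: measurable_funD; apply: measurable_funM.
pose rot (y : @borel_vec R I) : @borel_vec R I := fun k =>
  if k == i then c * y i + s * y j
  else if k == j then - s * y i + c * y j else y k.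
have mrot : measurable_fun setT rot.
  apply: (@measurable_vec R I _ (@borel_vec R I) (fun k y => rot y k)) => k.
  rewrite /rot; case: (k == i).
    by apply: measurable_funD; apply: measurable_funM => //; exact: measurable_coord.
  case: (k == j); last exact: measurable_coord.
  by apply: measurable_funD; apply: measurable_funM => //; exact: measurable_coord.
have mE : measurable (rot @^-1` box B).
  by rewrite -[X in measurable X]setTI; apply: mrot => //; exact: measurable_box.
have nZ := @iidN_glue _ _ _ _ (N01 \x N01)%E P _ [set i; j]%SET
  (fun k u => if k == i then u.1 else u.2) Y.
rewrite (_ : [set t | _] = [set t | (rot @^-1` box B) (fun k => Y k t)])//.
rewrite (iidN_law nY (nZ _ _ nY) mE)/=; last first.
- move=> A mA; rewrite big_setU1 ?finset.in_set1//= big_set1 EFinM.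
  rewrite !fineK ?fin_num_measure//; last 2 first.
    exact: mA.
    exact: mA.
  rewrite -[RHS](product_measure1E N01 N01 (mA i) (mA j)).
  rewrite (_ : [set u | _] = A i `*` A j)//; apply/seteqP; split=> [u /= h|u /= [h1 h2] k].
    split; first by have := h i; rewrite !finset.in_set2 !eqxx; apply.
    have := h j; rewrite !finset.in_set2 !eqxx orbT eq_sym (negbTE ij).
    by apply.
  rewrite !finset.in_set2 => /orP[]/eqP ->; rewrite ?eqxx//.
  by rewrite eq_sym (negbTE ij).
- by move=> k; case: (k == i); [exact: measurable_fst|exact: measurable_snd].
pose B' k := if k \in [set i; j]%SET then setT else B k.
have mB' k : measurable (B' k) by rewrite /B'; case: ifP.
rewrite (_ : [set t | _] =
    [set u | B i (c * u.1 + s * u.2) /\ B j (- s * u.1 + c * u.2)] `*`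
    [set t | forall k, B' k (Y k t)]); last first.
  apply/seteqP; split=> [[u t] /= h|[u t] /= [[h1 h2] h3] k].
    split; last first.
      move=> k; rewrite /B'; case: ifP => // /negbT kK.
      have := h k; rewrite /rot /= (negbTE kK).
      by move: kK; rewrite !finset.in_set2 negb_or => /andP[/negbTE -> /negbTE ->].
    split.
      have := h i; rewrite /rot /= !finset.in_set2 !eqxx orbT.
      by rewrite [j == i]eq_sym (negbTE ij).
    have := h j; rewrite /rot /= !finset.in_set2 !eqxx orbT.
    by rewrite [j == i]eq_sym (negbTE ij).
  rewrite /rot /= !finset.in_set2 !eqxx orbT [j == i]eq_sym (negbTE ij).
  case: eqP => [->//|/eqP ki]; case: eqP => [->//|/eqP kj] /=.
  by have := h3 k; rewrite /B' !finset.in_set2 (negbTE ki) (negbTE kj).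
have m1 : measurable [set u : R * R | B i (c * u.1 + s * u.2) /\
                                      B j (- s * u.1 + c * u.2)].
  have mrot2 : measurable_fun setT
      (fun u : R * R => (c * u.1 + s * u.2, - s * u.1 + c * u.2)).
    by apply/measurable_fun_pairP; split; apply: measurable_funD;
      apply: measurable_funM.
  have := mrot2 measurableT _ (measurableX (mB i) (mB j)).
  by rewrite setTI.
have m2 : measurable [set t | forall k, B' k (Y k t)].
  have := measurable_vec mY (@measurableT _ _) (measurable_box mB').
  by rewrite setTI.
apply: etrans; first exact: (product_measure1E (N01 \x N01)%E P m1 m2).
rewrite [X in (X * _)%E]normal_pair_rotation// [X in (_ * X)%E](PY B' mB').
rewrite [in RHS](bigD1 i)//= [in RHS](bigD1 j)/= ?[j != i]eq_sym//.
rewrite [in RHS]mulrA [RHS]EFinM.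
rewrite EFinM !fineK; last 2 first.
- by rewrite fin_num_measure//; exact: mB.
- by rewrite fin_num_measure//; exact: mB.
congr (_ * _)%E; congr EFin.
rewrite (bigID (mem [set i; j]%SET))/= big1 ?mul1r; last first.
  by move=> k kK; rewrite /B' kK probability_setT.
apply: eq_big => [k|k /negbTE kK]; last by rewrite /B' kK.
  by rewrite finset.in_set2 negb_or.
by rewrite eq_sym.
Qed.

Lemma normal_probN (A : set R) : measurable A ->
  N01 ((fun x => - x) @^-1` A) = N01 A.
Proof.
move=> mA.
(* a quarter turn changes the sign of one of the coordinates *)
have := @normal_pair_rotation R 0 1 setT A _ _ measurableT mA.
rewrite oner_eq0 expr0n/= expr1n add0r => /(_ isT erefl).
rewrite [X in (X * _)%E](@probability_setT _ _ _ N01) mul1e => <-.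
have mA' : measurable ((fun x : R => - x) @^-1` A).
  by rewrite -[X in measurable X]setTI; apply: oppr_measurable.
rewrite -[LHS]mule1 -[X in (_ * X)%E](@probability_setT _ _ _ N01).
rewrite -(product_measure1E N01 N01 mA' measurableT).
congr (product_measure1 _ _ _); apply/seteqP.
by split=> u /=; rewrite mulN1r mul0r addr0 => -[].
Qed.

Lemma iidN_opp {d} {T : measurableType d} (P : probability T R)
    {I : finType} (Y : I -> T -> R) (i : I) : iidN P Y ->
  iidN P (fun k t => if k == i then - Y k t else Y k t).
Proof.
move=> [mY PY]; split=> [k|B mB].
  by case: (k == i) => //; exact: measurableT_comp.
pose B' k := if k == i then (fun x => - x) @^-1` B k else B k.
have mB' k : measurable (B' k).
  rewrite /B'; case: ifP => _//; rewrite -[X in measurable X]setTI.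
  exact: oppr_measurable.
rewrite (_ : [set t | _] = [set t | forall k, B' k (Y k t)]); last first.
  by apply/seteqP; split=> t /= h k; have := h k; rewrite /B'; case: ifP.
rewrite PY//; congr EFin; apply: eq_bigr => k _.
by rewrite /B'; case: ifP => _ //; rewrite normal_probN.
Qed.

End glueing.

Section orthogonal_matrices.
Context {R : realType} {m : nat}.
Implicit Types Q : 'M[R]_m.

Definition orthogonal Q := Q^T *m Q = 1%:M.

Lemma orthogonal_tr Q : orthogonal Q -> Q *m Q^T = 1%:M.
Proof. exact: mulmx1C. Qed.

Lemma orthogonalM Q Q' : orthogonal Q -> orthogonal Q' -> orthogonal (Q *m Q').
Proof.
by rewrite /orthogonal => oQ oQ'; rewrite trmx_mul mulmxA -(mulmxA Q'^T) oQ mulmx1.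
Qed.

Lemma orthogonal_col Q (k l : 'I_m) : orthogonal Q ->
  \sum_i Q i k * Q i l = (k == l)%:R.
Proof.
by move=> /matrixP /(_ k l); rewrite !mxE => <-; apply: eq_bigr => i _; rewrite mxE.
Qed.

Definition givens (i j : 'I_m) (c s : R) : 'M[R]_m := \matrix_(k, l)
  if k == i then c * (l == i)%:R + s * (l == j)%:R
  else if k == j then - s * (l == i)%:R + c * (l == j)%:R else (k == l)%:R.

Lemma sum_delta (F : 'I_m -> R) (i : 'I_m) : \sum_k (k == i)%:R * F k = F i.
Proof.
rewrite (bigD1 i)//= eqxx mul1r big1 ?addr0// => k /negbTE ->.
by rewrite mul0r.
Qed.

Lemma givens_sum (i j : 'I_m) (c s : R) (F : 'I_m -> R) k :
  \sum_l givens i j c s k l * F l =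
  if k == i then c * F i + s * F j
  else if k == j then - s * F i + c * F j else F k.
Proof.
have E (a b : R) : \sum_l (a * (l == i)%:R + b * (l == j)%:R) * F l
    = a * F i + b * F j.
  under eq_bigr do rewrite mulrDl -!mulrA.
  by rewrite big_split/= -!mulr_sumr !sum_delta.
transitivity (\sum_l (if k == i then c * (l == i)%:R + s * (l == j)%:R
  else if k == j then - s * (l == i)%:R + c * (l == j)%:R else (k == l)%:R) * F l).
  by apply: eq_bigr => l _; rewrite mxE.
case: ifP => _; first exact: E.
case: ifP => _; first exact: E.
by under eq_bigr do rewrite eq_sym; exact: sum_delta.
Qed.

Lemma givens_mul (i j : 'I_m) (c s : R) Q k l :
  (givens i j c s *m Q) k l =
  if k == i then c * Q i l + s * Q j l
  else if k == j then - s * Q i l + c * Q j l else Q k l.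
Proof. by rewrite mxE givens_sum. Qed.

Lemma givensK (i j : 'I_m) (c s : R) Q : i != j -> c ^+ 2 + s ^+ 2 = 1 ->
  givens i j c (- s) *m (givens i j c s *m Q) = Q.
Proof.
move=> ij cs; apply/matrixP => k l; rewrite givens_mul.
have ji : (j == i) = false by rewrite eq_sym (negbTE ij).
have [->|/eqP ki] := eqP.
  by rewrite !givens_mul !eqxx ji -[RHS]mul1r -cs; ring.
have [->|/eqP kj] := eqP.
  by rewrite !givens_mul !eqxx ji -[RHS]mul1r -cs; ring.
by rewrite givens_mul (negbTE ki) (negbTE kj).
Qed.

Lemma givens_orthogonal (i j : 'I_m) (c s : R) : i != j ->
  c ^+ 2 + s ^+ 2 = 1 -> orthogonal (givens i j c s).
Proof.
move=> ij cs; have ji : (j == i) = false by rewrite eq_sym (negbTE ij).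
rewrite /orthogonal -[RHS](givensK 1%:M ij cs) mulmx1; congr (_ *m _).
apply/matrixP => k l; rewrite !mxE.
have [?|li] := eqVneq l i; [|have [?|lj] := eqVneq l j];
  (have [?|ki] := eqVneq k i; [|have [?|kj] := eqVneq k j]);
  subst; rewrite ?eqxx ?(negbTE ij) ?ji ?(negbTE li) ?(negbTE lj) ?(negbTE ki)
    ?(negbTE kj) ?[i == _]eq_sym ?[j == _]eq_sym ?(negbTE ki) ?(negbTE kj)
    ?(negbTE li) ?(negbTE lj) ?ji ?(negbTE ij)//=; try ring.
by rewrite eq_sym.
Qed.

End orthogonal_matrices.

Section rotation_invariance.
Context {R : realType} {d : measure_display} {T : measurableType d}.
Variables (P : probability T R) (m : nat).
Implicit Types Q : 'M[R]_m.

Definition lin_image Q (Y : 'I_m -> T -> R) : 'I_m -> T -> R :=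
  fun i t => \sum_j Q i j * Y j t.

Definition preserves_iidN Q := forall Y, iidN P Y -> iidN P (lin_image Q Y).

Lemma preserves_iidNM Q Q' :
  preserves_iidN Q -> preserves_iidN Q' -> preserves_iidN (Q *m Q').
Proof.
move=> pQ pQ' Y nY; rewrite (_ : lin_image _ Y = lin_image Q (lin_image Q' Y)).
  exact/pQ/pQ'.
apply/funext => i; apply/funext => t; rewrite /lin_image.
under eq_bigr do rewrite mxE mulr_suml.
rewrite exchange_big/=; apply: eq_bigr => j _; rewrite mulr_sumr.
by apply: eq_bigr => k _; rewrite mulrA.
Qed.

Lemma preserves_iidN_givens (i j : 'I_m) (c s : R) : i != j -> s != 0 ->
  c ^+ 2 + s ^+ 2 = 1 -> preserves_iidN (givens i j c s).
Proof.
move=> ij s0 cs Y nY; rewrite (_ : lin_image _ Y = fun k t =>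
   if k == i then c * Y i t + s * Y j t
   else if k == j then - s * Y i t + c * Y j t else Y k t).
  exact: iidN_rotation.
by apply/funext => k; apply/funext => t; rewrite /lin_image givens_sum.
Qed.

Definition flip (i : 'I_m) : 'M[R]_m :=
  \matrix_(k, l) ((-1) ^+ (k == i) * (l == k)%:R).

Lemma flip_mul i Q k l : (flip i *m Q) k l = (-1) ^+ (k == i) * Q k l.
Proof.
rewrite mxE; under eq_bigr do rewrite mxE -mulrA.
by rewrite -mulr_sumr sum_delta.
Qed.

Lemma preserves_iidN_flip i : preserves_iidN (flip i).
Proof.
move=> Y nY; rewrite (_ : lin_image _ Y = fun k t =>
   if k == i then - Y k t else Y k t); first exact: iidN_opp.
apply/funext => k; apply/funext => t; rewrite /lin_image.
under eq_bigr do rewrite mxE -mulrA.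
by rewrite -mulr_sumr sum_delta; case: eqP => _; rewrite ?mulN1r ?mul1r.
Qed.

Lemma flipK i Q : flip i *m (flip i *m Q) = Q.
Proof.
by apply/matrixP => k l; rewrite !flip_mul mulrA -expr2 sqrr_sign mul1r.
Qed.

Lemma flip_orthogonal i : orthogonal (flip i).
Proof.
rewrite /orthogonal -[RHS](flipK i) mulmx1; congr (_ *m _).
apply/matrixP => k l; rewrite !mxE; case: (eqVneq k l) => [->//|kl].
by rewrite !mulr0.
Qed.

(** Gaussian elimination by plane rotations: an orthogonal matrix fixing the
    first [k] basis vectors is brought, by rotations of the planes spanned by
    the [k]-th and a later basis vector, and possibly one sign change, to one
    that fixes the first [k.+1] of them. *)
Lemma orthogonal_preserves_iidN Q : orthogonal Q -> preserves_iidN Q.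
Proof.
suff fix_ind n : forall k Q, (m - k <= n)%N -> (k <= m)%N -> orthogonal Q ->
    (forall i l : 'I_m, (l < k)%N -> Q i l = (i == l)%:R) -> preserves_iidN Q.
  by move=> oQ; apply: (fix_ind m 0%N) => //; rewrite subn0.
elim: n => [|n IHn] k {}Q.
  move=> mk km oQ Qfix Y nY; have {mk km} mk : k = m by lia.
  rewrite (_ : lin_image Q Y = Y)//.
  apply/funext => i; apply/funext => t; rewrite /lin_image.
  under eq_bigr do rewrite Qfix ?mk// eq_sym.
  by rewrite sum_delta.
have [->|mk0] := eqVneq k m.
  by move=> *; apply: (IHn m) => //; rewrite subnn.
move=> mk km oQ Qfix; have {}km : (k < m)%N by rewrite ltn_neqAle mk0.
pose k0 := Ordinal km.
have [N NE] : {N | N = #|[set i : 'I_m | (k0 < i)%N && (Q i k0 != 0)]%SET|}.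
  by exists #|[set i : 'I_m | (k0 < i)%N && (Q i k0 != 0)]%SET|.
elim: N Q NE oQ Qfix => [|N IHN] Q NE oQ Qfix.
  have Q0 i : i != k0 -> Q i k0 = 0.
    move=> ik; case: (ltngtP i k0) => [ik0|ik0|ik0].
    - have := orthogonal_col i k0 oQ; rewrite (negbTE ik).
      by under eq_bigr do rewrite Qfix//; rewrite sum_delta.
    - have /setP/(_ i) : [set i : 'I_m | (k0 < i)%N && (Q i k0 != 0)]%SET = finset.set0.
        by apply/eqP; rewrite -cards_eq0 -NE.
      by rewrite !finset.inE ik0 => /negbFE/eqP.
    - by move: ik; rewrite -val_eqE/= ik0 eqxx.
  have Qk2 : Q k0 k0 ^+ 2 = 1.
    have := orthogonal_col k0 k0 oQ; rewrite eqxx (bigD1 k0)//= big1 ?addr0//.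
    by move=> i /Q0 ->; rewrite mul0r.
  have fixS Q' : orthogonal Q' -> (forall i l : 'I_m, (l < k)%N -> Q' i l = (i == l)%:R) ->
     (forall i, Q' i k0 = (i == k0)%:R) -> preserves_iidN Q'.
    move=> oQ' f1 f2; apply: (IHn k.+1) => //; first by lia.
    move=> i l; rewrite ltnS leq_eqVlt => /predU1P[lk|]; last exact: f1.
    by rewrite (_ : l = k0) ?f2//; exact: val_inj.
  move/eqP: Qk2; rewrite sqrf_eq1 => /orP[]/eqP Qk.
    apply: fixS => // i; have [->//|/Q0 ->//] := eqVneq i k0.
  rewrite -(flipK k0 Q); apply: preserves_iidNM; first exact: preserves_iidN_flip.
  apply: fixS => [|i l lk|i]; first by apply: orthogonalM => //; exact: flip_orthogonal.
    rewrite flip_mul Qfix//; case: (eqVneq i k0) => [ik|_]; last by rewrite mul1r.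
    by case: eqP => [il|_]; rewrite ?mulr0//; move: lk; rewrite -il ik ltnn.
  rewrite flip_mul; case: (eqVneq i k0) => [->|/Q0 ->]; last by rewrite mulr0.
  by rewrite Qk mulN1r opprK.
have /card_gt0P[i] : (0 < #|[set i : 'I_m | (k0 < i)%N && (Q i k0 != 0)%R]%SET|)%N by rewrite -NE.
rewrite finset.inE => /andP[ki Qi0].
have k0i : k0 != i by rewrite -val_eqE/= ltn_eqF.
have ik0 : (i == k0) = false by rewrite eq_sym (negbTE k0i).
pose r := Num.sqrt (Q k0 k0 ^+ 2 + Q i k0 ^+ 2).
have r2 : r ^+ 2 = Q k0 k0 ^+ 2 + Q i k0 ^+ 2.
  by rewrite sqr_sqrtr// addr_ge0 ?sqr_ge0.
have r0 : r != 0.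
  by rewrite -sqrf_eq0 r2 paddr_eq0 ?sqr_ge0// negb_and !sqrf_eq0 Qi0 orbT.
pose c := Q k0 k0 / r; pose s := Q i k0 / r.
have s0 : s != 0 by rewrite mulf_neq0 ?invr_eq0.
have cs : c ^+ 2 + s ^+ 2 = 1.
  by rewrite !exprMn -mulrDl -r2 -exprMn divff// expr1n.
rewrite -(givensK Q k0i cs); apply: preserves_iidNM.
  by apply: preserves_iidN_givens; rewrite ?oppr_eq0 ?sqrrN.
apply: IHN.
- apply/eqP; rewrite -eqSS NE; apply/eqP.
  rewrite (cardsD1 i) finset.inE ki Qi0 add1n; congr _.+1; apply: eq_card => l.
  rewrite !finset.inE givens_mul.
  have [->|li] := eqVneq l i.
    rewrite ik0 /c /s (_ : _ + _ = 0) ?eqxx ?andbF//.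
    by field.
  by have [->|//] := eqVneq l k0; rewrite ltnn.
- exact/orthogonalM/oQ/givens_orthogonal.
- move=> l l' l'k; rewrite givens_mul !Qfix//.
  have kl' : (k0 == l') = false by rewrite -val_eqE/= gtn_eqF.
  have il' : (i == l') = false by rewrite -val_eqE/= gtn_eqF// (ltn_trans l'k).
  rewrite kl' il' !mulr0 addr0.
  by case: eqP => [->|_]; [rewrite kl'|case: eqP => [->|_//]; rewrite il'].
Qed.

End rotation_invariance.

(** * Symmetric matrices: spectral theorem and Ky Fan's principle *)

Section spectral_theorem.
Context {R : realType}.

Lemma trmx_mul_col {m} (v : 'cV[R]_m) : v^T *m v = (\sum_i v i 0 ^+ 2)%:M.
Proof.
apply/matrixP => i j; rewrite !ord1 !mxE eqxx mulr1n; apply: eq_bigr => k _.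
by rewrite mxE expr2.
Qed.

Lemma sum_sqr_gt0 {m} (v : 'cV[R]_m) : v != 0 -> 0 < \sum_i v i 0 ^+ 2.
Proof.
move=> v0; rewrite lt_neqAle sumr_ge0 ?andbT => [|i _]; last exact: sqr_ge0.
apply: contra_neq v0 => /esym/eqP; rewrite psumr_eq0 => [/allP h|i _]; last exact: sqr_ge0.
apply/matrixP => i j; rewrite !ord1 mxE; apply/eqP.
by rewrite -sqrf_eq0; apply: h; rewrite mem_index_enum.
Qed.

(** A Householder reflection carries the first basis vector to any given unit
    vector. *)
Lemma orthogonal_first_col {m} (v : 'cV[R]_m.+1) : v^T *m v = 1%:M ->
  exists2 H : 'M[R]_m.+1, orthogonal H & col 0 H = v.
Proof.
move=> v1; pose e : 'cV[R]_m.+1 := delta_mx 0 0.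
have [->|ve] := eqVneq v e.
  exists 1%:M; first by rewrite /orthogonal trmx1 mulmx1.
  by apply/matrixP => i j; rewrite !ord1 !mxE andbT.
pose w := v - e; have w0 : w != 0 by rewrite subr_eq0.
pose a := \sum_i w i 0 ^+ 2; have a0 : a != 0 by rewrite gt_eqF ?sum_sqr_gt0.
have wa : w^T *m w = a%:M by exact: trmx_mul_col.
have we : w^T *m e = (- (a / 2))%:M.
  have e1 : e^T *m e = 1%:M.
    by rewrite trmx_delta mul_delta_mx; apply/matrixP => i j; rewrite !ord1 !mxE.
  have ev : e^T *m v = v^T *m e.
    by rewrite -[RHS]trmxK trmx_mul trmxK [RHS](_ : _ = e^T *m v)//;
       apply/matrixP => i j; rewrite !ord1 mxE.
  have := wa; rewrite /w [(v - e)^T]linearB/= mulmxBl !mulmxBr v1 e1 ev.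
  rewrite mulmxBl e1 [v^T *m e]mx11_scalar; move: ((v^T *m e) 0 0) => x h.
  apply/matrixP => i j; move/matrixP: h => /(_ i j); rewrite !ord1 !mxE !eqxx.
  by rewrite !mulr1n => h; rewrite -[a]h; field.
(* the reflection in the hyperplane orthogonal to [w = v - e] *)
exists (1%:M - (2 / a) *: (w *m w^T)); last first.
  rewrite colE -/e mulmxBl mul1mx -scalemxAl -mulmxA we mul_mx_scalar scalerA.
  rewrite (_ : 2 / a * - (a / 2) = -1); last by field.
  by rewrite scaleN1r opprK /w addrC subrK.
rewrite /orthogonal [(1%:M - _)^T]linearB/= trmx1 [(_ *: _)^T]linearZ/= trmx_mul trmxK.
rewrite mulmxBl mul1mx mulmxBr mulmx1 -scalemxAl -scalemxAr.
rewrite (_ : w *m w^T *m (w *m w^T) = a *: (w *m w^T)); last first.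
  by rewrite mulmxA -(mulmxA w) wa mul_mx_scalar -scalemxAl.
rewrite !scalerA (_ : 2 / a * (2 / a) * a = 2 / a + 2 / a); last by field.
by rewrite scalerDl; move: (_ *: _) => M; rewrite opprB [M + M]addrC addrK subrK.
Qed.

Lemma char_poly_conj {m} (A H : 'M[R]_m) : orthogonal H ->
  char_poly (H^T *m A *m H) = char_poly A.
Proof.
move=> oH; rewrite /char_poly /char_poly_mx.
pose f := map_mx (@polyC R) : 'M[R]_m -> 'M[{poly R}]_m.
have -> : 'X%:M - f (H^T *m A *m H) = f H^T *m ('X%:M - f A) *m f H.
  rewrite /f !map_mxM mulmxBr mulmxBl; congr (_ - _).
  by rewrite scalar_mxC -mulmxA -map_mxM oH map_mx1 mulmx1.
rewrite !det_mulmx mulrAC -det_mulmx /f -map_mxM oH map_mx1.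
by rewrite det1 mul1r.
Qed.

Lemma char_poly_block {m n} (A : 'M[R]_m) (B : 'M[R]_n) :
  char_poly (block_mx A 0 0 B) = char_poly A * char_poly B.
Proof. by rewrite /char_poly char_block_diag_mx det_ublock. Qed.

(** Real spectral theorem.  The splitting of the characteristic polynomial is
    assumed, so that an eigenvector is available at each step. *)
Lemma spectral_symmetric {m} (A : 'M[R]_m) (s : seq R) : A^T = A ->
  char_poly A = \prod_(t <- s) ('X - t%:P) ->
  exists2 Q : 'M[R]_m, orthogonal Q &
    A = Q *m diag_mx (\row_i s`_i) *m Q^T.
Proof.
elim: s m A => [|t s IHs] m A symA cA.
  have m0 : m = 0%N.
    by have := size_char_poly A; rewrite cA big_nil size_poly1 => -[].
  subst m; exists 1%:M; first by rewrite /orthogonal trmx1 mulmx1.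
  by apply/matrixP => -[].
have : root (char_poly A) t.
  by rewrite cA big_cons rootM root_XsubC eqxx.
case: m A symA cA => [|m] A symA cA.
  by have := size_char_poly A; rewrite cA (size_prod_XsubC _ id).
rewrite -eigenvalue_root_char => /eigenvalueP[v0 Av0 v00].
pose v := (Num.sqrt (\sum_i v0^T i 0 ^+ 2))^-1 *: v0^T.
have v0T : v0^T != 0 by rewrite trmx_eq0.
have v1 : v^T *m v = 1%:M.
  rewrite /v [(_ *: _)^T]linearZ/= -scalemxAl -scalemxAr scalerA trmx_mul_col.
  rewrite scale_scalar_mx; congr (_%:M); set x := \sum_i _.
  have x0 : 0 < x by exact: sum_sqr_gt0.
  by rewrite -invfM -expr2 sqr_sqrtr ?ltW// mulVf// gt_eqF.
have Av : A *m v = t *: v.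
  rewrite /v -scalemxAr scalerA mulrC -scalerA; congr (_ *: _).
  by rewrite -[LHS]trmxK trmx_mul trmxK symA Av0 linearZ.
have [H oH Hv] := orthogonal_first_col v1.
pose B : 'M[R]_(1 + m) := H^T *m A *m H.
have BD : B = H^T *m A *m H by [].
clearbody B.
have symB : B^T = B by rewrite BD !trmx_mul trmxK symA mulmxA.
have HHt := orthogonal_tr oH.
have B0 : col 0 B = t *: delta_mx 0 0.
  rewrite !colE BD -!mulmxA -colE Hv Av -scalemxAr; congr (_ *: _).
  by rewrite -Hv colE mulmxA oH mul1mx.
have BE : B = block_mx t%:M 0 0 (drsubmx B).
  have dl i : B (rshift 1 i) (lshift m 0) = 0.
    have /matrixP/(_ (rshift 1 i) 0) := B0.
    by rewrite (_ : lshift m 0 = 0) ?mxE//; [move=> ->; rewrite mulr0|exact: val_inj].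
  rewrite -[LHS]submxK; congr block_mx.
  - apply/matrixP => i j; rewrite !ord1 !mxE.
    have /matrixP/(_ 0 0) := B0; rewrite !mxE !eqxx mulr1 => <-.
    by congr (B _ _); apply: val_inj.
  - by apply/matrixP => i j; rewrite !ord1 !mxE -symB mxE dl.
  - by apply/matrixP => i j; rewrite !ord1 !mxE dl.
have symB' : (drsubmx B)^T = drsubmx B by rewrite trmx_drsub symB.
have [|Q' oQ' BQ'] := IHs m (drsubmx B) symB'.
  apply: (@mulfI _ ('X - t%:P)); first by rewrite polyXsubC_eq0.
  have <- : char_poly B = ('X - t%:P) * \prod_(t <- s) ('X - t%:P).
    by rewrite BD char_poly_conj// cA big_cons.
  rewrite [in RHS]BE char_poly_block; congr (_ * _).
  by rewrite /char_poly /char_poly_mx det_mx11 !mxE.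
pose Q : 'M[R]_(1 + m) := H *m (block_mx 1%:M 0 0 Q' : 'M[R]_(1 + m)).
exists Q.
  suff oB : orthogonal (block_mx 1%:M 0 0 Q' : 'M[R]_(1 + m)).
    exact: (@orthogonalM _ (1 + m)).
  rewrite /orthogonal tr_block_mx mulmx_block.
  by rewrite !trmx0 trmx1 !mulmx0 !mul0mx !mulmx1 oQ' !(addr0, add0r) -scalar_mx_block.
have AE : A = H *m B *m H^T.
  by rewrite BD !mulmxA HHt mul1mx -mulmxA HHt mulmx1.
have DE : diag_mx (\row_i (t :: s)`_i) =
    block_mx t%:M 0 0 (diag_mx (\row_i s`_i)) :> 'M[R]_(1 + m).
  apply/matrixP => i j; rewrite !mxE.
  case: split_ordP => k ->; rewrite !mxE; case: split_ordP => l ->; rewrite ?mxE.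
  - by rewrite !ord1.
  - by rewrite -val_eqE/= ord1.
  - by rewrite -val_eqE/= ord1.
  - by rewrite -!val_eqE/= !add1n eqSS.
pose K : 'M[R]_(1 + m) := block_mx 1%:M 0 0 Q'.
have BK : B = K *m diag_mx (\row_i (t :: s)`_i) *m K^T.
  rewrite DE BE BQ' /K tr_block_mx !trmx0 trmx1 !mulmx_block.
  by rewrite !mulmx0 !mul0mx !mul1mx !mulmx1 !(addr0, add0r) mul0mx.
by rewrite AE BK /Q (@trmx_mul _ (1 + m) (1 + m) (1 + m)) !mulmxA.
Qed.

End spectral_theorem.

Section euclidean.
Context {R : realType} {I : finType}.
Implicit Types f g : I -> R.

Definition dot f g : R := \sum_i f i * g i.
Definition nrm f : R := Num.sqrt (dot f f).

Lemma dotC f g : dot f g = dot g f.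
Proof. by apply: eq_bigr => i _; rewrite mulrC. Qed.

Lemma dotDr f g h : dot f (g + h) = dot f g + dot f h.
Proof. by rewrite -big_split; apply: eq_bigr => i _; exact: mulrDr. Qed.

Lemma dotZr a f g : dot f (a *: g) = a * dot f g.
Proof. by rewrite mulr_sumr; apply: eq_bigr => i _; exact: mulrCA. Qed.

Lemma dotDl f g h : dot (f + g) h = dot f h + dot g h.
Proof. by rewrite dotC dotDr !(dotC h). Qed.

Lemma dotZl a f g : dot (a *: f) g = a * dot f g.
Proof. by rewrite dotC dotZr dotC. Qed.

Lemma dot_ge0 f : 0 <= dot f f.
Proof. by apply: sumr_ge0 => i _; rewrite -expr2 sqr_ge0. Qed.

Lemma dot_eq0 f : dot f f = 0 -> forall i, f i = 0.
Proof.
move=> /eqP; rewrite psumr_eq0 => [/allP h i|i _]; last by rewrite -expr2 sqr_ge0.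
by have := h i (mem_index_enum _); rewrite -expr2 sqrf_eq0 => /eqP.
Qed.

Lemma dot_CS f g : dot f g ^+ 2 <= dot f f * dot g g.
Proof.
have [g0|g0] := eqVneq (dot g g) 0.
  rewrite g0 mulr0 [dot f g]big1 ?expr0n// => i _.
  by rewrite (dot_eq0 g0) mulr0.
have gp : 0 < dot g g by rewrite lt_neqAle eq_sym g0 dot_ge0.
have := dot_ge0 (dot g g *: f + (- dot f g) *: g).
rewrite !(dotDl, dotDr, dotZl, dotZr) (dotC g f) => h.
have : 0 <= dot g g * (dot f f * dot g g - dot f g ^+ 2) by apply: le_trans h _; lra.
by rewrite pmulr_rge0// subr_ge0.
Qed.

Lemma nrm_ge0 f : 0 <= nrm f. Proof. exact: sqrtr_ge0. Qed.

Lemma nrm_sqr f : nrm f ^+ 2 = dot f f.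
Proof. by rewrite sqr_sqrtr// dot_ge0. Qed.

Lemma dot_le_nrm f g : dot f g <= nrm f * nrm g.
Proof.
apply: le_trans (ler_norm _) _.
rewrite -(@ler_pXn2r _ 2)// ?nnegrE ?mulr_ge0 ?nrm_ge0//.
by rewrite -normrX ger0_norm ?sqr_ge0// exprMn !nrm_sqr dot_CS.
Qed.

Lemma nrm_triangle f g : nrm (f + g) <= nrm f + nrm g.
Proof.
rewrite -(@ler_pXn2r _ 2)// ?nnegrE ?addr_ge0 ?nrm_ge0//.
rewrite nrm_sqr !(dotDl, dotDr) (dotC g f) sqrrD !nrm_sqr.
by have := dot_le_nrm f g; lra.
Qed.

Lemma nrmZ a f : nrm (a *: f) = `|a| * nrm f.
Proof. by rewrite /nrm dotZl dotZr mulrA -expr2 sqrtrM ?sqr_ge0// sqrtr_sqr. Qed.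

End euclidean.

Section ky_fan.
Context {R : realType}.

Lemma sorted_nth_ge (s : seq R) i j : sorted >=%R s ->
  (i <= j)%N -> (j < size s)%N -> s`_j <= s`_i.
Proof.
move=> ss ij js; apply: (@sorted_leq_nth _ (fun x y : R => y <= x) _ _ _ _ ss).
- by move=> x y z yx xz; exact: le_trans xz yx.
- exact: lexx.
- by rewrite inE (leq_ltn_trans ij).
- by rewrite inE.
- exact: ij.
Qed.

Context {m : nat} (A : 'M[R]_m) (s : seq R).
Hypotheses (symA : A^T = A) (es : eigenvalues_of A s).

Lemma size_eigenvalues : size s = m.
Proof.
have [_ cA] := es; have := size_char_poly A.
by rewrite cA (size_prod_XsubC _ id) => -[].
Qed.

Lemma spectral_eigenvalues_of :
  exists2 Q : 'M[R]_m, orthogonal Q & A = Q *m diag_mx (\row_i s`_i) *m Q^T.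
Proof. by have [_] := es; exact: spectral_symmetric. Qed.

Lemma trace_eigenvalues : \tr A = \sum_(i < m) s`_i.
Proof.
have [Q oQ ->] := spectral_eigenvalues_of.
rewrite -mulmxA mxtrace_mulC -mulmxA oQ mulmx1 mxtrace_diag.
by apply: eq_bigr => i _; rewrite mxE.
Qed.

Lemma eigenvalues_ge0 : (forall v : 'cV[R]_m, 0 <= (v^T *m A *m v) 0 0) ->
  forall i, 0 <= s`_i.
Proof.
move=> A0 i; have [im|mi] := ltnP i m; last by rewrite nth_default ?size_eigenvalues.
have [Q oQ AE] := spectral_eigenvalues_of.
have := A0 (col (Ordinal im) Q); rewrite AE colE trmx_mul.
rewrite !mulmxA -(mulmxA _ Q^T Q) oQ mulmx1 -(mulmxA _ Q^T Q) oQ mulmx1.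
rewrite trmx_delta -rowE -colE !mxE eqxx mulr1n.
by [].
Qed.

(** Ky Fan's maximum principle: in an eigenbasis the trace over a [k]-frame is
    an average of the eigenvalues with weights at most 1 and total weight [k]. *)
Lemma ky_fan k (U : 'M[R]_(m, k)) : U^T *m U = 1%:M -> (k <= m)%N ->
  \tr (U^T *m A *m U) <= \sum_(j < k) s`_j.
Proof.
move=> U1 km; have [ss _] := es.
have [Q oQ AE] := spectral_eigenvalues_of.
pose V := Q^T *m U.
have VE : V = Q^T *m U by [].
clearbody V.
have V1 : V^T *m V = 1%:M.
  by rewrite VE trmx_mul trmxK mulmxA -(mulmxA _ Q) (orthogonal_tr oQ) mulmx1.
pose q l := \sum_(j < k) V l j ^+ 2.
have q0 l : 0 <= q l by apply: sumr_ge0 => j _; exact: sqr_ge0.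
have qsum : \sum_l q l = k%:R.
  rewrite exchange_big/= -(@mxtrace1 _ k) -V1; apply: eq_bigr => j _.
  by rewrite !mxE; apply: eq_bigr => l _; rewrite mxE expr2.
have q1 l : q l <= 1.
  pose x := V *m (row l V)^T.
  have xl : x l 0 = q l.
    by rewrite mxE; apply: eq_bigr => j _; rewrite !mxE expr2.
  have : (x^T *m x) 0 0 = q l.
    rewrite /x trmx_mul trmxK -mulmxA (mulmxA V^T) V1 mul1mx mxE.
    by apply: eq_bigr => j _; rewrite !mxE expr2.
  rewrite trmx_mul_col !mxE eqxx mulr1n (bigD1 l)//= xl => h.
  have : q l ^+ 2 <= q l.
    by rewrite -[leRHS]h lerDl sumr_ge0// => i _; exact: sqr_ge0.
  rewrite expr2 => h2; have := q0 l; rewrite le_eqVlt => /predU1P[<-//|ql].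
  by move: h2; rewrite -[leRHS]mulr1 ler_pM2l.
have trE : \tr (U^T *m A *m U) = \sum_(l < m) s`_l * q l.
  rewrite AE (_ : _ *m U = V^T *m (diag_mx (\row_i s`_i) *m V)); last first.
    by rewrite VE trmx_mul trmxK !mulmxA.
  rewrite mxtrace_mulC -mulmxA mul_diag_mx; apply: eq_bigr => l _; rewrite !mxE.
  by congr (_ * _); apply: eq_bigr => j _; rewrite !mxE expr2.
(* subtracting the [k]-th eigenvalue makes the terms of index below [k]
   nonnegative and the others nonpositive *)
rewrite trE; pose c := s`_k.-1.
have sumk (F : nat -> R) : \sum_(j < k) F j = \sum_(l < m | (l < k)%N) F l.
  exact: big_ord_widen.
rewrite (sumk (nth 0 s)).
have -> : \sum_(l < m) s`_l * q l = \sum_(l < m) (s`_l - c) * q l + c * k%:R.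
  by rewrite -qsum mulr_sumr -big_split; apply: eq_bigr => l _ /=; lra.
have -> : \sum_(l < m | (l < k)%N) s`_l
    = \sum_(l < m | (l < k)%N) (s`_l - c) + c * k%:R.
  transitivity (\sum_(l < m | (l < k)%N) (s`_l - c) + \sum_(j < k) c).
    rewrite (sumk (fun=> c)) -big_split/=.
    by apply: eq_bigr => l _; rewrite subrK.
  by rewrite sumr_const card_ord mulr_natr.
rewrite lerD2r [leLHS](bigID (fun l : 'I_m => (l < k)%N))/=.
rewrite -[leRHS]addr0 lerD//.
  apply: ler_sum => l lk; rewrite -[leRHS]mulr1 ler_wpM2l// subr_ge0.
  by apply: sorted_nth_ge; rewrite ?size_eigenvalues; lia.
apply: sumr_le0 => l; rewrite -leqNgt => kl; have lm := ltn_ord l.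
rewrite mulr_le0_ge0// subr_le0.
by apply: sorted_nth_ge; rewrite ?size_eigenvalues; lia.
Qed.

End ky_fan.

(** * Seminorms and their kinks *)

Section seminorm.
Context {R : realType} {I : finType}.

Definition seminorm (N : (I -> R) -> R) : Prop :=
  (forall y z, N (y + z) <= N y + N z) /\
  (forall (a : R) y, N (a *: y) = `|a| * N y).

Definition basis (i : I) : I -> R := fun j => (j == i)%:R.

Variable N : (I -> R) -> R.
Hypothesis sN : seminorm N.

Let Ntri y z : N (y + z) <= N y + N z. Proof. exact: sN.1. Qed.
Let NZ a y : N (a *: y) = `|a| * N y. Proof. exact: sN.2. Qed.

Lemma seminorm0 : N 0 = 0.
Proof. by rewrite -[X in N X](scale0r 0) NZ normr0 mul0r. Qed.

Lemma seminormN y : N (- y) = N y.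
Proof. by rewrite -scaleN1r NZ normrN1 mul1r. Qed.

Lemma seminorm_ge0 y : 0 <= N y.
Proof.
by have := Ntri y (- y); rewrite subrr seminorm0 seminormN; lra.
Qed.

Lemma seminorm_sum (J : finType) (f : J -> I -> R) :
  N (\sum_j f j) <= \sum_j N (f j).
Proof.
elim/big_ind2: _ => [|x a y b xa yb|//]; first by rewrite seminorm0.
by apply: le_trans (Ntri _ _) _; exact: lerD.
Qed.

Lemma sum_basis (y : I -> R) : \sum_i y i *: basis i = y.
Proof.
apply/funext => j; rewrite fct_sumE (bigD1 j)//= big1 ?addr0.
  by rewrite [LHS](_ : _ = y j * (j == j)%:R)// eqxx mulr1.
by move=> i ij; rewrite [LHS](_ : _ = y i * (j == i)%:R)// eq_sym (negbTE ij) mulr0.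
Qed.

Lemma seminorm_le y : N y <= \sum_i `|y i| * N (basis i).
Proof.
rewrite -{1}(sum_basis y); apply: le_trans (seminorm_sum _) _.
by apply: ler_sum => i _; rewrite NZ.
Qed.

Lemma seminorm_near y z r : (forall i, `|y i - z i| <= r) ->
  N y <= N z + r * \sum_i N (basis i).
Proof.
move=> h; rewrite -{1}(subrK z y) addrC; apply: le_trans (Ntri _ _) _.
rewrite lerD2l; apply: le_trans (seminorm_le _) _; rewrite mulr_sumr.
by apply: ler_sum => i _; rewrite ler_wpM2r ?seminorm_ge0//; exact: h.
Qed.

(** A seminorm is continuous for the sup norm, so its open sublevel sets are
    countable unions of boxes with rational centre and radius. *)
Lemma measurable_seminorm : measurable_fun setT (N : @borel_vec R I -> R).
Proof.
pose C := \sum_i N (basis i).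
have C0 : 0 <= C by apply: sumr_ge0 => i _; exact: seminorm_ge0.
pose F (u : {ffun I -> rat} * rat) : set (@borel_vec R I) :=
  box (fun i => ball (ratr (u.1 i) : R) (ratr u.2)).
apply: (measurability _ (RGenInftyO.measurableE R)) => // _ [_ [c ->] <-].
rewrite setTI.
have -> : N @^-1` `]-oo, c[%classic = \bigcup_(u in [set u : {ffun I -> rat} * rat | N (fun i => ratr (u.1 i)) + ratr u.2 * C < c]) F u.
  apply/seteqP; split=> [y /=|y [u /= uc Fy]]; rewrite in_itv/=; last first.
    apply: le_lt_trans uc; apply: seminorm_near => i.
    by have := Fy i; rewrite /ball/= distrC => /ltW.
  move=> Nyc.
  have [r /andP[r0 rC]] : exists r : rat, (0 < (ratr r : R)) && (2 * ratr r * C < c - N y).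
    have D0 : 0 < (c - N y) / (2 * (C + 1)).
      by rewrite divr_gt0 ?subr_gt0// mulr_gt0// ltr_wpDl.
    have [r] := rat_in_itvoo D0; rewrite in_itv/= => /andP[r0 rD].
    exists r; rewrite r0/=; move: rD; rewrite ltr_pdivlMr; last by rewrite mulr_gt0// ltr_wpDl.
    by apply: le_lt_trans; nra.
  have ex i : exists q : rat, `|y i - ratr q| < ratr r.
    have : y i - ratr r < y i + ratr r by rewrite ltrBlDr -addrA ltrDl addr_gt0.
    move=> /rat_in_itvoo[q]; rewrite in_itv/= => /andP[h1 h2]; exists q.
    by rewrite ltr_norml; lra.
  pose q i := projT1 (cid (ex i)).
  exists ([ffun i => q i], r) => /=.
    apply: le_lt_trans (_ : N y + ratr r * C + ratr r * C < c); last by lra.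
    rewrite lerD2r; apply: seminorm_near => i; rewrite ffunE distrC ltW//.
    exact: (projT2 (cid (ex i))).
  by move=> i; rewrite /ball/= ffunE distrC; exact: (projT2 (cid (ex i))).
rewrite bigcup_mkcond; apply: countable_bigcupT_measurable => [|u].
  exact: countableP.
case: ifP => // _; apply: measurable_box => i; exact: measurable_ball.
Qed.

End seminorm.

Section kinks.
Context {R : realType} {I : finType}.
Local Notation N01 := (@normal_prob R 0 1).
Local Notation V := (@borel_vec R I).

Variable N : (I -> R) -> R.
Hypothesis sN : seminorm N.

Lemma seminorm_slope_le (y v : I -> R) (h k : R) : 0 < h -> h <= k ->
  (N (y + h *: v) - N y) / h <= (N (y + k *: v) - N y) / k.
Proof.
move=> h0 hk; have k0 : 0 < k by exact: lt_le_trans hk.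
have [tri hom] := sN.
have E : y + h *: v = (1 - h / k) *: y + (h / k) *: (y + k *: v).
  rewrite scalerDr scalerA divfK ?gt_eqF// scalerBl scale1r.
  by rewrite addrA subrK.
have hk1 : 0 <= 1 - h / k by rewrite subr_ge0 ler_pdivrMr// mul1r.
have hk0 : 0 <= h / k by rewrite divr_ge0// ltW.
have : N (y + h *: v) <= (1 - h / k) * N y + (h / k) * N (y + k *: v).
  by rewrite {1}E; apply: le_trans (tri _ _) _; rewrite !hom !ger0_norm.
move=> le1; rewrite ler_pdivrMr//.
rewrite (_ : _ / k * h = (h / k) * N (y + k *: v) - (h / k) * N y); last by lra.
lra.
Qed.

(** [kink i q q'] collects the points where the convex function
    [x |-> N (y + x *: basis i)] has the two slopes [q < q'] as subgradients
    at 0. *)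
Definition kink (i : I) (q q' : R) : set V := \bigcap_m
  [set y | N y + q' * m.+1%:R^-1 <= N (y + m.+1%:R^-1 *: basis i) /\
           N y - q * m.+1%:R^-1 <= N (y + (- m.+1%:R^-1) *: basis i)].

Lemma measurable_shift (a : R) (v : I -> R) :
  measurable_fun setT (fun y : V => y + a *: v : V).
Proof.
apply: (@measurable_vec R I _ V (fun i y => y i + a * v i)) => i.
by apply: measurable_funD => //; exact: measurable_coord.
Qed.

Lemma measurable_kink i q q' : measurable (kink i q q').
Proof.
have mN := measurable_seminorm sN.
apply: bigcap_measurableType => m _; apply: measurableI.
  rewrite -[X in measurable X]setTI; apply: measurable_fun_le => //.
    exact: measurable_funD.
  exact: (measurableT_comp mN (measurable_shift _ _)).
rewrite -[X in measurable X]setTI; apply: measurable_fun_le => //.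
  exact: measurable_funB.
exact: (measurableT_comp mN (measurable_shift _ _)).
Qed.

Definition upd (y : I -> R) (i : I) (x : R) : I -> R :=
  fun k => if k == i then x else y k.

Lemma upd_shift y i x x' : upd y i x' = upd y i x + (x' - x) *: basis i.
Proof.
apply/funext => k; rewrite /upd [RHS]/(_ + _).
rewrite [X in _ = _ + X](_ : _ = (x' - x) * (k == i)%:R)//.
by case: eqP => _; rewrite ?mulr1 ?mulr0 ?addr0// addrC subrK.
Qed.

(** The right slope at [x] is at least [q'] and the left slope at [x'] at most [q];
    for [x < x'] this contradicts convexity. *)
Lemma kink_line_subsingleton i q q' y x x' : q < q' ->
  kink i q q' (upd y i x) -> kink i q q' (upd y i x') -> x = x'.
Proof.
move=> qq' k1 k2; wlog xx' : x x' k1 k2 / x < x'.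
  move=> wl; case: (ltgtP x x') => // h; first exact: wl.
  by apply/esym/wl.
have D0 : 0 < x' - x by rewrite subr_gt0.
have [m mD] : exists m, (m.+1%:R^-1 : R) <= x' - x.
  have [m _] := near_infty_natSinv_lt (PosNum D0).
  by move=> /(_ m (leqnn _))/= /ltW h; exists m.
have m0 : 0 < (m.+1%:R^-1 : R) by rewrite invr_gt0.
have [r1 _] := k1 m Logic.I; have [_ l2] := k2 m Logic.I.
have s1 := seminorm_slope_le (upd y i x) (basis i) m0 mD.
have s2 := seminorm_slope_le (upd y i x') (- basis i) m0 mD.
rewrite -upd_shift in s1.
rewrite !scalerN -!scaleNr opprB -upd_shift in s2.
have {}s1 : q' <= (N (upd y i x') - N (upd y i x)) / (x' - x).
  by apply: le_trans s1; rewrite ler_pdivlMr// lerBrDl; exact: r1.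
have {}s2 : - q <= (N (upd y i x) - N (upd y i x')) / (x' - x).
  by apply: le_trans s2; rewrite ler_pdivlMr// lerBrDl mulNr; exact: l2.
move: s1 s2; rewrite !ler_pdivlMr// => s1 s2.
have : q' * (x' - x) <= q * (x' - x) by lra.
by rewrite ler_pM2r// leNgt qq'.
Qed.

Lemma normal_prob_subsingleton (A : set R) : measurable A ->
  (forall x x', A x -> A x' -> x = x') -> N01 A = 0%E.
Proof.
move=> mA sA; have /null_content_dominatesP := @normal_prob_dominates R 0 1.
apply=> //; apply: countable_lebesgue_measure0.
have [->|/set0P[x Ax]] := eqVneq A set0; first exact: countable0.
rewrite (_ : A = [set x]); first exact: countable1.
by apply/seteqP; split=> [y Ay|y ->//]; exact: sA.
Qed.

(** Given the other coordinates, a convex function of one coordinate has at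
    most one point with prescribed distinct subgradients, and that coordinate
    has no atom. *)
Lemma kink_null {d} {T : measurableType d} (P : probability T R)
    (g : I -> T -> R) i q q' : iidN P g -> q < q' ->
  P [set t | kink i q q' (fun k => g k t)] = 0%E.
Proof.
move=> ng qq'; have mK := measurable_kink i q q'.
rewrite (iidN_law ng (iidN_resample i ng) mK).
have mG := measurable_vec (iidN_resample i ng).1.
set E := [set ut | _].
have mE : measurable E by rewrite -[X in measurable X]setTI; exact: mG.
transitivity ((N01 \x^ P)%E E).
  by apply: product_measure_unique => // A B mA mB; exact: product_measure2E.
rewrite /product_measure2 integral0_eq// => t _ /=.
apply: normal_prob_subsingleton => [|x x'].
  exact: measurable_ysection.
rewrite /ysection/= !inE /E/=.
exact: (@kink_line_subsingleton i q q' (fun k => g k t)).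
Qed.

(** Rational slopes suffice to separate one-sided derivatives, which keeps the
    union countable. *)
Definition kinks : set V := \bigcup_(u in [set: I * (rat * rat)])
  [set y | u.2.1 < u.2.2 /\ kink u.1 (ratr u.2.1) (ratr u.2.2) y].

Lemma kinksE : kinks = \bigcup_(u in [set: I * (rat * rat)])
  (if u.2.1 < u.2.2 then kink u.1 (ratr u.2.1) (ratr u.2.2) else set0).
Proof.
apply/seteqP; split=> y [u _].
  by move=> [lt k]; exists u => //; rewrite lt.
by case: ifP => // lt k; exists u.
Qed.

Lemma measurable_kinks : measurable kinks.
Proof.
rewrite kinksE; apply: countable_bigcupT_measurable => [|u].
  exact: countableP.
by case: ifP => // _; exact: measurable_kink.
Qed.

Lemma kinks_null {d} {T : measurableType d} (P : probability T R)
    (g : I -> T -> R) : iidN P g ->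
  P [set t | kinks (fun k => g k t)] = 0%E.
Proof.
move=> ng; have mv := measurable_vec ng.1.
have mpre (S : set V) : measurable S -> measurable [set t | S (fun k => g k t)].
  by move=> mS; rewrite -[X in measurable X]setTI; exact: mv.
pose F (u : I * (rat * rat)) : set T := [set t |
  (if u.2.1 < u.2.2 then kink u.1 (ratr u.2.1) (ratr u.2.2) else set0)
   (fun k => g k t)].
rewrite kinksE; rewrite (_ : [set t | _] = \bigcup_n
    (if unpickle n is Some u then F u else set0)); last first.
  apply/seteqP; split=> t.
    by move=> [u _ h]; exists (pickle u) => //; rewrite pickleK.
  by move=> [n _]; case: (unpickle n) => // u h; exists u.
apply/eqP; rewrite eq_le measure_ge0 andbT.
have mF n : measurable (if unpickle n is Some u then F u else set0).
  case: (unpickle n) => // u; apply: mpre; case: ifP => // _.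
  exact: measurable_kink.
apply: le_trans (measure_sigma_subadditive P mF _ (@subset_refl _ _)) _.
  exact: bigcupT_measurable.
rewrite eseries0// => n _ _; case: (unpickle n) => [u|]; last exact: measure0.
rewrite /F; case: ifP => lt; last exact: measure0.
by apply: kink_null => //; rewrite ltr_rat.
Qed.

End kinks.

Section derivative.
Context {R : realType} {I : finType}.
Variable N : (I -> R) -> R.
Hypothesis sN : seminorm N.

(** [x], read as the linear functional [dot x], is a subgradient of [N] at [y]. *)
Definition supports (x y : I -> R) := forall z, N y + dot x z <= N (y + z).

Lemma dot_basis (x : I -> R) i : dot x (basis i) = x i.
Proof.
rewrite /dot (bigD1 i)//= big1 ?addr0 /basis ?eqxx ?mulr1// => j ji.
by rewrite (negbTE ji) mulr0.
Qed.

Lemma natSinv_le (e : R) : 0 < e -> exists m, forall k, (m <= k)%N -> k.+1%:R^-1 <= e.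
Proof.
move=> e0; have [m _ h] := near_infty_natSinv_lt (PosNum e0).
by exists m => k /h/= /ltW.
Qed.

Lemma natSinv_gt0 m : 0 < m.+1%:R^-1 :> R.
Proof. by rewrite invr_gt0. Qed.

(** If a slope exceeded the subgradient by [e] at every small scale on one side,
    two rational slopes in between would make a kink. *)
Lemma off_kinks_partial (x y : I -> R) (i : I) (e : R) :
  supports x y -> ~ kinks N y -> 0 < e ->
  exists2 r, 0 < r & forall h, `|h| <= r ->
    N (y + h *: basis i) <= N y + x i * h + e * `|h|.
Proof.
move=> sup nk e0.
have supi h : N y + x i * h <= N (y + h *: basis i).
  by have := sup (h *: basis i); rewrite dotZr dot_basis (mulrC h).
have nokink q q' : x i - e < ratr q -> ratr q < (ratr q' : R) -> ratr q' < x i + e ->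
    ~ kink N i (ratr q) (ratr q') y.
  by move=> _ qq' _ k; apply: nk; exists (i, (q, q')) => //; split=> //=; rewrite -(ltr_rat R).
have [m hm] : exists m, N (y + m.+1%:R^-1 *: basis i) < N y + (x i + e) * m.+1%:R^-1.
  apply: contrapT => /forallNP h.
  have [q /=] := @rat_in_itvoo R (x i) (x i + e) ltac:(lra).
  rewrite in_itv/= => /andP[q1 q2].
  have [q' /=] := @rat_in_itvoo R _ _ q2; rewrite in_itv/= => /andP[q1' q2'].
  apply: (nokink q q') => // [|m _]; first by lra.
  have hm := h m; have p := natSinv_gt0 m; split.
    apply: le_trans (_ : N y + (x i + e) * m.+1%:R^-1 <= _).
      by rewrite lerD2l ler_wpM2r// ltW.
    by rewrite leNgt; apply/negP.
  apply: le_trans (supi _); rewrite lerD2l mulrN lerN2 ler_wpM2r//; exact: ltW.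
have [m' hm'] : exists m, N (y + (- m.+1%:R^-1) *: basis i) < N y - (x i - e) * m.+1%:R^-1.
  apply: contrapT => /forallNP h.
  have [q /=] := @rat_in_itvoo R (x i - e) (x i) ltac:(lra).
  rewrite in_itv/= => /andP[q1 q2].
  have [q' /=] := @rat_in_itvoo R _ _ q2; rewrite in_itv/= => /andP[q1' q2'].
  apply: (nokink q q') => // [|m0 _]; first by lra.
  have hm0 := h m0; have p := natSinv_gt0 m0; split.
    by apply: le_trans (supi _); rewrite lerD2l ler_wpM2r//; exact: ltW.
  apply: le_trans (_ : N y - (x i - e) * m0.+1%:R^-1 <= _).
    by rewrite lerD2l lerN2 ler_wpM2r// ltW.
  by rewrite leNgt; apply/negP.
exists (Num.min m.+1%:R^-1 m'.+1%:R^-1); first by rewrite lt_min !natSinv_gt0.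
move=> h; rewrite le_min => /andP[h1 h2].
have [h0|h0|->] := ltgtP h 0; last by rewrite scale0r normr0 !addr0 !mulr0 !addr0.
  rewrite ltr0_norm// in h1 h2 *.
  have := @seminorm_slope_le _ _ _ sN y (- basis i) (- h) m'.+1%:R^-1.
  rewrite oppr_gt0 => /(_ h0 h2); rewrite !scalerN -!scaleNr opprK.
  rewrite ler_pdivrMr ?oppr_gt0// => le1.
  have le2 : (N (y + - m'.+1%:R^-1 *: basis i) - N y) / m'.+1%:R^-1 <= - (x i - e).
    by rewrite ler_pdivrMr ?natSinv_gt0// lerBlDl mulNr ltW.
  have : (N (y + - m'.+1%:R^-1 *: basis i) - N y) / m'.+1%:R^-1 * - h <= - (x i - e) * - h.
    by rewrite ler_wpM2r// oppr_ge0 ltW.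
  by move=> le3; have := le_trans le1 le3; lra.
rewrite gtr0_norm// in h1 h2 *.
have := @seminorm_slope_le _ _ _ sN y (basis i) h m.+1%:R^-1 h0 h1.
rewrite ler_pdivrMr// => le1.
have le2 : (N (y + m.+1%:R^-1 *: basis i) - N y) / m.+1%:R^-1 <= x i + e.
  by rewrite ler_pdivrMr ?natSinv_gt0// lerBlDl ltW.
have le3 : (N (y + m.+1%:R^-1 *: basis i) - N y) / m.+1%:R^-1 * h <= (x i + e) * h.
  by rewrite ler_wpM2r// ltW.
by have := le_trans le1 le3; lra.
Qed.

(** Off the kinks all partial derivatives exist, and by convexity they
    determine every directional derivative; the given subgradient is then
    the gradient. *)
Lemma off_kinks_derivative (x y v : I -> R) (e : R) :
  supports x y -> ~ kinks N y -> 0 < e ->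
  exists m, N (y + m.+1%:R^-1 *: v) < N y + m.+1%:R^-1 * (dot x v + e).
Proof.
move=> sup nk e0; pose M : R := #|I|%:R.
pose e' := e / (1 + \sum_i `|v i|).
have s0 : 0 <= \sum_i `|v i| by apply: sumr_ge0.
have e'0 : 0 < e' by rewrite divr_gt0// ltr_wpDr.
have e's : e' * \sum_i `|v i| < e.
  by rewrite /e' mulrAC ltr_pdivrMr ?ltr_wpDr// mulrDr mulr1 ltrDr.
have ex i : exists m, forall k, (m <= k)%N ->
    N (y + (k.+1%:R^-1 * (M * v i)) *: basis i)
    <= N y + k.+1%:R^-1 * (M * (x i * v i + e' * `|v i|)).
  have [r r0 hr] := @off_kinks_partial x y i e' sup nk e'0.
  have M0 : 0 <= M by rewrite ler0n.
  have D0 : 0 < M * `|v i| + 1 by rewrite ltr_wpDl// mulr_ge0.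
  have [m hm] := @natSinv_le (r / (M * `|v i| + 1)) (divr_gt0 r0 D0).
  exists m => k /hm; rewrite ler_pdivlMr// => hk.
  have k0 := natSinv_gt0 k.
  have nE : `|k.+1%:R^-1 * (M * v i)| = k.+1%:R^-1 * (M * `|v i|).
    by rewrite !normrM (gtr0_norm k0) (ger0_norm M0).
  apply: le_trans (hr _ _) _; rewrite nE.
    by apply: le_trans hk; rewrite mulrDr mulr1 lerDl ltW.
  by rewrite -addrA lerD2l le_eqVlt; apply/orP; left; apply/eqP; ring.
pose m i := projT1 (cid (ex i)); pose k := \max_i m i.
have ek i : N (y + (k.+1%:R^-1 * (M * v i)) *: basis i)
    <= N y + k.+1%:R^-1 * (M * (x i * v i + e' * `|v i|)).
  by apply: (projT2 (cid (ex i))); rewrite /k; exact: (leq_bigmax i).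
exists k; have k0 := natSinv_gt0 k; set h := k.+1%:R^-1 in ek k0 *.
have [I0|In0] := eqVneq #|I| 0%N.
  have -> : y + h *: v = y.
    by apply/funext => i; have := card0_eq I0 i; rewrite !inE.
  rewrite ltrDl mulr_gt0// /dot big1 ?add0r// => i _.
  by have := card0_eq I0 i; rewrite !inE.
have Mp : 0 < M by rewrite ltr0n lt0n.
(* a point in the direction [v] is the mean of points in the coordinate
   directions, each displaced [M] times as far *)
have E : y + h *: v = \sum_i M^-1 *: (y + (h * (M * v i)) *: basis i).
  under eq_bigr do rewrite scalerDr scalerA (mulrCA M^-1) (mulrA M^-1) mulVf ?gt_eqF// mul1r -scalerA.
  rewrite big_split/= sumr_const -scaler_sumr sum_basis; congr (_ + _).
  by rewrite -[X in _ = X]scaler_nat scalerA divff ?gt_eqF// scale1r.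
rewrite E; apply: le_lt_trans (seminorm_sum sN _) _.
apply: (@le_lt_trans _ _ (\sum_i M^-1 * (N y + h * (M * (x i * v i + e' * `|v i|))))).
  have Mi : 0 <= M^-1 by rewrite invr_ge0 ler0n.
  by apply: ler_sum => i _; rewrite sN.2 ger0_norm// ler_wpM2l.
rewrite (eq_bigr (fun i => M^-1 * N y + (h * (x i * v i) + h * e' * `|v i|))); last first.
  by move=> i _; field; rewrite gt_eqF.
rewrite big_split/= sumr_const -[X in X + _]mulr_natl mulrA divff ?gt_eqF// mul1r.
rewrite ltrD2l big_split/= -!mulr_sumr -mulrA -mulrDr ltr_pM2l//.
by rewrite ltrD2l.
Qed.

End derivative.

(** * Exchangeable blocks *)

Section counting.
Context {R : realType} {d : measure_display} {T : measurableType d}.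
Variable P : probability T R.

Lemma sum_probability_le {J : finType} (E : J -> set T) (c : R) :
  (forall j, measurable (E j)) -> (forall t, \sum_j \1_(E j) t <= c) ->
  \sum_j fine (P (E j)) <= c.
Proof.
move=> mE h.
have PE j : (fine (P (E j)))%:E = (\int[P]_t (\1_(E j) t)%:E)%E.
  by rewrite fineK ?fin_num_measure// integral_indic// setIT.
rewrite -lee_fin -sumEFin (eq_bigr _ (fun j _ => PE j)).
rewrite -ge0_integral_sum//; last first.
  by move=> j; apply/measurable_EFinP; exact: measurable_indic.
apply: (@le_trans _ _ (\int[P]_t (cst c%:E) t)%E).
  apply: ge0_le_integral => //.
  - by move=> t _; apply: sume_ge0 => j _; rewrite lee_fin.
  - by apply: emeasurable_sum => j; apply/measurable_EFinP; exact: measurable_indic.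
  - by move=> t _; rewrite sumEFin lee_fin; exact: h.
by rewrite integral_cst// [X in (_ * X)%E](@probability_setT _ _ _ P) mule1.
Qed.

Lemma iidN_reindex {I J : finType} (Y : I -> T -> R) (f : J -> I) (f' : I -> J) :
  cancel f f' -> cancel f' f -> iidN P Y -> iidN P (fun j => Y (f j)).
Proof.
move=> fK f'K [mY PY]; split=> [j|B mB]; first exact: mY.
rewrite (_ : [set t | _] = [set t | forall i, B (f' i) (Y i t)]); last first.
  apply/seteqP; split=> t /= h i; first by have := h (f' i); rewrite f'K.
  by have := h (f i); rewrite fK.
rewrite (PY (fun i => B (f' i)))//; congr EFin; rewrite [RHS](reindex f')//.
by exists f => i _; rewrite ?fK ?f'K.
Qed.

End counting.

Section exchange.
Context {R : realType} {I : finType}.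
Local Notation V := (@borel_vec R I).
Variable N : (I -> R) -> R.
Hypothesis sN : seminorm N.

Definition restr (B : pred I) (y : I -> R) : I -> R := fun i => (B i)%:R * y i.

(** For the convex [N] this is a lower bound by [e] for the right derivative at [y]
    in the direction of the restriction of [y] to [B], together with a bound on
    [N y].  It is expressed by countably many conditions on [N] alone, so it is
    measurable and follows permutations of the coordinates. *)
Definition sensitive (B : pred I) (K e : R) : set V :=
  [set y | N y <= K /\
    forall m, N y + m.+1%:R^-1 * e <= N (y + m.+1%:R^-1 *: restr B y)].

Lemma measurable_sensitive B K e : measurable (sensitive B K e).
Proof.
have mN := measurable_seminorm sN.
have -> : sensitive B K e = [set y : V | N y <= K] `&` \bigcap_m
    [set y : V | N y + m.+1%:R^-1 * e <= N (y + m.+1%:R^-1 *: restr B y)].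
  by apply/seteqP; split=> y [h1 h2]; split=> // m; [move=> _|]; apply: h2.
apply: measurableI.
  by rewrite -[X in measurable X]setTI; apply: measurable_fun_le.
apply: bigcap_measurableType => m _.
rewrite -[X in measurable X]setTI; apply: measurable_fun_le => //.
  exact: measurable_funD.
apply: (measurableT_comp mN).
apply: (@measurable_vec R I _ V (fun i y => y i + m.+1%:R^-1 * ((B i)%:R * y i))) => i.
apply: measurable_funD; first exact: measurable_coord.
by apply: measurable_funM => //; apply: measurable_funM => //; exact: measurable_coord.
Qed.

Lemma sensitive_perm (s : {perm I}) (B C : pred I) K e y :
  (forall z, N (fun i => z (s i)) = N z) -> (forall i, B (s i) = C i) ->
  sensitive C K e (fun i => y (s i)) <-> sensitive B K e y.
Proof.
move=> Ns BC.
have E m : N ((fun i => y (s i)) + m.+1%:R^-1 *: restr C (fun i => y (s i)))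
    = N (y + m.+1%:R^-1 *: restr B y).
  rewrite -[RHS]Ns; congr N; apply/funext => i.
  rewrite [LHS](_ : _ = y (s i) + m.+1%:R^-1 * ((C i)%:R * y (s i)))//.
  by rewrite -BC.
by split=> -[h1 h2]; rewrite /sensitive/= ?Ns in h1 h2 *; split=> // m;
  have := h2 m; rewrite E.
Qed.

Lemma sensitive_supports (x y : I -> R) B K e : supports N x y ->
  ~ kinks N y -> sensitive B K e y -> e <= dot x (restr B y).
Proof.
move=> sup nk [_ h]; rewrite leNgt; apply/negP => lt.
have d0 : 0 < e - dot x (restr B y) by rewrite subr_gt0.
have [m] := @off_kinks_derivative _ _ _ sN x y (restr B y) _ sup nk d0.
by rewrite subrKC ltNge h.
Qed.

Lemma supports_sensitive (x y : I -> R) B K e : supports N x y ->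
  N y <= K -> e <= dot x (restr B y) -> sensitive B K e y.
Proof.
move=> sup NK eB; split=> // m; apply: le_trans (sup _).
by rewrite dotZr lerD2l ler_wpM2l// ltW// natSinv_gt0.
Qed.

(** If many disjoint blocks of coordinates are exchangeable with [C], then [N]
    is rarely sensitive to [C]: the gradient distributes at most [N] among the
    blocks, so at most [K / e] blocks are sensitive at a time, while all have
    the probability of [C]. *)
Lemma sensitive_rare {d} {T : measurableType d} (P : probability T R)
    (g : I -> T -> R) (M : nat) (B : 'I_M -> pred I) (C : pred I)
    (s : 'I_M -> {perm I}) (K e : R) :
  iidN P g -> (0 < M)%N -> 0 <= K -> 0 < e ->
  (forall b z, N (fun i => z (s b i)) = N z) ->
  (forall b i, B b (s b i) = C i) ->
  (forall t, exists x, let y := fun i => g i t in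
     [/\ supports N x y, forall b, 0 <= dot x (restr (B b) y)
       & \sum_b dot x (restr (B b) y) <= N y]) ->
  fine (P [set t | sensitive C K e (fun i => g i t)]) <= K / (e * M%:R).
Proof.
move=> ng M0 K0 e0 Ns Bs sup.
have mv := measurable_vec ng.1.
have mpre (S : set V) : measurable S -> measurable [set t | S (fun k => g k t)].
  by move=> mS; rewrite -[X in measurable X]setTI; exact: mv.
pose E b := [set t | sensitive (B b) K e (fun i => g i t)].
pose Z := [set t | kinks N (fun i => g i t)].
have mE b : measurable (E b) by apply: mpre; exact: measurable_sensitive.
have mZ : measurable Z by apply: mpre; exact: measurable_kinks.
have PE b : fine (P (E b `\` Z)) = fine (P [set t | sensitive C K e (fun i => g i t)]).
  rewrite (measureD (mE b) mZ); last by rewrite ltey_eq fin_num_measure.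
  rewrite [X in (_ - X)%E](_ : _ = 0%E) ?sube0; last first.
    apply/eqP; rewrite eq_le measure_ge0 andbT -(kinks_null sN ng).
    by rewrite le_measure ?inE//; exact: measurableI.
  rewrite (iidN_law ng (iidN_reindex (permK (s b)) (permKV (s b)) ng) (measurable_sensitive C K e)).
  congr (fine (P _)); apply/seteqP; split=> t h.
    exact: (sensitive_perm K e (fun i => g i t) (Ns b) (Bs b)).2.
  exact: (sensitive_perm K e (fun i => g i t) (Ns b) (Bs b)).1.
have cnt t : \sum_b \1_(E b `\` Z) t <= K / e.
  have [[b0 [b0E nZ]]|none] := pselect (exists b, (E b `\` Z) t); last first.
    rewrite big1 ?divr_ge0 ?(ltW e0)// => b _; rewrite indicE memNset// => h.
    by apply: none; exists b.
  have [x [sx x0 xs]] := sup t.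
  rewrite ler_pdivlMr// mulr_suml; apply: le_trans (_ : N (fun i => g i t) <= _).
    apply: le_trans xs; apply: ler_sum => b _; rewrite indicE.
    have [/set_mem[bE _]|_] := boolP (t \in _); last by rewrite mul0r.
    by rewrite mul1r; exact: sensitive_supports sx nZ bE.
  by case: b0E.
have := @sum_probability_le _ _ _ P _ _ _ (fun b => measurableD (mE b) mZ) cnt.
rewrite (eq_bigr _ (fun b _ => PE b)) sumr_const card_ord -[X in X <= _ -> _]mulr_natr.
by rewrite -ler_pdivlMr ?ltr0n// invfM mulrA.
Qed.

End exchange.

(** * The Ky Fan norm of a data matrix *)

Section suprema.
Context {R : realType} {I : finType} {J : Type}.
Variables (D : set J) (f : J -> (I -> R) -> R).
Hypotheses (D0 : D !=set0) (sf : forall j, D j -> seminorm (f j)).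
Hypothesis (bf : forall y, exists c, forall j, D j -> f j y <= c).

Definition sup_family (y : I -> R) : R := sup [set f j y | j in D].

Lemma sup_family_ub y j : D j -> f j y <= sup_family y.
Proof.
move=> Dj; apply: ub_le_sup; last by exists j.
by have [c hc] := bf y; exists c => _ [i Di <-]; exact: hc.
Qed.

Lemma sup_family_le y c : (forall j, D j -> f j y <= c) -> sup_family y <= c.
Proof.
move=> h; apply: ge_sup => [|_ [j Dj <-]]; last exact: h.
by have [j Dj] := D0; exists (f j y), j.
Qed.

Lemma seminorm_sup : seminorm sup_family.
Proof.
have hom a y : sup_family (a *: y) <= `|a| * sup_family y.
  apply: sup_family_le => j Dj; rewrite (sf Dj).2 ler_wpM2l//.
  exact: sup_family_ub.
split=> [y z|a y].
  apply: sup_family_le => j Dj; apply: le_trans ((sf Dj).1 _ _) _.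
  by apply: lerD; exact: sup_family_ub.
apply/eqP; rewrite eq_le hom/=; have [->|a0] := eqVneq a 0.
  rewrite normr0 mul0r scale0r; have [j Dj] := D0.
  by apply: le_trans (sup_family_ub _ Dj); rewrite seminorm0//; exact: sf.
have := hom a^-1 (a *: y); rewrite scalerA mulVf// scale1r normfV.
by rewrite ler_pdivlMl ?normr_gt0.
Qed.

End suprema.

Section frames.
Context {R : realType}.

Definition frob {m k} (A : 'M[R]_(m, k)) : R := nrm (fun ij : 'I_m * 'I_k => A ij.1 ij.2).

Definition fdot {m k} (A B : 'M[R]_(m, k)) : R := \tr (A^T *m B).

Lemma fdotE {m k} (A B : 'M[R]_(m, k)) :
  fdot A B = dot (fun ij : 'I_m * 'I_k => A ij.1 ij.2) (fun ij => B ij.1 ij.2).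
Proof.
rewrite /dot -(pair_big xpredT xpredT (fun i j => A i j * B i j))/= exchange_big/=.
by apply: eq_bigr => j _; rewrite mxE; apply: eq_bigr => i _; rewrite mxE.
Qed.

Lemma frob_ge0 {m k} (A : 'M[R]_(m, k)) : 0 <= frob A.
Proof. exact: nrm_ge0. Qed.

Lemma frob_sqr {m k} (A : 'M[R]_(m, k)) : frob A ^+ 2 = fdot A A.
Proof. by rewrite nrm_sqr fdotE. Qed.

Lemma frobD {m k} (A B : 'M[R]_(m, k)) : frob (A + B) <= frob A + frob B.
Proof.
apply: le_trans (nrm_triangle _ _); rewrite le_eqVlt; apply/orP; left; apply/eqP.
by congr nrm; apply/funext => ij; rewrite mxE.
Qed.

Lemma frobZ {m k} a (A : 'M[R]_(m, k)) : frob (a *: A) = `|a| * frob A.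
Proof. by rewrite /frob -nrmZ; congr nrm; apply/funext => ij; rewrite mxE. Qed.

Lemma fdot_le {m k} (A B : 'M[R]_(m, k)) : fdot A B <= frob A * frob B.
Proof. by rewrite fdotE dot_le_nrm. Qed.

Lemma fdotDr {m k} (A B C : 'M[R]_(m, k)) : fdot A (B + C) = fdot A B + fdot A C.
Proof. by rewrite /fdot mulmxDr linearD. Qed.

Lemma fdotZr {m k} a (A B : 'M[R]_(m, k)) : fdot A (a *: B) = a * fdot A B.
Proof. by rewrite /fdot -scalemxAr linearZ. Qed.

Definition is_frame {m k} (U : 'M[R]_(m, k)) := U^T *m U = 1%:M.

(** Each of the [k] columns of a frame is a unit vector. *)
Lemma frob_frame {m N k} (A : 'M[R]_(m, N)) (U : 'M[R]_(N, k)) : is_frame U ->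
  frob (A *m U) <= Num.sqrt k%:R * frob A.
Proof.
move=> fU; rewrite -(@ler_pXn2r _ 2)// ?nnegrE ?mulr_ge0 ?frob_ge0 ?sqrtr_ge0//.
rewrite exprMn !frob_sqr sqr_sqrtr ?ler0n// !fdotE /dot.
rewrite -(pair_big xpredT xpredT (fun i j => (A *m U) i j * (A *m U) i j))/=.
rewrite -(pair_big xpredT xpredT (fun i j => A i j * A i j))/=.
rewrite mulr_sumr; apply: ler_sum => i _.
apply: (@le_trans _ _ (\sum_(j < k) \sum_a A i a * A i a)); last first.
  by rewrite sumr_const card_ord mulr_natl.
apply: ler_sum => j _; rewrite mxE -expr2.
have := dot_CS (fun a => A i a) (fun a => U a j).
rewrite [X in _ * X](_ : _ = 1) ?mulr1//.
have /matrixP/(_ j j) := fU; rewrite !mxE eqxx mulr1n => <-.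
by apply: eq_bigr => a _; rewrite mxE.
Qed.

Lemma frame_exists {N k} : (k <= N)%N -> exists U : 'M[R]_(N, k), is_frame U.
Proof.
by move=> kN; exists (pid_mx k); rewrite /is_frame tr_pid_mx mul_pid_mx minnn (minn_idPr kN) pid_mx_1.
Qed.

End frames.

Section ky_fan_norm.
Context {R : realType}.
Variables (n N k : nat) (ell : 'I_N -> R).
Hypothesis kN : (k <= N)%N.
Implicit Types y z : 'I_n * 'I_N -> R.

(** The columns of [y] centred and scaled so that [(design y)^T *m design y] is
    a sample covariance matrix. *)
Definition design y : 'M[R]_(n, N) := \matrix_(i, a)
  ((Num.sqrt n%:R)^-1 * (y (i, a) - n%:R^-1 * \sum_i' y (i', a)) * ell a).

Definition scov y : 'M[R]_N := (design y)^T *m design y.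

Lemma designD y z : design (y + z) = design y + design z.
Proof.
apply/matrixP => i a; rewrite !mxE.
rewrite (eq_bigr (fun i' => y (i', a) + z (i', a)))// big_split/=.
rewrite [(y + z) _](_ : _ = y (i, a) + z (i, a))//; ring.
Qed.

Lemma designZ c y : design (c *: y) = c *: design y.
Proof.
apply/matrixP => i a; rewrite !mxE.
rewrite (eq_bigr (fun i' => c * y (i', a)))// -mulr_sumr.
rewrite [(c *: y) _](_ : _ = c * y (i, a))//; ring.
Qed.

Lemma design_restr (b : pred 'I_N) y :
  design (restr (fun ia => b ia.2) y) = design y *m diag_mx (\row_a (b a)%:R).
Proof.
apply/matrixP => i a; rewrite mul_mx_diag !mxE /restr/= -mulr_sumr; ring.
Qed.

Definition frames : set 'M[R]_(N, k) := [set U | is_frame U].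

(** The square of [ky_fan_norm y] is the sum of the [k] largest eigenvalues of
    [scov y]. *)
Definition ky_fan_norm : ('I_n * 'I_N -> R) -> R :=
  sup_family frames (fun U y => frob (design y *m U)).

Let frames0 : frames !=set0.
Proof. by have [U fU] := @frame_exists R _ _ kN; exists U. Qed.

Let seminorm_frame U : frames U -> seminorm (fun y => frob (design y *m U)).
Proof.
move=> _; split=> [y z|c y]; first by rewrite designD mulmxDl frobD.
by rewrite designZ -scalemxAl frobZ.
Qed.

Let bounded_frame y : exists c, forall U, frames U -> frob (design y *m U) <= c.
Proof.
by exists (Num.sqrt k%:R * frob (design y)) => U fU; exact: frob_frame.
Qed.

Lemma seminorm_ky_fan : seminorm ky_fan_norm.
Proof. exact: (seminorm_sup frames0 seminorm_frame bounded_frame). Qed.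

Lemma ky_fan_norm_ub (U : 'M[R]_(N, k)) y : is_frame U ->
  frob (design y *m U) <= ky_fan_norm y.
Proof. by move=> fU; exact: (sup_family_ub bounded_frame y (j := U) fU). Qed.

Lemma ky_fan_norm_le y c :
  (forall U : 'M[R]_(N, k), is_frame U -> frob (design y *m U) <= c) ->
  ky_fan_norm y <= c.
Proof. by move=> h; exact: (sup_family_le frames0 h). Qed.

Lemma column_perm_inj (s : {perm 'I_N}) :
  injective (fun ia : 'I_n * 'I_N => (ia.1, s ia.2)).
Proof. by move=> [i a] [j b] [-> /perm_inj ->]. Qed.

Definition column_perm (s : {perm 'I_N}) : {perm 'I_n * 'I_N} :=
  perm (@column_perm_inj s).

(** A permutation of columns with equal scales only permutes the rows of the
    frames over which the supremum is taken. *)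
Lemma ky_fan_norm_perm (s : {perm 'I_N}) y : (forall a, ell (s a) = ell a) ->
  ky_fan_norm (fun ia => y (column_perm s ia)) = ky_fan_norm y.
Proof.
have le (s' : {perm 'I_N}) z : (forall a, ell (s' a) = ell a) ->
    ky_fan_norm (fun ia => z (column_perm s' ia)) <= ky_fan_norm z.
  move=> es; apply: ky_fan_norm_le => U fU.
  apply: le_trans (ky_fan_norm_ub (U := row_perm s'^-1 U) z _); last first.
    rewrite /is_frame row_permE trmx_mul tr_perm_mx invgK mulmxA.
    by rewrite -(mulmxA U^T) -perm_mxM mulgV perm_mx1 mulmx1.
  rewrite le_eqVlt; apply/orP; left; apply/eqP; congr frob.
  apply/matrixP => i j; rewrite !mxE [RHS](reindex_inj (@perm_inj _ s'))/=.
  apply: eq_bigr => a _; rewrite !mxE permK es permE/=; congr (_ * _ * _ * _).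
  by congr (_ - _ * _); apply: eq_bigr => i' _; rewrite permE.
move=> es; apply/eqP; rewrite eq_le le//=.
have es' a : ell (s^-1%g a) = ell a by rewrite -[in RHS](permKV s a) es.
have := le s^-1%g (fun ia => y (column_perm s ia)) es'.
rewrite [X in ky_fan_norm X <= _](_ : _ = y)//.
apply/funext => -[i a]; rewrite /column_perm (permE (@column_perm_inj s^-1%g)).
by rewrite (permE (@column_perm_inj s))/= permKV.
Qed.

End ky_fan_norm.

Section gradient.
Context {R : realType}.
Variables (n N k : nat) (ell : 'I_N -> R).
Hypothesis kN : (k <= N)%N.
Implicit Types y z : 'I_n * 'I_N -> R.
Local Notation design := (@design R n N ell).
Local Notation scov := (@scov R n N ell).
Local Notation norm := (@ky_fan_norm R n N k ell).

Lemma scov_sym y : (scov y)^T = scov y.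
Proof. by rewrite /scov trmx_mul trmxK. Qed.

Lemma scov_quad y {m} (U : 'M[R]_(N, m)) :
  \tr (U^T *m scov y *m U) = frob (design y *m U) ^+ 2.
Proof. by rewrite frob_sqr /fdot trmx_mul /scov !mulmxA. Qed.

Lemma scov_psd y (v : 'cV[R]_N) : 0 <= (v^T *m scov y *m v) 0 0.
Proof.
have -> : (v^T *m scov y *m v) 0 0 = \tr (v^T *m scov y *m v).
  by rewrite /mxtrace big_ord1.
by rewrite scov_quad sqr_ge0.
Qed.

Variables (y : 'I_n * 'I_N -> R) (tau : seq R) (U : 'M[R]_(N, k)).
Hypotheses (et : eigenvalues_of (scov y) tau) (fU : is_frame U).
Hypothesis eU : scov y *m U = U *m diag_mx (\row_j tau`_j).

Lemma frob_eigenframe : frob (design y *m U) ^+ 2 = \sum_(j < k) tau`_j.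
Proof.
rewrite -scov_quad -mulmxA eU mulmxA fU mul1mx mxtrace_diag.
by apply: eq_bigr => j _; rewrite mxE.
Qed.

Lemma ky_fan_norm_eigenframe : norm y = frob (design y *m U).
Proof.
apply/eqP; rewrite eq_le ky_fan_norm_ub// andbT.
apply: ky_fan_norm_le => // W fW.
rewrite -(@ler_pXn2r _ 2)// ?nnegrE ?frob_ge0// frob_eigenframe -scov_quad.
exact: (ky_fan (scov_sym y) et fW kN).
Qed.

Lemma ky_fan_norm_sqr : norm y ^+ 2 = \sum_(j < k) tau`_j.
Proof. by rewrite ky_fan_norm_eigenframe frob_eigenframe. Qed.

(** Restricting the columns multiplies the design matrix by a diagonal projection
    on the right, which meets the eigenvectors after [scov y] has been applied. *)
Lemma fdot_restr (b : pred 'I_N) :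
  fdot (design y *m U) (design (restr (fun ia => b ia.2) y) *m U)
  = \sum_(j < k) tau`_j * \sum_a (b a)%:R * U a j ^+ 2.
Proof.
rewrite /fdot design_restr trmx_mul -!mulmxA.
rewrite (mulmxA _ (design y)) -/(scov y) (mulmxA _ (scov y)).
have -> : U^T *m scov y = diag_mx (\row_j tau`_j) *m U^T.
  by rewrite -[LHS]trmxK trmx_mul trmxK scov_sym eU trmx_mul tr_diag_mx.
rewrite -mulmxA; move: (diag_mx (\row_a (b a)%:R) *m U) (mul_diag_mx (\row_a (b a)%:R) U) => W WE.
rewrite mul_diag_mx; apply: eq_bigr => j _; rewrite mxE [(\row__ _) _ _]mxE; congr (_ * _).
rewrite mxE WE; apply: eq_bigr => a _; by rewrite !mxE mulrCA expr2.
Qed.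

(** The eigenframe realises the supremum defining the norm, so the derivative of
    the term for this fixed frame is a subgradient. *)
Lemma supports_eigenframe : exists2 x, supports norm x y &
  forall b : pred 'I_N, dot x (restr (fun ia => b ia.2) y)
    = (\sum_(j < k) tau`_j * \sum_a (b a)%:R * U a j ^+ 2) / norm y.
Proof.
pose L z := fdot (design y *m U) (design z *m U).
have LD z z' : L (z + z') = L z + L z'.
  by rewrite /L designD mulmxDl fdotDr.
have LZ c z : L (c *: z) = c * L z.
  by rewrite /L designZ -scalemxAl fdotZr.
have L0 : L 0 = 0 by rewrite -(scale0r (0 : 'I_n * 'I_N -> R)) LZ mul0r.
pose x (ia : 'I_n * 'I_N) := L (basis ia) / norm y.
have dx z : dot x z = L z / norm y.
  rewrite -{2}(sum_basis z) (big_morph L LD L0) mulr_suml.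
  by apply: eq_bigr => ia _; rewrite LZ /x mulrC mulrA.
exists x => [z|b]; last by rewrite dx /L fdot_restr.
rewrite dx.
have Ny0 : 0 <= norm y by rewrite ky_fan_norm_eigenframe frob_ge0.
have [N0|N0] := eqVneq (norm y) 0.
  rewrite N0 invr0 mulr0 addr0.
  by apply: le_trans (ky_fan_norm_ub _ _ fU); exact: frob_ge0.
have Np : 0 < norm y by rewrite lt_neqAle eq_sym N0.
apply: le_trans (ky_fan_norm_ub _ _ fU).
have := fdot_le (design y *m U) (design (y + z) *m U).
rewrite -/(L _) LD -ky_fan_norm_eigenframe -ler_pdivrMl//.
suff -> : (norm y)^-1 * (L y + L z) = norm y + L z / norm y by [].
rewrite /L -frob_sqr -ky_fan_norm_eigenframe; field; exact: N0.
Qed.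

End gradient.

(** * Bounds for the sample spectrum *)

Section spectrum_bounds.
Context {R : realType}.
Variables (n N k : nat) (ell : 'I_N -> R).
Hypotheses (n0 : (0 < n)%N) (kN : (k <= N)%N).
Variables (y : 'I_n * 'I_N -> R) (K1 : R).

(** The operator norm of the matrix [y] is at most [sqrt (K1 * n)]. *)
Definition op_bound := forall w : 'I_N -> R,
  \sum_i (\sum_a y (i, a) * w a) ^+ 2 <= K1 * n%:R * \sum_a w a ^+ 2.

Hypotheses (K10 : 0 <= K1) (opb : op_bound).

Let nR : 0 < n%:R :> R. Proof. by rewrite ltr0n. Qed.

Let mean a := n%:R^-1 * \sum_i y (i, a).

Let centering (x : 'I_n -> R) :
  \sum_i (x i - n%:R^-1 * \sum_j x j) ^+ 2
  = \sum_i x i ^+ 2 - n%:R^-1 * (\sum_j x j) ^+ 2.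
Proof.
set s := \sum_j x j.
rewrite (eq_bigr (fun i => x i ^+ 2 + (- (2 * n%:R^-1 * s) * x i + (n%:R^-1 * s) ^+ 2))); last first.
  by move=> i _; ring.
rewrite !big_split/= -mulr_sumr -/s sumr_const card_ord -[X in _ + (_ + X)]mulr_natr.
by field; rewrite gt_eqF.
Qed.

Let mean_bound : \sum_a mean a ^+ 2 <= K1.
Proof.
set s := \sum_a _; have s0 : 0 <= s by apply: sumr_ge0 => a _; exact: sqr_ge0.
have [->//|sn0] := eqVneq s 0.
have sp : 0 < s by rewrite lt_neqAle eq_sym sn0.
pose F i := \sum_a y (i, a) * mean a.
have sumF : \sum_i F i = n%:R * s.
  rewrite exchange_big/= mulr_sumr; apply: eq_bigr => a _.
  by rewrite -mulr_suml /mean; field; rewrite gt_eqF.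
have cs := dot_CS (fun=> 1 : R) F.
have e1 : dot (fun=> 1) F = n%:R * s.
  by rewrite -sumF; apply: eq_bigr => i _; rewrite mul1r.
have e2 : dot (fun _ : 'I_n => 1 : R) (fun=> 1 : R) = n%:R :> R.
  transitivity (\sum_(i < n) (1 : R)).
    by apply: eq_bigr => i _; rewrite mulr1.
  by rewrite sumr_const card_ord.
have := opb mean; rewrite -/s => ob.
have {cs} : (n%:R * s) ^+ 2 <= n%:R * (K1 * n%:R * s).
  rewrite -[X in X ^+ 2]e1; apply: le_trans cs _; rewrite e2 ler_wpM2l//.
have -> : (n%:R * s) ^+ 2 = (n%:R ^+ 2 * s) * s by ring.
have -> : n%:R * (K1 * n%:R * s) = (n%:R ^+ 2 * s) * K1 by ring.
by rewrite ler_pM2l// mulr_gt0// exprn_gt0.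
Qed.

Variables (L l0 : R).
Hypotheses (L0 : 0 <= L) (l0p : 0 < l0).
Hypotheses (ellL : forall a, ell a ^+ 2 <= L) (ell0 : forall a, l0 <= ell a ^+ 2).

Let sqrt_n2 : (Num.sqrt n%:R)^-1 ^+ 2 = n%:R^-1 :> R.
Proof. by rewrite exprVn sqr_sqrtr// ltW. Qed.

(** Centring does not increase Euclidean norms, and each column of a frame
    contributes at most the square of the operator norm. *)
Lemma ky_fan_norm_bound :
  ky_fan_norm k ell y ^+ 2 <= k%:R * (K1 * L).
Proof.
have KL : 0 <= k%:R * (K1 * L) by rewrite !mulr_ge0.
have sK := seminorm_ge0 (seminorm_ky_fan n ell kN) y.
rewrite -[leRHS](sqr_sqrtr KL) ler_pXn2r ?nnegrE ?sqrtr_ge0//.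
apply: ky_fan_norm_le => // W fW.
rewrite -(@ler_pXn2r _ 2)// ?nnegrE ?frob_ge0 ?sqrtr_ge0// frob_sqr sqr_sqrtr//.
rewrite /fdot /mxtrace.
apply: (@le_trans _ _ (\sum_(j < k) (K1 * L))); last first.
  by rewrite sumr_const card_ord mulr_natl.
apply: ler_sum => j _; rewrite mxE.
pose x i := \sum_a y (i, a) * (ell a * W a j).
have DE i : (design ell y *m W) i j
    = (Num.sqrt n%:R)^-1 * (x i - n%:R^-1 * \sum_i' x i').
  rewrite mxE /x exchange_big/= mulr_sumr -sumrB mulr_sumr.
  apply: eq_bigr => a _; rewrite mxE -mulr_suml; ring.
rewrite (eq_bigr (fun i => n%:R^-1 * (x i - n%:R^-1 * \sum_i' x i') ^+ 2)); last first.
  by move=> i _; rewrite mxE DE -expr2 exprMn sqrt_n2.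
rewrite -mulr_sumr centering ler_pdivrMl//.
apply: (@le_trans _ _ (\sum_i x i ^+ 2)).
  by rewrite gerBl mulr_ge0 ?sqr_ge0// invr_ge0 ltW.
apply: le_trans (opb _) _; rewrite [leRHS]mulrCA [leRHS]mulrA ler_wpM2l//.
  by rewrite mulr_ge0// ltW.
have W1 : \sum_a W a j ^+ 2 = 1.
  have /matrixP/(_ j j) := fW; rewrite !mxE eqxx mulr1n => <-.
  by apply: eq_bigr => a _; rewrite mxE expr2.
rewrite -[leRHS]mulr1 -W1 mulr_sumr; apply: ler_sum => a _.
by rewrite exprMn ler_wpM2r// sqr_ge0.
Qed.

(** Centring removes from the energy only the squared norm of the mean, which is
    bounded by the operator norm. *)
Lemma trace_scov_ge :
  l0 * (n%:R^-1 * \sum_a \sum_i y (i, a) ^+ 2 - K1) <= \tr (scov ell y).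
Proof.
have trE : \tr (scov ell y)
    = \sum_a ell a ^+ 2 * (n%:R^-1 * \sum_i (y (i, a) - mean a) ^+ 2).
  rewrite /mxtrace; apply: eq_bigr => a _; rewrite mxE !mulr_sumr.
  by apply: eq_bigr => i _; rewrite !mxE -/(mean a) -sqrt_n2; ring.
rewrite trE; apply: (@le_trans _ _
    (\sum_a l0 * (n%:R^-1 * \sum_i (y (i, a) - mean a) ^+ 2))); last first.
  apply: ler_sum => a _; rewrite ler_wpM2r// mulr_ge0 ?invr_ge0 ?(ltW nR)//.
  by apply: sumr_ge0 => i _; exact: sqr_ge0.
rewrite -mulr_sumr ler_wpM2l//; first exact: ltW.
rewrite [leRHS](eq_bigr (fun a => n%:R^-1 * \sum_i y (i, a) ^+ 2 - mean a ^+ 2)); last first.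
  move=> a _; have := centering (fun i => y (i, a)); rewrite -/(mean a) => ->.
  by rewrite /mean; field; rewrite gt_eqF.
by rewrite sumrB -mulr_sumr lerD2l lerN2 mean_bound.
Qed.

Variables (tau : seq R) (U : 'M[R]_(N, k)).
Hypotheses (et : eigenvalues_of (scov ell y) tau) (fU : is_frame U).
Hypothesis eU : scov ell y *m U = U *m diag_mx (\row_j tau`_j).

Lemma eigenvalue_ge0 j : 0 <= tau`_j.
Proof. by apply: (eigenvalues_ge0 (scov_sym ell y) et); exact: scov_psd. Qed.

Lemma eigenvalue_sum_le : \sum_(j < k) tau`_j <= k%:R * (K1 * L).
Proof. by rewrite -(ky_fan_norm_sqr kN et fU eU) ky_fan_norm_bound. Qed.

(** The total variance is spread over [N] eigenvalues, of which the first few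
    are bounded, so the next one is bounded below. *)
Lemma eigenvalue_ge j : (j < k)%N ->
  n%:R * N%:R / 16 <= \sum_a \sum_i y (i, a) ^+ 2 ->
  32 * (K1 + k%:R * (K1 * L) / l0) <= N%:R ->
  l0 / 32 <= tau`_j.
Proof.
move=> jk ysq Nbig; have jN : (j < N)%N := leq_trans jk kN.
have NR : 0 < N%:R :> R by rewrite ltr0n (leq_ltn_trans _ jN).
have tr_le : \tr (scov ell y) <= k%:R * (K1 * L) + N%:R * tau`_j.
  rewrite (trace_eigenvalues (scov_sym ell y) et).
  rewrite (bigID (fun i : 'I_N => (i < j)%N))/=; apply: lerD.
    apply: le_trans eigenvalue_sum_le; rewrite (big_ord_widen _ (nth 0 tau) kN).
    rewrite [leRHS](bigID (fun i : 'I_N => (i < j)%N))/=.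
    rewrite -[leLHS]addr0 lerD//; last by apply: sumr_ge0 => i _; exact: eigenvalue_ge0.
    rewrite le_eqVlt; apply/orP; left; apply/eqP; apply: eq_bigl => i.
    by case: (ltnP i j) => ij; rewrite ?andbF// andbT (ltn_trans ij jk).
  apply: (@le_trans _ _ (\sum_(i < N | ~~ (i < j)%N) tau`_j)).
    apply: ler_sum => i; rewrite -leqNgt => ji.
    apply: sorted_nth_ge => //; first by case: et.
    by rewrite (size_eigenvalues et).
  rewrite -[N in leRHS]card_ord mulr_natl -sumr_const.
  rewrite [leRHS](bigID (fun i : 'I_N => (i < j)%N))/= addrC lerDl.
  by apply: sumr_ge0 => i _; exact: eigenvalue_ge0.
have := le_trans trace_scov_ge tr_le => h.
have h2 : N%:R / 16 <= n%:R^-1 * \sum_a \sum_i y (i, a) ^+ 2.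
  by rewrite -ler_pdivrMl ?invr_gt0// invrK mulrA.
have h3 : l0 * (N%:R / 16 - K1) <= k%:R * (K1 * L) + N%:R * tau`_j.
  by apply: le_trans h; rewrite ler_wpM2l ?(ltW l0p)// lerD2r.
have h4 : l0 * (32 * (K1 + k%:R * (K1 * L) / l0)) <= l0 * N%:R.
  by rewrite ler_wpM2l// ltW.
have h5 : l0 * (k%:R * (K1 * L) / l0) = k%:R * (K1 * L).
  by rewrite mulrC divfK// gt_eqF.
rewrite -(ler_pM2l NR).
move: h3 h4; rewrite !mulrDr !(mulrCA l0 32) h5.
set X := k%:R * (K1 * L) in h5 *; lra.
Qed.

End spectrum_bounds.

(** * The operator norm of a normal matrix *)

Section net.
Context {R : realType}.

Section one_dimension.
Variable m : nat.

(** Integer vectors divided by [4 * sqrt m], coded by signs and magnitudes so as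
    to form a finite type; [net] selects those in the unit ball. *)
Definition net_index := {ffun 'I_m -> bool * 'I_(4 * m).+1}.

Definition net_vec (f : net_index) (i : 'I_m) : R :=
  (-1) ^+ (f i).1 * (f i).2%:R / (4 * Num.sqrt m%:R).

Definition net : {set net_index} :=
  [set f : net_index | (\sum_i (f i).2 ^ 2 <= 16 * m)%N]%SET.

(** Give the integer vector [z] the weight [2 ^- |z| ^ 2].  It is at least
    [2 ^- (16 * m)] on the net, while the total weight factors over the [m]
    coordinates, each with a sum of at most 4. *)
Lemma card_net : (#|net|%:R : R) <= 2 ^+ (18 * m).
Proof.
pose w (x : bool * 'I_(4 * m).+1) : R := 2^-1 ^+ (x.2 ^ 2).
have w0 x : 0 <= w x by rewrite exprn_ge0.
have wsum : \sum_x w x <= 4.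
  rewrite -(pair_big xpredT xpredT (fun b j => w (b, j)))/= big_bool/=.
  suff : \sum_(j < (4 * m).+1) (2^-1 ^+ (j ^ 2) : R) <= 2 by rewrite /w/=; lra.
  have geo q : \sum_(j < q) (2^-1 ^+ j : R) <= 2 - 2^-1 ^+ q * 2.
    elim: q => [|q IHq]; first by rewrite big_ord0 expr0; lra.
    by rewrite big_ord_recr/= exprS; move: (2^-1 ^+ q) IHq => x; lra.
  apply: le_trans (_ : \sum_(j < (4 * m).+1) (2^-1 ^+ j : R) <= _).
    apply: ler_sum => j _; rewrite ler_wiXn2l//.
      by rewrite invf_le1// ler1n.
    by case: (nat_of_ord j) => // j'; rewrite expnS leq_pmulr.
  apply: le_trans (geo _) _; rewrite gerBl mulr_ge0// exprn_ge0//.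
apply: (@le_trans _ _ (\sum_(f : net_index) 2 ^+ (16 * m) * \prod_i w (f i))).
  rewrite -sum1_card natr_sum (bigID (mem net) predT)/=.
  apply: ler_wpDr.
    by apply: sumr_ge0 => f _; rewrite mulr_ge0 ?exprn_ge0 ?prodr_ge0.
  apply: ler_sum => f; rewrite finset.inE => fn; rewrite /w prodrXr exprVn.
  by rewrite ler_pdivlMr ?exprn_gt0// mul1r ler_weXn2l ?ler1n.
rewrite -mulr_sumr -(bigA_distr_bigA (fun _ x => w x)) prodr_const card_ord.
rewrite (_ : 18 * m = 16 * m + 2 * m)%N; last by lia.
rewrite exprD ler_wpM2l ?exprn_ge0// exprM.
apply: lerXn2r; rewrite ?nnegrE ?exprn_ge0 ?sumr_ge0//.
by apply: le_trans wsum _; rewrite expr2; lra.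
Qed.

(** Rounding the coordinates towards 0 to multiples of [1 / (4 * sqrt m)] does not
    increase the norm. *)
Lemma net_round (v : 'I_m -> R) : dot v v <= 1 -> exists2 f, f \in net &
  dot (net_vec f) (net_vec f) <= 1 /\
  dot (v - net_vec f) (v - net_vec f) <= 4^-1 ^+ 2.
Proof.
move=> v1; pose D : R := 4 * Num.sqrt m%:R.
have [m0|m0] := posnP m.
  have i0 (i : 'I_m) : False by have := ltn_ord i; rewrite {2}m0.
  exists [ffun=> (true, ord0)].
    by rewrite finset.inE big1// => i; case: (i0 i).
  by split; rewrite /dot big1 ?exprn_ge0// => i; case: (i0 i).
have mR : 0 < m%:R :> R by rewrite ltr0n.
have D0 : 0 < D by rewrite mulr_gt0// sqrtr_gt0.
have Dge0 := ltW D0.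
have D2 : D ^+ 2 = 16 * m%:R by rewrite exprMn sqr_sqrtr ?ltW//; lra.
pose t i := Num.truncn (D * `|v i|).
have tP i : (t i)%:R <= D * `|v i| < (t i).+1%:R.
  by apply: truncn_itv; rewrite mulr_ge0.
have tsq i : (t i)%:R ^+ 2 <= D ^+ 2 * v i ^+ 2.
  rewrite -[v i ^+ 2]real_normK ?num_real// -exprMn.
  by rewrite ler_pXn2r ?nnegrE ?mulr_ge0//; case/andP: (tP i).
have sum_t : \sum_i (t i)%:R ^+ 2 <= D ^+ 2.
  apply: le_trans (_ : \sum_i D ^+ 2 * v i ^+ 2 <= _); first exact: ler_sum.
  rewrite -mulr_sumr -[leRHS]mulr1 ler_wpM2l ?sqr_ge0//.
have tN : (\sum_i t i ^ 2 <= 16 * m)%N.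
  rewrite -(ler_nat R) natr_sum; apply: le_trans (_ : \sum_i (t i)%:R ^+ 2 <= _).
    by apply: ler_sum => i _; rewrite natrX.
  by apply: le_trans sum_t _; rewrite D2 natrM.
have tq i : (t i < (4 * m).+1)%N.
  rewrite ltnS -(@leq_exp2r _ _ 2)//.
  have : (t i ^ 2 <= 16 * m)%N by apply: leq_trans tN; rewrite (bigD1 i)//= leq_addr.
  by move=> h; apply: leq_trans h _; rewrite expnMn; nia.
pose f : net_index := [ffun i => (v i < 0, Ordinal (tq i))].
have fE i : net_vec f i = (-1) ^+ (v i < 0)%R * (t i)%:R / D.
  by rewrite /net_vec ffunE.
clearbody D; exists f; first by rewrite finset.inE; under eq_bigr do rewrite ffunE.
split.
  apply: (@le_trans _ _ (\sum_i (t i)%:R ^+ 2 / D ^+ 2)).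
    apply: ler_sum => i _; rewrite fE -expr2 !exprMn sqrr_sign mul1r exprVn.
    exact: lexx.
  by rewrite -mulr_suml ler_pdivrMr ?exprn_gt0// mul1r.
apply: (@le_trans _ _ (\sum_(i < m) (D ^+ 2)^-1)).
  apply: ler_sum => i _; rewrite -expr2.
  rewrite [X in X ^+ 2](_ : _ = v i - net_vec f i)// fE.
  have vE : v i = (-1) ^+ (v i < 0)%R * `|v i| by rewrite mulr_sign_norm.
  rewrite {1}vE -mulrA -mulrBr exprMn sqrr_sign mul1r -exprVn.
  rewrite -[leLHS]real_normK ?num_real// ler_pXn2r ?nnegrE ?invr_ge0//.
  have -> : `|v i| - (t i)%:R / D = (D * `|v i| - (t i)%:R) / D.
    by field; rewrite gt_eqF.
  have Di : 0 <= D^-1 by rewrite invr_ge0.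
  have tD : 0 <= D * `|v i| - (t i)%:R by case/andP: (tP i); rewrite subr_ge0.
  rewrite normrM (ger0_norm tD) (ger0_norm Di) ler_piMl// lerBlDr; case/andP: (tP i) => _ /ltW.
  by rewrite -natr1 addrC.
rewrite sumr_const card_ord -mulr_natr D2; rewrite le_eqVlt; apply/orP; left.
by apply/eqP; field; rewrite gt_eqF.
Qed.

End one_dimension.

Variables (n N : nat) (y : 'I_n * 'I_N -> R).

Definition bil (v : 'I_n -> R) (w : 'I_N -> R) : R :=
  \sum_i \sum_a v i * w a * y (i, a).

Lemma bilDl v v' w : bil (v + v') w = bil v w + bil v' w.
Proof.
rewrite /bil -big_split; apply: eq_bigr => i _; rewrite -big_split.
by apply: eq_bigr => a _ /=; rewrite -!mulrDl.
Qed.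

Lemma bilDr v w w' : bil v (w + w') = bil v w + bil v w'.
Proof.
rewrite /bil -big_split; apply: eq_bigr => i _; rewrite -big_split.
by apply: eq_bigr => a _ /=; rewrite -mulrDl -mulrDr.
Qed.

Lemma bilZl c v w : bil (c *: v) w = c * bil v w.
Proof.
rewrite /bil mulr_sumr; apply: eq_bigr => i _; rewrite mulr_sumr.
by apply: eq_bigr => a _; rewrite !mulrA.
Qed.

Lemma bilZr c v w : bil v (c *: w) = c * bil v w.
Proof.
rewrite /bil mulr_sumr; apply: eq_bigr => i _; rewrite mulr_sumr.
apply: eq_bigr => a _.
rewrite [LHS](_ : _ = v i * (c * w a) * y (i, a))//; ring.
Qed.

(** A bilinear form bounded by [s] on pairs of net points is bounded by [2 * s]
    on the unit balls: rounding loses at most half of the supremum. *)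
Lemma net_bil s :
  (forall f h, f \in net n -> h \in net N -> bil (net_vec f) (net_vec h) <= s) ->
  forall v w, dot v v <= 1 -> dot w w <= 1 -> bil v w <= 2 * s.
Proof.
move=> hs; pose S := [set bil vw.1 vw.2 | vw in
  [set vw : ('I_n -> R) * ('I_N -> R) | dot vw.1 vw.1 <= 1 /\ dot vw.2 vw.2 <= 1]].
have coord (m : nat) (v : 'I_m -> R) i : dot v v <= 1 -> `|v i| <= 1.
  move=> v1; rewrite -(@expr_le1 _ 2)// real_normK ?num_real//.
  apply: le_trans v1; rewrite /dot (bigD1 i)//= -expr2 lerDl.
  by apply: sumr_ge0 => j _; rewrite -expr2 sqr_ge0.
have ubS : has_ubound S.
  exists (\sum_i \sum_a `|y (i, a)|) => _ [[v w] /= [v1 w1] <-].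
  apply: ler_sum => i _; apply: ler_sum => a _; apply: le_trans (ler_norm _) _.
  rewrite !normrM ler_piMl// mulr_ile1//; exact: coord.
have S0 : S !=set0.
  exists (bil 0 0), (0, 0) => //=; rewrite /dot !big1 ?ler01//.
    by move=> i _; rewrite mulr0.
  by move=> i _; rewrite mulr0.
have leS v w : dot v v <= 1 -> dot w w <= 1 -> bil v w <= sup S.
  by move=> v1 w1; apply: ub_le_sup => //; exists (v, w).
have quarter (m : nat) (u : 'I_m -> R) : dot u u <= 4^-1 ^+ 2 -> dot (4 *: u) (4 *: u) <= 1.
  by rewrite dotZl dotZr => h; lra.
suff : sup S <= s + sup S / 2.
  move=> h v w v1 w1; apply: le_trans (leS v w v1 w1) _; lra.
apply: ge_sup => // _ [[v w] /= [v1 w1] <-].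
have [f fn [f1 vf]] := net_round v1.
have [h hn [h1 wh]] := net_round w1.
have -> : bil v w = bil (net_vec f) (net_vec h) + bil (v - net_vec f) w
    + bil (net_vec f) (w - net_vec h).
  have -> : bil v w = bil (net_vec f) w + bil (v - net_vec f) w.
    by rewrite -bilDl subrKC.
  have -> : bil (net_vec f) w
      = bil (net_vec f) (net_vec h) + bil (net_vec f) (w - net_vec h).
    by rewrite -bilDr subrKC.
  by rewrite addrAC.
have h2 := hs f h fn hn.
have h3 := leS _ _ (quarter _ _ vf) w1.
have h4 := leS _ _ f1 (quarter _ _ wh).
move: h3 h4; rewrite bilZl bilZr; lra.
Qed.

(** The norm of the image of [w] is the value of the form at [w] and the image. *)
Lemma net_op_bound s K1 : 0 <= s -> 4 * s ^+ 2 <= K1 * n%:R ->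
  (forall f h, f \in net n -> h \in net N -> bil (net_vec f) (net_vec h) <= s) ->
  op_bound y K1.
Proof.
move=> s0 sK hs w; pose F i := \sum_a y (i, a) * w a.
have bF v : bil v w = dot v F.
  apply: eq_bigr => i _; rewrite mulr_sumr; apply: eq_bigr => a _.
  by rewrite (mulrC (y _)) mulrA.
have key : nrm F <= 2 * s * nrm w.
  have [F0|Fn0] := eqVneq (nrm F) 0; first by rewrite F0 !mulr_ge0 ?nrm_ge0.
  have Fp : 0 < nrm F by rewrite lt_neqAle eq_sym Fn0 nrm_ge0.
  have [w0|wn0] := eqVneq (nrm w) 0.
    have /dot_eq0 w00 : dot w w = 0 by rewrite -nrm_sqr w0 expr0n.
    move: Fn0; rewrite /nrm /dot big1 ?sqrtr0 ?eqxx// => i _.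
    by rewrite {1}/F big1 ?mul0r// => a _; rewrite w00 mulr0.
  have wp : 0 < nrm w by rewrite lt_neqAle eq_sym wn0 nrm_ge0.
  have unit (m : nat) (u : 'I_m -> R) : 0 < nrm u ->
      dot ((nrm u)^-1 *: u) ((nrm u)^-1 *: u) <= 1.
    move=> u0; rewrite dotZl dotZr -nrm_sqr expr2 mulKf ?gt_eqF//.
    by rewrite mulVf ?gt_eqF.
  have := net_bil hs (unit _ _ Fp) (unit _ _ wp).
  rewrite bilZl bilZr bF -nrm_sqr expr2 mulrCA mulKf ?gt_eqF//.
  by rewrite mulrC ler_pdivrMr.
have -> : \sum_i (\sum_a y (i, a) * w a) ^+ 2 = nrm F ^+ 2.
  by rewrite nrm_sqr; apply: eq_bigr => i _; rewrite expr2.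
have -> : \sum_a w a ^+ 2 = nrm w ^+ 2.
  by rewrite nrm_sqr; apply: eq_bigr => i _; rewrite expr2.
apply: le_trans (_ : (2 * s * nrm w) ^+ 2 <= _).
  by rewrite ler_pXn2r ?nnegrE ?nrm_ge0// !mulr_ge0 ?nrm_ge0.
rewrite exprMn ler_wpM2r ?sqr_ge0//; apply: le_trans sK.
by rewrite exprMn; lra.
Qed.

End net.

Section normal_tail.
Context {R : realType}.
Local Notation N01 := (@normal_prob R 0 1).
Local Notation mu := (@lebesgue_measure R).

(** Beyond [s] the standard normal density is at most [2 * exp (- s ^ 2 / 4)]
    times the normal density of variance 2. *)
Lemma normal_tail (s : R) : 0 <= s ->
  (N01 `[s, +oo[%classic <= (2 * expR (- (s ^+ 2 / 4)))%:E)%E.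
Proof.
move=> s0; pose c := 2 * expR (- (s ^+ 2 / 4)).
pose q := Num.sqrt 2 : R; have q2 : q ^+ 2 = 2 by rewrite sqr_sqrtr.
have q0 : q != 0 by rewrite sqrtr_eq0 -ltNge.
have c0 : 0 <= c by rewrite mulr_ge0 ?expR_ge0.
have mpdf (u : R) (A : set R) : measurable_fun A (fun x => (normal_pdf 0 u x)%:E).
  by apply/measurable_EFinP/measurable_funTS; exact: measurable_normal_pdf.
have -> : (2 * expR (- (s ^+ 2 / 4)))%:E = (c%:E * \int[mu]_x (normal_pdf 0 q x)%:E)%E.
  by rewrite integral_normal_pdf mule1.
rewrite -ge0_integralZl//; last 2 first.
  exact: mpdf.
  by move=> x _; rewrite lee_fin normal_pdf_ge0.
rewrite /normal_prob; apply: (@le_trans _ _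
    (\int[mu]_(x in `[s, +oo[%classic) (c%:E * (normal_pdf 0 q x)%:E))%E).
  apply: ge0_le_integral => //.
  - by move=> x _; rewrite lee_fin normal_pdf_ge0.
  - exact: mpdf.
  - by apply: measurable_funeM; exact: mpdf.
  move=> x; rewrite /= in_itv/= andbT => sx; rewrite -EFinM lee_fin.
  rewrite !normal_pdfE ?oner_neq0// /normal_peak /normal_fun subr0 q2 expr1n.
  have x2 : s ^+ 2 <= x ^+ 2.
    by rewrite ler_pXn2r ?nnegrE// (le_trans s0).
  have pk : (Num.sqrt (1 * pi *+ 2))^-1 <= 2 * (Num.sqrt (2 * pi *+ 2))^-1 :> R.
    have p0 : 0 < Num.sqrt (1 * pi *+ 2) :> R.
      by rewrite sqrtr_gt0 mul1r mulrn_wgt0// pi_gt0.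
    have -> : 2 * pi *+ 2 = (1 * pi *+ 2) * 2 :> R by rewrite !mulr2n; ring.
    rewrite sqrtrM; last by rewrite mul1r mulrn_wge0// pi_ge0.
    rewrite invfM mulrCA -[leLHS]mulr1 ler_wpM2l//.
    rewrite -/q -q2 expr2 -mulrA divff// mulr1.
    by rewrite -(@ler_pXn2r _ 2)// ?nnegrE ?sqrtr_ge0// q2 expr1n ler1n.
  have ex : expR (- x ^+ 2 / (1 *+ 2)) <= expR (- (s ^+ 2 / 4)) * expR (- x ^+ 2 / (2 *+ 2)).
    by rewrite -expRD ler_expR; lra.
  have i0 : 0 <= (Num.sqrt (1 * pi *+ 2))^-1 :> R by rewrite invr_ge0 sqrtr_ge0.
  apply: le_trans (ler_pM i0 (expR_ge0 _) pk ex) _; rewrite /c.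
  by rewrite le_eqVlt; apply/orP; left; apply/eqP; ring.
apply: ge0_subset_integral => //.
  by apply: measurable_funeM; exact: mpdf.
by move=> x _; rewrite mule_ge0// lee_fin normal_pdf_ge0.
Qed.

End normal_tail.

Section linear_forms.
Context {R : realType} {d : measure_display} {T : measurableType d}.
Variable P : probability T R.
Local Notation N01 := (@normal_prob R 0 1).

(** By rotation invariance a unit linear form of independent standard normal
    variables is standard normal. *)
Lemma linear_form_prob {I : finType} (Y : I -> T -> R) (a : I -> R) (B : set R) :
  iidN P Y -> dot a a = 1 -> measurable B ->
  P [set t | B (\sum_i a i * Y i t)] = N01 B.
Proof.
move=> nY a1 mB.
have [m mE] : {m | m = #|I|} by exists #|I|.
case: m mE => [/esym I0|m mE].
  by move: a1; rewrite /dot big1 => [/esym/eqP|i]; [rewrite oner_eq0|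
    have := card0_eq I0 i; rewrite !inE].
pose f (j : 'I_m.+1) : I := enum_val (cast_ord mE j).
pose f' (i : I) : 'I_m.+1 := cast_ord (esym mE) (enum_rank i).
have fK : cancel f f' by move=> j; rewrite /f /f' enum_valK cast_ordK.
have f'K : cancel f' f by move=> i; rewrite /f /f' cast_ordKV enum_rankK.
pose v : 'cV[R]_m.+1 := \col_j a (f j).
have re (F : I -> R) : \sum_i F i = \sum_j F (f j).
  by apply: reindex; exists f' => i _; rewrite ?fK ?f'K.
have v1 : v^T *m v = 1%:M.
  rewrite trmx_mul_col; congr (_%:M); rewrite -a1 /dot re.
  by apply: eq_bigr => j _; rewrite mxE expr2.
(* the form is the first coordinate of the image under the transpose of [H] *)
have [H oH Hv] := orthogonal_first_col v1.
have oHt : orthogonal H^T by rewrite /orthogonal trmxK orthogonal_tr.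
have nZ := orthogonal_preserves_iidN oHt (iidN_reindex fK f'K nY).
rewrite -(@iidN_marginal R d T P _ _ ord0 B nZ mB); congr (P _).
have sumE t : lin_image H^T (fun j => Y (f j)) ord0 t = \sum_i a i * Y i t.
  rewrite re; apply: eq_bigr => j _; rewrite mxE; congr (_ * _).
  by have /matrixP/(_ j 0) := Hv; rewrite !mxE.
by apply/seteqP; split=> t; rewrite /preimage /= sumE.
Qed.

Lemma linear_form_tail {I : finType} (Y : I -> T -> R) (a : I -> R) (s : R) :
  iidN P Y -> dot a a <= 1 -> 0 < s ->
  (P [set t | (s < \sum_i a i * Y i t)%R] <= (2 * expR (- (s ^+ 2 / 4)))%:E)%E.
Proof.
move=> nY a1 s0; pose r := nrm a.
have mform (b : I -> R) : measurable_fun setT (fun t => \sum_i b i * Y i t).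
  by apply: measurable_sum => i; apply: measurable_funM => //; exact: nY.1.
have [r0|rn0] := eqVneq r 0.
  rewrite (_ : [set t | _] = set0) ?measure0 ?lee_fin ?mulr_ge0 ?expR_ge0//.
  have /dot_eq0 a0 : dot a a = 0 by rewrite -nrm_sqr -/r r0 expr0n.
  apply/seteqP; split=> t //=; rewrite big1 ?ltNge ?(ltW s0)// => i _.
  by rewrite a0 mul0r.
have rp : 0 < r by rewrite lt_neqAle eq_sym rn0 nrm_ge0.
have r1 : r <= 1.
  by rewrite -(@expr_le1 _ 2)// ?nrm_ge0// nrm_sqr.
have b1 : dot (r^-1 *: a) (r^-1 *: a) = 1.
  by rewrite dotZl dotZr -nrm_sqr -/r expr2 mulKf// mulVf.
apply: le_trans (normal_tail (ltW s0)).
rewrite -(linear_form_prob nY b1 (measurable_itv _)).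
have me (b : I -> R) A : measurable A -> measurable [set t | A (\sum_i b i * Y i t)].
  by move=> mA; rewrite -[X in measurable X]setTI; exact: mform.
apply: le_measure; rewrite ?inE.
- by have := me a _ (measurable_itv `]s, +oo[); congr measurable; apply/seteqP; split=> t /=; rewrite in_itv/= andbT.
- exact: me.
move=> t /= st; rewrite in_itv/= andbT.
rewrite (eq_bigr (fun i => r^-1 * (a i * Y i t))); last first.
  by move=> i _; rewrite mulrA.
rewrite -mulr_sumr; apply: le_trans (ltW st) _.
by rewrite ler_peMl ?(le_trans (ltW s0) (ltW st))// invf_ge1.
Qed.

Lemma union_bound {J : finType} (E : J -> set T) :
  (forall j, measurable (E j)) ->
  measurable [set t | exists j, E j t] /\
  (P [set t | exists j, E j t] <= \sum_j P (E j))%E.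
Proof.
move=> mE; have -> : [set t | exists j, E j t] = \big[setU/set0]_j E j.
  apply/seteqP; split=> t.
    by move=> [j Ej]; rewrite (bigD1 j)//=; left.
  elim/big_ind: _ => [//|A B hA hB [|]//|j _ Ej].
  by exists j.
split; first exact: bigsetU_measurable.
elim: (index_enum J) => [|j r IHr]; first by rewrite !big_nil measure0.
rewrite !big_cons; apply: le_trans (measureU2 _ _ _) _ => //.
  exact: bigsetU_measurable.
by rewrite leeD2l.
Qed.

End linear_forms.

Section operator_norm.
Context {R : realType} {d : measure_display} {T : measurableType d}.
Variable P : probability T R.

Lemma net_norm m (f : net_index m) : f \in net m ->
  dot (net_vec (R := R) f) (net_vec f) <= 1.
Proof.
rewrite finset.inE => fm; have [m0|m0] := posnP m.
  by rewrite /dot big1 // => i; have := ltn_ord i; rewrite {2}m0.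
have mR : 0 < m%:R :> R by rewrite ltr0n.
have -> : dot (net_vec (R := R) f) (net_vec f)
    = (\sum_i (f i).2 ^ 2)%N%:R / (16 * m%:R).
  rewrite natr_sum mulr_suml; apply: eq_bigr => i _.
  rewrite /net_vec -expr2 !exprMn sqrr_sign mul1r exprVn exprMn sqr_sqrtr ?ltW//.
  by rewrite natrX (_ : 4 ^+ 2 = 16 :> R)//; rewrite -natrX.
by rewrite ler_pdivrMr ?mulr_gt0// mul1r -natrM ler_nat.
Qed.

(** A union bound over the pairs of net points: on each of them the bilinear form
    is a linear form of norm at most 1 in the entries, so it has normal tails. *)
Lemma op_bound_probability (n N : nat) (kappa : R)
    (g : 'I_n * 'I_N -> T -> R) :
  (0 < n)%N -> N%:R <= kappa * n%:R -> iidN P g ->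
  exists Bad : set T, [/\ measurable Bad, fine (P Bad) <= 2 * 2^-1 ^+ n &
    forall t, ~ Bad t -> op_bound (fun ia => g ia t) (16 * (19 + 18 * kappa))].
Proof.
move=> n0 Nk ng.
(* one deviation has probability at most [2 * 2 ^- q], and there are at most
   [2 ^ (18 * (n + N))] pairs of net points *)
pose q := (18 * (n + N) + n)%N.
pose s : R := 2 * Num.sqrt q%:R.
have q0 : (0 < q)%N by rewrite /q addn_gt0 n0 orbT.
have s0 : 0 < s by rewrite mulr_gt0// sqrtr_gt0 ltr0n.
have s2 : s ^+ 2 = 4 * q%:R by rewrite exprMn sqr_sqrtr ?ler0n//; lra.
pose a (fh : net_index n * net_index N) (ia : 'I_n * 'I_N) : R :=
  net_vec fh.1 ia.1 * net_vec fh.2 ia.2.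
pose E (fh : net_index n * net_index N) : set T :=
  if (fh.1 \in net n) && (fh.2 \in net N)
  then [set t | s < \sum_ia a fh ia * g ia t] else set0.
have mE fh : measurable (E fh).
  rewrite /E; case: ifP => // _.
  have mf : measurable_fun setT (fun t => \sum_ia a fh ia * g ia t).
    by apply: measurable_sum => i; apply: measurable_funM => //; exact: ng.1.
  have := mf measurableT _ (measurable_itv `]s, +oo[); rewrite setTI.
  by congr measurable; apply/seteqP; split=> t /=; rewrite in_itv/= andbT.
have [mB PB] := union_bound P mE.
exists [set t | exists fh, E fh t]; split=> // [|t nB].
  pose tau : R := 2 * expR (- (s ^+ 2 / 4)).
  have tau0 : 0 <= tau by rewrite mulr_ge0// expR_ge0.
  have PE fh : (P (E fh) <= (((fh.1 \in net n) && (fh.2 \in net N))%:R * tau)%:E)%E.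
    rewrite /E; case: ifP => [/andP[h1 h2]|_]; last by rewrite measure0 mul0r.
    rewrite mul1r; apply: linear_form_tail => //.
    rewrite /dot -(pair_big xpredT xpredT (fun i j => a fh (i, j) * a fh (i, j)))/=.
    rewrite (_ : \sum_i _ = dot (net_vec fh.1) (net_vec fh.1) * dot (net_vec fh.2) (net_vec fh.2)).
      by rewrite mulr_ile1 ?dot_ge0 ?net_norm.
    rewrite /dot mulr_suml; apply: eq_bigr => i _; rewrite mulr_sumr.
    by apply: eq_bigr => j _; rewrite /a/= mulrACA.
  have Pfin : P [set t | exists fh, E fh t] \is a fin_num by rewrite fin_num_measure.
  rewrite -lee_fin fineK//; apply: le_trans PB _.
  apply: (@le_trans _ _ (\sum_fh (((fh.1 \in net n) && (fh.2 \in net N))%:R * tau)%:E)%E).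
    by apply: lee_sum => fh _; exact: PE.
  rewrite sumEFin lee_fin -mulr_suml.
  have -> : \sum_(fh : net_index n * net_index N)
      ((fh.1 \in net n) && (fh.2 \in net N))%:R = #|net n|%:R * #|net N|%:R :> R.
    have cardR (J : finType) (A : {set J}) : #|A|%:R = \sum_j (j \in A)%:R :> R.
      by rewrite -sum1_card natr_sum big_mkcond; apply: eq_bigr => j _; case: ifP.
    rewrite -(pair_big xpredT xpredT (fun f h => ((f \in net n) && (h \in net N))%:R))/=.
    rewrite !cardR mulr_suml; apply: eq_bigr => f _.
    by rewrite mulr_sumr; apply: eq_bigr => h _; rewrite -natrM mulnb.
  have tauq : tau <= 2 * 2^-1 ^+ q.
    rewrite ler_wpM2l// s2 (_ : 4 * q%:R / 4 = q%:R); last by field.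
    rewrite -mulrN1 mulrC expRM_natr ler_pXn2r ?nnegrE ?expR_ge0 ?invr_ge0//.
    rewrite expRN lef_pV2 ?posrE ?expR_gt0//.
    by have := expR_ge1Dx (1 : R); lra.
  have cn := @card_net R n; have cN := @card_net R N.
  apply: le_trans (_ : 2 ^+ (18 * n) * 2 ^+ (18 * N) * (2 * 2^-1 ^+ q) <= _).
    by rewrite ler_pM// ?mulr_ge0// ler_pM.
  rewrite -exprD -mulnDr /q exprD mulrCA; apply: ler_wpM2l => //.
  by rewrite mulrA -exprMn divff// expr1n mul1r.
apply: (net_op_bound (ltW s0)) => [|f h fn hn].
  by rewrite s2 /q natrD natrM natrD; lra.
rewrite leNgt; apply/negP => lt; apply: nB; exists (f, h); rewrite /E/= fn hn/=.
move: lt; rewrite /bil (pair_big xpredT xpredT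
  (fun i j => net_vec f i * net_vec h j * g (i, j) t))/=.
by congr (_ < _); apply: eq_bigr => -[i j].
Qed.

End operator_norm.

(** * The energy of a normal matrix *)

Section energy.
Context {R : realType} {d : measure_display} {T : measurableType d}.
Variable P : probability T R.
Local Notation N01 := (@normal_prob R 0 1).
Local Notation mu := (@lebesgue_measure R).

Lemma probability_le_sum {J : finType} (E : J -> set T) (L : set T) (c : R) :
  (forall j, measurable (E j)) -> measurable L ->
  (forall t, L t -> c <= \sum_j \1_(E j) t) ->
  c * fine (P L) <= \sum_j fine (P (E j)).
Proof.
move=> mE mL h; have [c0|c0] := ltP c 0.
  apply: (@le_trans _ _ 0).
    by rewrite mulr_le0_ge0 ?fine_ge0// ltW.
  by apply: sumr_ge0 => j _; rewrite fine_ge0.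
have PE (A : set T) : measurable A -> (fine (P A))%:E = (\int[P]_t (\1_A t)%:E)%E.
  by move=> mA; rewrite fineK ?fin_num_measure// integral_indic// setIT.
rewrite -lee_fin -sumEFin (eq_bigr _ (fun j _ => PE _ (mE j))) EFinM PE//.
rewrite -ge0_integral_sum//; last first.
  by move=> j; apply/measurable_EFinP; exact: measurable_indic.
rewrite -ge0_integralZl//; last first.
  by apply/measurable_EFinP; exact: measurable_indic.
apply: ge0_le_integral => //.
- by move=> t _; rewrite -EFinM lee_fin mulr_ge0.
- by apply: measurable_funeM; apply/measurable_EFinP; exact: measurable_indic.
- by apply: emeasurable_sum => j; apply/measurable_EFinP; exact: measurable_indic.
- move=> t _; rewrite sumEFin -EFinM lee_fin indicE.
  have [/set_mem Lt|_] := boolP (t \in L); first by rewrite mulr1; exact: h.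
  by rewrite mulr0 sumr_ge0.
Qed.

(** The density is at most [1 / sqrt (2 * pi)], hence at most 1/2, and the interval
    has length 1. *)
Lemma normal_half : (N01 `](- 2^-1)%R, (2^-1)%R[%classic <= (2^-1)%:E)%E.
Proof.
apply: (@le_trans _ _ (\int[mu]_(x in `](- 2^-1)%R, (2^-1)%R[%classic) (cst (2^-1)%:E x))%E).
  apply: ge0_le_integral => //.
  - by move=> x _; rewrite lee_fin normal_pdf_ge0.
  - by apply/measurable_EFinP/measurable_funTS; exact: measurable_normal_pdf.
  move=> x _; rewrite lee_fin; apply: le_trans (normal_pdf_ub _ _ _) _.
    exact: oner_neq0.
  have p4 : 4 <= pi *+ 2 :> R by have := @pi_ge2 R; rewrite mulr2n; lra.
  have p0 : 0 < pi *+ 2 :> R by apply: lt_le_trans p4.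
  rewrite /normal_peak expr1n mul1r lef_pV2 ?posrE ?sqrtr_gt0//.
  rewrite -(@ler_pXn2r _ 2)// ?nnegrE ?sqrtr_ge0// sqr_sqrtr ?(ltW p0)//.
  by apply: le_trans p4; rewrite expr2; lra.
rewrite integral_cst//= lebesgue_measure_itv/= lte_fin.
case: ifP => _; last by rewrite mule0 lee_fin.
by rewrite -EFinB -EFinM lee_fin; lra.
Qed.

(** With probability at least 1/3 a quarter of the entries exceed 1/2 in
    absolute value, by Markov's inequality for the number of the others. *)
Lemma energy_probability {I : finType} (g : I -> T -> R) :
  (0 < #|I|)%N -> iidN P g ->
  exists Low : set T, [/\ measurable Low, fine (P Low) <= 2 / 3 &
    forall t, ~ Low t -> #|I|%:R / 16 <= \sum_i g i t ^+ 2].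
Proof.
move=> I0 ng; pose M : R := #|I|%:R.
have M0 : 0 < M by rewrite ltr0n.
pose A i := g i @^-1` `]- 2^-1, 2^-1[%classic.
have mA i : measurable (A i).
  by rewrite -[X in measurable X]setTI; apply: ng.1 => //; exact: measurable_itv.
have PA i : fine (P (A i)) <= 2^-1.
  rewrite -lee_fin fineK ?fin_num_measure//.
  by rewrite (iidN_marginal i ng (measurable_itv _)); exact: normal_half.
pose cnt t : R := \sum_i \1_(A i) t.
have mcnt : measurable_fun setT cnt.
  by apply: measurable_sum => i; exact: measurable_indic.
have mL : measurable [set t | M * (3 / 4) <= cnt t].
  by rewrite -[X in measurable X]setTI; apply: measurable_fun_le.
exists [set t | M * (3 / 4) <= cnt t]; split=> // [|t /negP]; last first.
  rewrite -ltNge => lt.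
  have : \sum_i ((1 - \1_(A i) t) / 4 : R) <= \sum_i g i t ^+ 2.
    apply: ler_sum => i _; rewrite indicE.
    have [_|nA] := boolP (t \in A i); first by rewrite subrr mul0r sqr_ge0.
    rewrite subr0; have : ~ A i t by move=> h; move/negP: nA; apply; rewrite inE.
    rewrite /A/= in_itv/= => /negP; rewrite negb_and -!leNgt => /orP[h|h]; nra.
  rewrite -mulr_suml sumrB sumr_const -/M -/(cnt t); apply: le_trans.
  by lra.
have := probability_le_sum mA mL (fun t h => h).
have : \sum_i fine (P (A i)) <= M / 2.
  apply: le_trans (ler_sum _ (fun i _ => PA i)) _.
  by rewrite sumr_const -[X in X <= _]mulr_natl.
move=> h1 h2; have h3 := le_trans h2 h1.
rewrite -(ler_pM2l M0); lra.
Qed.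

End energy.

(** * The augmented model in normal coordinates *)

Section whitening.
Context {R : realType} {d : measure_display} {T : measurableType d}.
Variable P : probability T R.
Local Notation N01 := (@normal_prob R 0 1).

Let prod_pair {I J : finType} (F : I * J -> R) :
  \prod_ia F ia = \prod_i \prod_j F (i, j).
Proof.
by rewrite (pair_big xpredT xpredT (fun i j => F (i, j)))/=; apply: eq_bigr => -[].
Qed.

Lemma std_normal_iidN {m} (W : T -> 'cV[R]_m) : std_normal P W ->
  iidN P (fun i t => W t i 0).
Proof.
move=> [mW nW iW]; split=> // B mB.
have := iW [set: 'I_m]%SET (fun i => (fun t => W t i 0) @^-1` B i).
rewrite (_ : \bigcap_(i in _) _ = [set t | forall i, B i (W t i 0)]); last first.
  by apply/seteqP; split=> t /= h i; [apply: h; rewrite /= finset.inE|move=> _; exact: h].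
move=> ->; last by move=> i _; exists (B i); [exact: mB|rewrite setTI].
by congr EFin; apply: eq_big => [i|i _]; rewrite ?finset.inE// nW.
Qed.

Section one_vector.
Variables (m : nat) (mu : 'cV[R]_m) (Sigma O : 'M[R]_m) (ell : 'I_m -> R).
Hypotheses (oO : orthogonal O) (ell0 : forall a, ell a != 0).
Hypothesis SigmaE : Sigma = O *m diag_mx (\row_a ell a ^+ 2) *m O^T.

Definition whiten (X : T -> 'cV[R]_m) (a : 'I_m) (t : T) : R :=
  (ell a)^-1 * \sum_b O b a * (X t b 0 - mu b 0).

Lemma whitenK X t : X t = mu + O *m \col_a (ell a * whiten X a t).
Proof.
apply/matrixP => b c; rewrite !ord1 mxE [(O *m _) _ _]mxE.
have HHt := orthogonal_tr oO.
have E a : ell a * whiten X a t = (O^T *m (X t - mu)) a 0.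
  rewrite /whiten mulrA divff// mul1r mxE.
  by apply: eq_bigr => b' _; rewrite !mxE.
have -> : \sum_a O b a * (\col_a (ell a * whiten X a t)) a 0
    = (O *m (O^T *m (X t - mu))) b 0.
  by rewrite [RHS]mxE; apply: eq_bigr => a _; rewrite mxE E.
by rewrite mulmxA HHt mul1mx !mxE subrKC.
Qed.

(** The whitened vector is the image of a standard normal vector under an
    orthogonal matrix, whichever square root of the covariance is used. *)
Lemma whiten_iidN X : multivariate_normal P mu Sigma X -> iidN P (whiten X).
Proof.
move=> [A [W [AS nW XE]]].
pose B := diag_mx (\row_a (ell a)^-1) *m O^T *m A.
have oB : orthogonal B.
  apply: mulmx1C; rewrite /B !trmx_mul trmxK tr_diag_mx !mulmxA.
  rewrite -(mulmxA _ A) AS SigmaE !mulmxA.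
  rewrite -(mulmxA _ O^T O) oO mulmx1 -(mulmxA _ O^T O) oO mulmx1.
  rewrite !mulmx_diag; apply/matrixP => i j; rewrite !mxE.
  by case: eqP => [->|_]; rewrite ?mulr1n ?mulr0n//; field.
have := orthogonal_preserves_iidN oB (std_normal_iidN nW).
rewrite (_ : lin_image B _ = whiten X)//.
apply/funext => a; apply/funext => t; rewrite /lin_image /whiten.
transitivity ((B *m W t) a 0); first by rewrite mxE.
rewrite /B -!mulmxA mul_diag_mx 2!mxE; congr (_ * _); rewrite mxE.
by apply: eq_bigr => b _; rewrite XE [(O^T)%R _ _]mxE [(mu + _) _ _]mxE addrAC subrr add0r.
Qed.

Definition sigma_gen (X : T -> 'cV[R]_m) : set (set T) :=
  \bigcup_(i in [set: 'I_m]) sigma_rv (fun t => X t i 0).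

(** Events about the whitened vector are events about the original one, so
    independence carries over. *)
Lemma whiten_sigma X (B : 'I_m -> set R) : (forall a, measurable (B a)) ->
  sigma_rvec X [set t | forall a, B a (whiten X a t)].
Proof.
move=> mB; pose T' := g_sigma_algebraType (sigma_gen X).
have mX i : measurable_fun setT (fun t : T' => X t i 0).
  move=> _ C mC; rewrite setTI; apply: sub_sigma_algebra.
  by exists i => //; exists C => //; rewrite setTI.
have mh a : measurable_fun setT (fun t : T' => whiten X a t).
  apply: measurable_funM => //; apply: measurable_sum => b.
  by apply: measurable_funM => //; apply: measurable_funB => //; exact: mX.
have : measurable [set t : T' | forall a, B a (whiten X a t)].
  have := measurable_vec mh (@measurableT _ _) (measurable_box mB).
  by rewrite setTI.
by [].
Qed.

End one_vector.

Section sample.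
Variables (n m : nat) (mu : 'cV[R]_m) (Sigma O : 'M[R]_m) (ell : 'I_m -> R).
Hypotheses (oO : orthogonal O) (ell0 : forall a, ell a != 0).
Hypothesis SigmaE : Sigma = O *m diag_mx (\row_a ell a ^+ 2) *m O^T.
Variable X : 'I_n -> T -> 'cV[R]_m.
Hypothesis nX : iid_normal P mu Sigma X.

Definition whiten_sample (ia : 'I_n * 'I_m) (t : T) : R :=
  whiten mu O ell (X ia.1) ia.2 t.

Lemma whiten_sample_iidN : iidN P whiten_sample.
Proof.
have [nXi iX] := nX.
have wi i := whiten_iidN oO ell0 SigmaE (nXi i).
split=> [ia|B mB]; first exact: (wi ia.1).1.
have := iX [set: 'I_n]%SET
  (fun i => [set t | forall a, B (i, a) (whiten mu O ell (X i) a t)]).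
rewrite (_ : \bigcap_(i in _) _ = [set t | forall ia, B ia (whiten_sample ia t)]); last first.
  apply/seteqP; split=> t /= h; first by move=> [i a]; apply: (h i); rewrite /= finset.inE.
  by move=> i _ a; exact: (h (i, a)).
move=> ->; last first.
  by move=> i _; exact: (@whiten_sigma _ mu O ell (X i) _ (fun a => mB (i, a))).
congr EFin; rewrite (prod_pair (fun ia => fine (N01 (B ia))))/=.
apply: eq_big => [i|i _]; first by rewrite finset.inE.
by rewrite ((wi i).2 (fun a => B (i, a))).
Qed.

Lemma whiten_sample_sigma (B : 'I_n * 'I_m -> set R) :
  (forall ia, measurable (B ia)) ->
  sigma_sample X [set t | forall ia, B ia (whiten_sample ia t)].
Proof.
move=> mB; pose G := \bigcup_(i in [set: 'I_n]) sigma_rvec (X i).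
have : measurable (\bigcap_(i in [set: 'I_n])
    [set t : g_sigma_algebraType G | forall a, B (i, a) (whiten mu O ell (X i) a t)]).
  apply: fin_bigcap_measurable; first exact: finite_finset.
  move=> i _.
  have h : G [set t | forall a, B (i, a) (whiten mu O ell (X i) a t)].
    by exists i => //; exact: (@whiten_sigma _ mu O ell (X i) _ (fun a => mB (i, a))).
  exact: (@sub_sigma_algebra _ setT G _ h).
rewrite (_ : \bigcap_(i in _) _ = [set t | forall ia, B ia (whiten_sample ia t)])//.
apply/seteqP; split=> t /= h; first by move=> [i a]; exact: (h i).
by move=> i _ a; exact: (h (i, a)).
Qed.

End sample.

(** Whitened predictors and augmentation are placed side by side, in the order of
    the coordinates of the augmented sample. *)
Lemma join_samples {n p r} (hx : 'I_n * 'I_p -> T -> R) (hs : 'I_n * 'I_r -> T -> R)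
    (F G : set (set T)) :
  iidN P hx -> iidN P hs -> independent_systems P F G ->
  (forall B, (forall ia, measurable (B ia)) -> F [set t | forall ia, B ia (hx ia t)]) ->
  (forall B, (forall ia, measurable (B ia)) -> G [set t | forall ia, B ia (hs ia t)]) ->
  iidN P (fun (ia : 'I_n * 'I_(p + r)) t =>
    match fintype.split ia.2 with inl a => hx (ia.1, a) t | inr b => hs (ia.1, b) t end).
Proof.
move=> [mx Px] [ms Ps] ind Fx Gs; split=> [[i a]/=|B mB].
  by case: (fintype.split a) => b; [exact: mx|exact: ms].
pose Bx (ia : 'I_n * 'I_p) := B (ia.1, lshift r ia.2).
pose Bs (ia : 'I_n * 'I_r) := B (ia.1, rshift p ia.2).
have mBx ia : measurable (Bx ia) by exact: mB.
have mBs ia : measurable (Bs ia) by exact: mB.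
rewrite (_ : [set t | _] = [set t | forall ia, Bx ia (hx ia t)] `&`
    [set t | forall ia, Bs ia (hs ia t)]); last first.
  apply/seteqP; split=> t /=.
    move=> h; split=> -[i a]; rewrite /Bx /Bs/=.
      by have := h (i, lshift r a); rewrite /= (unsplitK (inl a)).
    by have := h (i, rshift p a); rewrite /= (unsplitK (inr a)).
  move=> [h1 h2] [i a]/=; case: split_ordP => b ->.
    exact: (h1 (i, b)).
  exact: (h2 (i, b)).
rewrite ind; [|exact: Fx|exact: Gs].
rewrite [X in (X * _)%E](Px _ mBx) [X in (_ * X)%E](Ps _ mBs) -EFinM; congr EFin.
rewrite (prod_pair (fun ia => fine (N01 (Bx ia))))/=.
rewrite (prod_pair (fun ia => fine (N01 (Bs ia))))/=.
rewrite (prod_pair (fun ia => fine (N01 (B ia))))/=.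
by rewrite -big_split/=; apply: eq_bigr => i _; rewrite big_split_ord.
Qed.

End whitening.

Section blocks.
Variables (p r d m : nat).
Hypothesis fits : (d + m * r <= p)%N.

(** Below [d] are the signal coordinates, which have larger scales; the blocks are
    made of noise coordinates, so that exchanging one of them with the
    augmentation preserves the scales. *)
Definition augmented (a : 'I_(p + r)) : bool := (p <= a)%N.

Definition block (b : 'I_m) (a : 'I_(p + r)) : bool :=
  (d + b * r <= a < d + b.+1 * r)%N.

Let block_fits (b : 'I_m) : (d + b.+1 * r <= p)%N.
Proof. by apply: leq_trans fits; rewrite leq_add2l leq_mul2r ltn_ord orbT. Qed.

(** The default of [insubd] is never taken, because the blocks fit. *)
Definition swap_fun (b : 'I_m) (a : 'I_(p + r)) : 'I_(p + r) :=
  insubd a (if augmented a then d + b * r + (a - p)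
            else if block b a then p + (a - (d + b * r)) else a)%N.

Lemma swap_val b a : nat_of_ord (swap_fun b a) =
  (if augmented a then d + b * r + (a - p)
   else if block b a then p + (a - (d + b * r)) else a)%N.
Proof.
rewrite /swap_fun val_insubd ifT//; have ar := ltn_ord a; have bp := block_fits b.
rewrite /augmented /block mulSn in bp *; case: (leqP p a) => pa; first by lia.
by case: ifP => // /andP[h1 h2]; lia.
Qed.

Lemma swapK b : involutive (swap_fun b).
Proof.
move=> a; apply: val_inj => /=; rewrite swap_val.
have := swap_val b a; rewrite /augmented /block.
move: (nat_of_ord (swap_fun b a)) => a'.
have ar := ltn_ord a; have bp := block_fits b; rewrite mulSn in bp *.
case: (leqP p a) => pa; last case: (boolP (_ && _)) => h; move=> a'E;
  case: (leqP p a') => pa'; try lia; case: (boolP (_ && _)) => h'; lia.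
Qed.

Definition swap b : {perm 'I_(p + r)} := perm (inv_inj (@swapK b)).

Lemma block_swap b a : block b (swap b a) = augmented a.
Proof.
rewrite permE /block swap_val /augmented /block.
have ar := ltn_ord a; have bp := block_fits b; rewrite mulSn in bp *.
case: (leqP p a) => pa; first by lia.
by case: ifP => // h; lia.
Qed.

Lemma sum_block_le {R : realType} a : \sum_(b < m) (block b a)%:R <= 1 :> R.
Proof.
have [[b0 hb0]|none] := pselect (exists b, block b a); last first.
  by rewrite big1// => b _; case: (boolP (block b a)) => // h; case: none; exists b.
rewrite (bigD1 b0)//= hb0 big1 ?addr0// => b bb0.
case: (boolP (block b a)) => // hb; case/eqP: bb0; apply: val_inj => /=.
move: hb0 hb; rewrite /block => /andP[h1 h2] /andP[h3 h4].
by apply/eqP; rewrite eqn_leq; apply/andP; split; rewrite leqNgt; apply/negP => lt;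
  have := leq_mul lt (leqnn r); lia.
Qed.

Lemma swap_noise b (a : 'I_(p + r)) : swap b a != a ->
  (d <= a)%N /\ (d <= swap b a)%N.
Proof.
rewrite permE -val_eqE/= swap_val /augmented /block.
have ar := ltn_ord a; have bp := block_fits b; rewrite mulSn in bp *.
case: (leqP p a) => pa; first by lia.
by case: ifP => [/andP[h1 h2]|]; [lia|rewrite eqxx].
Qed.

End blocks.

Section sample_covariance.
Context {R : realType}.

Lemma sample_cov_affine {n N} (z v : 'I_n -> 'cV[R]_N) (m0 : 'cV[R]_N) (O : 'M[R]_N) :
  (0 < n)%N -> (forall i, z i = m0 + O *m v i) ->
  sample_cov z = O *m sample_cov v *m O^T.
Proof.
move=> n0 zE; have nR : n%:R != 0 :> R by rewrite pnatr_eq0 -lt0n.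
have meanE : sample_mean z = m0 + O *m sample_mean v.
  rewrite /sample_mean (eq_bigr _ (fun i _ => zE i)) big_split/= sumr_const card_ord.
  rewrite scalerDr -[m0 *+ n]scaler_nat scalerA mulVf// scale1r; congr (_ + _).
  by rewrite -mulmx_sumr scalemxAr.
rewrite /sample_cov -scalemxAr -scalemxAl; congr (_ *: _).
rewrite mulmx_sumr mulmx_suml; apply: eq_bigr => i _.
have -> : z i - sample_mean z = O *m (v i - sample_mean v).
  by rewrite zE meanE mulmxBr opprD addrACA subrr add0r.
by rewrite trmx_mul !mulmxA.
Qed.

Lemma sample_cov_scov {n N} (ell : 'I_N -> R) (y : 'I_n * 'I_N -> R) :
  (0 < n)%N ->
  sample_cov (fun i => \col_a (ell a * y (i, a))) = scov ell y.
Proof.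
move=> n0; have nR : 0 < n%:R :> R by rewrite ltr0n.
apply/matrixP => a b; rewrite !mxE summxE mulr_sumr; apply: eq_bigr => i _.
have colE a' : (\col_a0 (ell a0 * y (i, a0)) -
    sample_mean (fun i0 => \col_a0 (ell a0 * y (i0, a0)))) a' 0
    = (y (i, a') - n%:R^-1 * \sum_i' y (i', a')) * ell a'.
  rewrite !mxE summxE (eq_bigr (fun i' => ell a' * y (i', a'))); last first.
    by move=> i' _; rewrite mxE.
  by rewrite -mulr_sumr; ring.
rewrite mxE big_ord1 [(_^T) _ _]mxE !colE !mxE.
have <- : (Num.sqrt n%:R)^-1 * (Num.sqrt n%:R)^-1 = n%:R^-1 :> R.
  by rewrite -invfM -expr2 sqr_sqrtr ?ltW.
set u := Num.sqrt n%:R; ring.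
Qed.

End sample_covariance.

Section model_at_n.
Context {R : realType} {lam : seq R} {sigma2 gp gr : R}.
Variable M : augmented_model lam sigma2 gp gr.
Variable n : nat.
Hypotheses (n0 : (0 < n)%N) (sigma2_gt0 : 0 < sigma2).
Hypothesis lam_gt0 : forall l, l \in lam -> 0 < l.
Local Notation p := (am_p M n).
Local Notation r := (am_r M n).
Local Notation P := (am_P M).

Let spec := [seq l + sigma2 | l <- lam] ++ nseq (p - size lam) sigma2.

Let size_spec : size spec = p.
Proof. exact: (size_eigenvalues (am_Sigma_eig M n0)). Qed.

Let d_le_p : (size lam <= p)%N.
Proof. by rewrite -[X in (_ <= X)%N]size_spec size_cat size_map leq_addr. Qed.

Let spec_nth a : (a < p)%N ->
  spec`_a = (if (a < size lam)%N then lam`_a else 0) + sigma2.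
Proof.
move=> ap; rewrite nth_cat !size_map; case: ltnP => ad; first by rewrite (nth_map 0).
by rewrite nth_nseq ifT ?add0r// ltn_sub2r// (leq_ltn_trans ad ap).
Qed.

(** The standard deviations of the augmented sample in the coordinates given by
    an eigenbasis of the population covariance and by the augmentation. *)
Definition std_dev (a : 'I_(p + r)) : R :=
  Num.sqrt ((if (a < size lam)%N then lam`_a else 0) + sigma2).

Let lam_nth_ge0 a : 0 <= (if (a < size lam)%N then lam`_a else 0).
Proof. by case: ifP => // ad; rewrite ltW// lam_gt0// mem_nth. Qed.

Lemma std_dev_sqr a : std_dev a ^+ 2 = (if (a < size lam)%N then lam`_a else 0) + sigma2.
Proof. by rewrite sqr_sqrtr// addr_ge0// ltW. Qed.

Lemma std_dev_noise (a b : 'I_(p + r)) : (size lam <= a)%N -> (size lam <= b)%N ->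
  std_dev a = std_dev b.
Proof. by move=> ha hb; rewrite /std_dev !ltnNge ha hb. Qed.

Lemma std_dev_ge a : sigma2 <= std_dev a ^+ 2.
Proof. by rewrite std_dev_sqr lerDr. Qed.

Lemma std_dev_le (Lam : R) a : 0 <= Lam -> (forall l, l \in lam -> l <= Lam) ->
  std_dev a ^+ 2 <= Lam + sigma2.
Proof.
move=> L0 lL; rewrite std_dev_sqr lerD2r; case: ifP => // ad.
by rewrite lL// mem_nth.
Qed.

(** Predictor and augmentation are whitened separately, by an eigenbasis of the
    population covariance and by the identity, so the block-diagonal change of
    coordinates leaves the augmentation alone. *)
Lemma model_normal : exists (O : 'M[R]_(p + r)) (g : 'I_n * 'I_(p + r) -> am_T M -> R),
  [/\ iidN P g, orthogonal O,
      forall (u : 'cV[R]_(p + r)) b, (O^T *m u) (rshift p b) 0 = u (rshift p b) 0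
    & forall t, am_S n t = O *m scov std_dev (fun ia => g ia t) *m O^T].
Proof.
have [Q oQ SQ] := spectral_eigenvalues_of (am_Sigma_sym M n0) (am_Sigma_eig M n0).
pose ellx (a : 'I_p) := std_dev (lshift r a).
have pos x : sigma2 <= x ^+ 2 -> x != 0.
  by rewrite -sqrf_eq0 => h; rewrite gt_eqF// (lt_le_trans _ h).
have ellx0 a : ellx a != 0 by apply: pos; exact: std_dev_ge.
have SQ' : am_Sigma M n = Q *m diag_mx (\row_a ellx a ^+ 2) *m Q^T.
  rewrite {1}SQ; congr (_ *m diag_mx _ *m _); apply/matrixP => i a; rewrite !mxE.
  by rewrite /ellx std_dev_sqr/= -spec_nth.
have one : 1%:M = 1%:M *m diag_mx (\row_(a < r) (1 : R) ^+ 2) *m 1%:M^T.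
  rewrite trmx1 mul1mx mulmx1; apply/matrixP => i j; rewrite !mxE.
  by rewrite expr1n.
have o1 : @orthogonal R r 1%:M by rewrite /orthogonal trmx1 mulmx1.
have one0 (a : 'I_r) : (1 : R) != 0 by exact: oner_neq0.
pose hx := whiten_sample (am_mu M n) Q ellx (am_x (a := M) (n := n)).
pose hs := whiten_sample (0 : 'cV[R]_r) 1%:M (fun=> 1) (am_s (a := M) (n := n)).
have ng := join_samples
  (whiten_sample_iidN oQ ellx0 SQ' (am_x_normal M n0))
  (whiten_sample_iidN o1 one0 one (am_s_normal M n0))
  (am_xs_indep n0)
  (@whiten_sample_sigma _ _ _ n p (am_mu M n) Q ellx _)
  (@whiten_sample_sigma _ _ _ n r 0 1%:M (fun=> 1) _).
set g := (fun ia t => _) in ng.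
pose O : 'M[R]_(p + r) := block_mx Q 0 0 1%:M.
have oO : orthogonal O.
  rewrite /orthogonal tr_block_mx mulmx_block !trmx0 trmx1 !mulmx0 !mul0mx !mulmx1.
  by rewrite oQ !(addr0, add0r) -scalar_mx_block.
exists O, g; split=> // [u b|t].
  rewrite -{1}[u]vsubmxK tr_block_mx !trmx0 trmx1 mul_block_col col_mxEd.
  by rewrite mul0mx mul1mx add0r !mxE.
have zE i : am_z (a := M) i t = col_mx (am_mu M n) 0 +
    O *m \col_a (std_dev a * g (i, a) t).
  rewrite -[\col_a _]vsubmxK mul_block_col !mul0mx mul1mx addr0 add0r add_col_mx.
  congr col_mx.
    rewrite [LHS](whitenK (am_mu M n) oQ ellx0 (am_x i) t); congr (_ + _ *m _).
    apply/matrixP => a j; rewrite !ord1 !mxE; congr (_ * _).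
    by rewrite /g/= (unsplitK (inl a)).
  rewrite add0r [X in _ *: X](whitenK 0 o1 one0 (am_s i) t) add0r mul1mx.
  apply/matrixP => b j; rewrite !ord1 !mxE mul1r; congr (_ * _).
    rewrite /std_dev/= ifF ?add0r//; apply/negbTE; rewrite -leqNgt.
    by apply: leq_trans d_le_p _; exact: leq_addr.
  by rewrite /g/= (unsplitK (inr b)).
rewrite /am_S (sample_cov_affine n0 zE); congr (_ *m _ *m _).
exact: (sample_cov_scov std_dev (fun ia => g ia t) n0).
Qed.

End model_at_n.

Section eigenframe.
Context {R : realType} {lam : seq R} {sigma2 gp gr : R}.
Variable M : augmented_model lam sigma2 gp gr.
Variables (n k : nat) (t : am_T M).
Hypotheses (n0 : (0 < n)%N) (kp : (k <= am_p M n)%N).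
Local Notation p := (am_p M n).
Local Notation r := (am_r M n).
Variables (O C : 'M[R]_(p + r)).
Hypotheses (oO : orthogonal O) (SC : am_S n t = O *m C *m O^T).
Hypothesis Oaug : forall (u : 'cV[R]_(p + r)) b,
  (O^T *m u) (rshift p b) 0 = u (rshift p b) 0.

(** The given eigenvectors in the coordinates that make the components of the
    sample independent. *)
Definition eigenframe : 'M[R]_(p + r, k) :=
  \matrix_(a, j) (O^T *m am_u M n t j) a 0.

Let col_eigenframe j : col j eigenframe = O^T *m am_u M n t j.
Proof. by apply/matrixP => a i; rewrite !ord1 !mxE. Qed.

Lemma eigenframe_frame : is_frame eigenframe.
Proof.
apply/matrixP => i j.
have -> : (eigenframe^T *m eigenframe) i j
    = ((O^T *m am_u M n t i)^T *m (O^T *m am_u M n t j)) 0 0.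
  by rewrite !mxE; apply: eq_bigr => a _; rewrite !mxE.
rewrite trmx_mul trmxK -mulmxA (mulmxA O) (orthogonal_tr oO) mul1mx.
have := am_u_orthonormal t n0 (leq_trans (ltn_ord i) kp) (leq_trans (ltn_ord j) kp).
rewrite !mxE -val_eqE/= => <-; rewrite /inner.
by apply: eq_bigr => a _; rewrite mxE.
Qed.

Lemma eigenframe_eig : C *m eigenframe
  = eigenframe *m diag_mx (\row_j (am_tau M n t)`_j).
Proof.
have CE : C = O^T *m am_S n t *m O.
  by rewrite SC !mulmxA oO mul1mx -mulmxA oO mulmx1.
apply/matrixP => a j.
have -> : (C *m eigenframe) a j = (C *m col j eigenframe) a 0.
  by rewrite !mxE; apply: eq_bigr => b _; rewrite !mxE.
rewrite col_eigenframe {1}CE -!mulmxA (mulmxA O) (orthogonal_tr oO) mul1mx.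
rewrite (am_u_eig t n0 (leq_trans (ltn_ord j) kp)) -scalemxAr.
by rewrite mul_mx_diag !mxE mulrC.
Qed.

Lemma eigenframe_eigenvalues : eigenvalues_of C (am_tau M n t).
Proof.
have [st cS] := am_tau_eig t n0; split=> //; rewrite -cS SC.
have oOt : orthogonal O^T by rewrite /orthogonal trmxK orthogonal_tr.
by rewrite -(char_poly_conj C oOt) trmxK.
Qed.

Lemma eigenframe_augmented (j : 'I_k) :
  \sum_a (augmented a)%:R * eigenframe a j ^+ 2 = aug_norm2 n t j.+1.
Proof.
rewrite big_split_ord/= big1 ?add0r => [|a _]; last first.
  by rewrite /augmented/= leqNgt ltn_ord mul0r.
rewrite /inner; apply: eq_bigr => b _.
rewrite /augmented/= leq_addr mul1r mxE Oaug mxE expr2.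
by [].
Qed.

End eigenframe.

(** * The step of the objective function at d *)

Section gap.
Context {R : realType}.

Definition eigen_gap (a0 S0 : R) : R := a0 ^+ 2 / ((1 + S0) * (1 + S0 + a0)).

Lemma eigen_gap_gt0 a0 S0 : 0 < a0 -> 0 <= S0 -> 0 < eigen_gap a0 S0.
Proof.
move=> a0p S00; rewrite divr_gt0 ?exprn_gt0// mulr_gt0//; lra.
Qed.

(** As [x / (1 + S + x)] increases with [x], the worst case is [b = a]; what is left,
    [a ^ 2 / ((1 + S) * (1 + S + a))], increases with [a] and decreases with [S]. *)
Lemma eigen_gap_le (a b S a0 S0 : R) : 0 < a0 -> a0 <= a -> 0 <= b -> b <= a ->
  0 <= S -> S <= S0 -> eigen_gap a0 S0 <= a / (1 + S) - b / (1 + S + b).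
Proof.
move=> a0p aa0 b0 ba Sp SS0.
have ap : 0 < a := lt_le_trans a0p aa0.
have S1 : 0 < 1 + S by lra.
have S2 : 0 < 1 + S + a by lra.
have S3 : 0 < 1 + S + b by lra.
have T1 : 0 < 1 + S0 by lra.
have T2 : 0 < 1 + S0 + a0 by lra.
have h1 : b / (1 + S + b) <= a / (1 + S + a).
  rewrite ler_pdivrMr// mulrAC ler_pdivlMr//; nra.
apply: (@le_trans _ _ (a / (1 + S) - a / (1 + S + a))); last by rewrite lerD2l lerN2.
have -> : a / (1 + S) - a / (1 + S + a) = a ^+ 2 / ((1 + S) * (1 + S + a)).
  by field; rewrite !gt_eqF.
rewrite /eigen_gap ler_pdivrMr ?mulr_gt0// mulrAC ler_pdivlMr ?mulr_gt0//.
have e1 : a0 * (1 + S) <= a * (1 + S0) by apply: ler_pM; lra.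
have e2 : a0 * (1 + S + a) <= a * (1 + S0 + a0) by lra.
have : a0 * (1 + S) * (a0 * (1 + S + a)) <= a * (1 + S0) * (a * (1 + S0 + a0)).
  by apply: ler_pM => //; rewrite mulr_ge0 ?(ltW a0p) ?(ltW S1) ?(ltW S2).
by congr (_ <= _); ring.
Qed.

Context {lam : seq R} {sigma2 gp gr : R}.
Variable M : augmented_model lam sigma2 gp gr.
Variable n : nat.
Hypotheses (n0 : (0 < n)%N) (sigma2_gt0 : 0 < sigma2).
Hypothesis lam_gt0 : forall l, l \in lam -> 0 < l.
Local Notation p := (am_p M n).
Local Notation r := (am_r M n).
Local Notation P := (am_P M).
Local Notation d := (size lam).
Local Notation sd := (@std_dev R lam sigma2 gp gr M n).
Local Notation k := (size lam).+1.
Hypothesis kp : (k <= p)%N.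

Let kN : (k <= p + r)%N. Proof. exact: leq_trans kp (leq_addr _ _). Qed.

Variables (O : 'M[R]_(p + r)) (g : 'I_n * 'I_(p + r) -> am_T M -> R).
Hypotheses (ng : iidN P g) (oO : orthogonal O).
Hypothesis Oaug : forall (u : 'cV[R]_(p + r)) b,
  (O^T *m u) (rshift p b) 0 = u (rshift p b) 0.
Hypothesis SE : forall t,
  am_S n t = O *m scov sd (fun ia => g ia t) *m O^T.

Local Notation N := (@ky_fan_norm R n (p + r) k sd).
Local Notation Caug := (fun ia : 'I_n * 'I_(p + r) => augmented ia.2).

Let U t := @eigenframe R lam sigma2 gp gr M n k t O.
Let et t := eigenframe_eigenvalues n0 oO (SE t).
Let fU t : is_frame (U t). Proof. exact: eigenframe_frame. Qed.
Let eU t := eigenframe_eig n0 kp oO (SE t).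

Let tau_ge0 t j : 0 <= (am_tau M n t)`_j.
Proof. by apply: (eigenvalues_ge0 (scov_sym sd _) (et t)); exact: scov_psd. Qed.

(** Inflating the augmentation rarely increases the Ky Fan norm, because noise
    coordinates of the predictor can be exchanged with it. *)
Lemma sensitive_augmentation (m : nat) (K e : R) :
  (0 < m)%N -> (d + m * r <= p)%N -> 0 <= K -> 0 < e ->
  fine (P [set t | sensitive N Caug K e (fun ia => g ia t)]) <= K / (e * m%:R).
Proof.
move=> m0 fits K0 e0.
apply: (@sensitive_rare R _ N (seminorm_ky_fan n sd kN) _ _ P g m
  (fun b ia => block d b ia.2) Caug (fun b => column_perm n (swap fits b)) K e
  ng m0 K0 e0).
- move=> b z; apply: ky_fan_norm_perm => // a.
  have [->//|/swap_noise[h1 h2]] := eqVneq (swap fits b a) a.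
  exact: std_dev_noise.
- by move=> b [i a]; rewrite permE/= block_swap.
move=> t; have [x sx dx] := supports_eigenframe kN (et t) (fU t) (eU t).
exists x; split=> // [b|].
  rewrite dx divr_ge0 ?(seminorm_ge0 (seminorm_ky_fan _ _ kN))//.
  apply: sumr_ge0 => j _; rewrite mulr_ge0//.
  by apply: sumr_ge0 => a _; rewrite mulr_ge0 ?sqr_ge0.
rewrite (eq_bigr _ (fun b _ => dx _)) -mulr_suml.
set y := (fun ia => g ia t).
have Ny0 : 0 <= N y by exact: seminorm_ge0 (seminorm_ky_fan _ _ kN) _.
have [->|Nn0] := eqVneq (N y) 0; first by rewrite invr0 mulr0.
rewrite ler_pdivrMr ?lt_neqAle 1?eq_sym ?Nn0// -expr2.
rewrite (ky_fan_norm_sqr kN (et t) (fU t) (eU t)) exchange_big/=.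
apply: ler_sum => j _; rewrite -mulr_sumr -[leRHS]mulr1 ler_wpM2l//.
have U1 : \sum_a U t a j ^+ 2 = 1.
  have /matrixP/(_ j j) := fU t; rewrite !mxE eqxx mulr1n => <-.
  by apply: eq_bigr => a _; rewrite [(_^T)%R _ _]mxE expr2.
rewrite -[leRHS]U1 exchange_big/=; apply: ler_sum => a _; rewrite -mulr_suml.
by apply: ler_piMl; [exact: sqr_ge0|exact: sum_block_le].
Qed.

Lemma objective_step t :
  objective M d n t - objective M k n t
  = (am_tau M n t)`_d / (1 + \sum_(j < k) (am_tau M n t)`_j)
    - (am_tau M n t)`_k / (1 + \sum_(j < k) (am_tau M n t)`_j + (am_tau M n t)`_k)
    - aug_norm2 n t k.
Proof.
rewrite /objective big_add1/= [in X in _ - (X + _)]big_nat_recr//=.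
rewrite big_add1/= [in X in _ - (_ + _ / (1 + X))]big_nat_recr//= !big_mkord.
by set s := \sum_(i < _) aug_norm2 _ _ _; rewrite addrA; lra.
Qed.

(** The deterministic part of the argument: on the intersection of the likely
    events, the mass of the augmentation in the eigenvector of rank [d + 1] is at
    most half of the gap between the two quotients.  It is read off the pairing of
    the subgradient with the augmentation, where it has the weight
    [tau_(d + 1) >= a0]. *)
Lemma objective_gap (K1 Lam e : R) t :
  let y := fun ia => g ia t in
  let S0 := k%:R * (K1 * (Lam + sigma2)) in
  let a0 := sigma2 / 32 in
  0 < K1 -> 0 <= Lam -> (forall l, l \in lam -> l <= Lam) ->
  op_bound y K1 -> n%:R * (p + r)%:R / 16 <= \sum_ia y ia ^+ 2 ->
  32 * (K1 + S0 / sigma2) <= (p + r)%:R ->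
  e * Num.sqrt S0 <= a0 * (eigen_gap a0 S0 / 2) ->
  ~ sensitive N Caug (Num.sqrt S0) e y ->
  eigen_gap a0 S0 / 2 <= objective M d n t - objective M k n t.
Proof.
move=> y S0 a0 K10 Lam0 lamL opb ysq big eS0 nsens.
have L0 : 0 <= Lam + sigma2 by exact: addr_ge0 Lam0 (ltW sigma2_gt0).
have K1ge := ltW K10.
have sdL a := std_dev_le (M := M) (n := n) sigma2_gt0 lam_gt0 a Lam0 lamL.
have sdge a := std_dev_ge (M := M) (n := n) sigma2_gt0 lam_gt0 a.
have S0ge : 0 <= S0 by apply: mulr_ge0 (ler0n _ _) (mulr_ge0 K1ge L0).
have a0p : 0 < a0 by rewrite divr_gt0.
have sumS0 := eigenvalue_sum_le n0 kN K1ge opb L0 sdL (et t) (fU t) (eU t).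
have ysq' : n%:R * (p + r)%:R / 16 <= \sum_a \sum_i y (i, a) ^+ 2.
  apply: le_trans ysq _; rewrite exchange_big/= (pair_big xpredT xpredT (fun i a => y (i, a) ^+ 2))/=.
  by rewrite le_eqVlt; apply/orP; left; apply/eqP; apply: eq_bigr => -[].
have taud := eigenvalue_ge n0 kN K1ge opb L0 sigma2_gt0 sdL sdge (et t) (fU t) (eU t)
  (ltnSn d) ysq' big.
have NyS : N y <= Num.sqrt S0.
  rewrite -(@ler_pXn2r _ 2)// ?nnegrE ?sqrtr_ge0 ?(seminorm_ge0 (seminorm_ky_fan _ _ kN))//.
  by rewrite sqr_sqrtr// (ky_fan_norm_sqr kN (et t) (fU t) (eU t)).
have [x sx dx] := supports_eigenframe kN (et t) (fU t) (eU t).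
have sm : dot x (restr Caug y) < e.
  by rewrite ltNge; apply/negP => h; apply: nsens; exact: supports_sensitive sx NyS h.
have normp : 0 < N y.
  have Ny0 : 0 <= N y by exact: seminorm_ge0 (seminorm_ky_fan _ _ kN) _.
  rewrite lt_neqAle Ny0 andbT eq_sym -sqrf_eq0 (ky_fan_norm_sqr kN (et t) (fU t) (eU t)).
  rewrite gt_eqF// (bigD1 (ord_max : 'I_k))//= ltr_pwDl//.
    exact: lt_le_trans taud.
  by apply: sumr_ge0.
have augle : (am_tau M n t)`_d * aug_norm2 n t k <= a0 * (eigen_gap a0 S0 / 2).
  apply: le_trans eS0; apply: le_trans (_ : e * N y <= _); last first.
    rewrite ler_wpM2l//; apply: le_trans (ltW sm); rewrite dx divr_ge0 ?(ltW normp)//.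
    apply: sumr_ge0 => j _; rewrite mulr_ge0//.
    by apply: sumr_ge0 => a _; rewrite mulr_ge0 ?sqr_ge0.
  move: sm; rewrite dx ltr_pdivrMr// => /ltW; apply: le_trans.
  rewrite (bigD1 (ord_max : 'I_k))//= (eigenframe_augmented _ Oaug) lerDl.
  apply: sumr_ge0 => j _; rewrite mulr_ge0//.
  by apply: sumr_ge0 => a _; rewrite mulr_ge0 ?sqr_ge0.
have q0 : 0 <= aug_norm2 n t k.
  by apply: sumr_ge0 => b _; rewrite -expr2 sqr_ge0.
have qle : aug_norm2 n t k <= eigen_gap a0 S0 / 2.
  rewrite -(ler_pM2l a0p); apply: le_trans augle; rewrite ler_wpM2r//.
rewrite objective_step.
have [st _] := et t; have sz := size_eigenvalues (et t).
have bd : (am_tau M n t)`_k <= (am_tau M n t)`_d.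
  have [ks|sk] := ltnP k (size (am_tau M n t)); first exact: sorted_nth_ge.
  by rewrite [leLHS]nth_default.
have S_ge0 : 0 <= \sum_(j < k) (am_tau M n t)`_j by apply: sumr_ge0 => j _; exact: tau_ge0.
have := eigen_gap_le a0p taud (tau_ge0 t k) bd S_ge0 sumS0.
rewrite -/a0 -/S0; lra.
Qed.

End gap.

(** The deviations of the objective function involve the chosen eigenvectors and are
    only controlled in outer measure, which is subadditive. *)
Lemma outer_avoid {R : realType} {disp} {T : measurableType disp} (P : probability T R)
    (A D1 D2 : set T) (a b1 b2 : R) :
  measurable A -> fine (P A) <= a ->
  (mu_ext P D1 < b1%:E)%E -> (mu_ext P D2 < b2%:E)%E -> a + b1 + b2 <= 1 ->
  exists t, [/\ ~ A t, ~ D1 t & ~ D2 t].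
Proof.
move=> mA PA h1 h2 le1; apply: contrapT => none.
have cov : [set: T] `<=` A `|` D1 `|` D2.
  move=> t _; apply: contrapT => /not_orP[/not_orP[nA nD1] nD2].
  by apply: none; exists t.
have muE X : measurable X -> mu_ext P X = P X by exact: measurable_mu_extE.
have muU X Y : (mu_ext P (X `|` Y) <= mu_ext P X + mu_ext P Y)%E.
  exact: (@outer_measureU2 _ _ (mu_ext P)).
have : (mu_ext P [set: T] <= mu_ext P (A `|` D1 `|` D2))%E.
  exact: (@le_outer_measure _ _ (mu_ext P)).
rewrite muE// probability_setT leNgt => /negP; apply.
apply: le_lt_trans (muU _ _) _.
apply: (@lt_le_trans _ _ ((a + b1) + b2)%:E); last by rewrite lee_fin.
rewrite EFinD; apply: lteD => //.
apply: le_lt_trans (muU _ _) _.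
have fA : P A \is a fin_num by exact: fin_num_measure.
by rewrite EFinD; apply: lee_ltD h1; rewrite muE// -(fineK fA) lee_fin.
Qed.

(** As [m * gr <= gp / 2], eventually [m] blocks of [r n] coordinates and any fixed
    number of further coordinates fit into [p n]. *)
Lemma dimensions_near {R : realType} (p r : nat -> nat) (gp gr : R) (d m : nat) (B : R) :
  (fun n => (p n)%:R / n%:R : R) @ \oo --> gp ->
  (fun n => (r n)%:R / n%:R : R) @ \oo --> gr ->
  0 < gp -> (0 < m)%N -> gr <= 1 -> m%:R * gr <= gp / 2 -> 0 <= B ->
  \forall n \near \oo, [/\ (p n + r n)%:R <= (gp + 2) * n%:R :> R,
    (d + m * r n <= p n)%N, (d < p n)%N & B <= (p n + r n)%:R].
Proof.
move=> pl rl gp0 m0 gr1 mgr B0.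
have mR : 0 < m%:R :> R by rewrite ltr0n.
have e0 : 0 < Num.min (gp / 8 / m%:R) (1 / 2).
  by rewrite lt_min !divr_gt0.
have q0 : 0 < Num.min (gp / 8) (1 / 2) by rewrite lt_min !divr_gt0.
near=> n.
have n0 : (0 < n)%N by near: n; exact: nbhs_infty_gt.
have nR : 0 < n%:R :> R by rewrite ltr0n.
have : `|gp - (p n)%:R / n%:R| < Num.min (gp / 8) (1 / 2).
  by near: n; move/cvgrPdist_lt : pl => /(_ _ q0).
rewrite lt_min !ltr_norml => /andP[/andP[a1 a2] /andP[a3 a4]].
have : `|gr - (r n)%:R / n%:R| < Num.min (gp / 8 / m%:R) (1 / 2).
  by near: n; move/cvgrPdist_lt : rl => /(_ _ e0).
rewrite lt_min !ltr_norml => /andP[/andP[b1 b2] /andP[b3 b4]].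
have big : (d.+1%:R + B) / (gp / 8) <= n%:R by near: n; exact: nbhs_infty_ger.
have b1' : m%:R * ((r n)%:R / n%:R) <= m%:R * gr + gp / 8.
  have -> : gp / 8 = m%:R * (gp / 8 / m%:R) by field; rewrite gt_eqF.
  by rewrite -mulrDr ler_wpM2l ?ler0n//; lra.
have pE : (p n)%:R = (p n)%:R / n%:R * n%:R :> R by rewrite divfK ?gt_eqF.
have rE : (r n)%:R = (r n)%:R / n%:R * n%:R :> R by rewrite divfK ?gt_eqF.
rewrite ler_pdivrMr ?divr_gt0// mulrC in big.
have d1 : d.+1%:R = d%:R + 1 :> R by rewrite -natr1.
have d0 : 0 <= d%:R :> R by rewrite ler0n.
set x := (p n)%:R / n%:R in a1 a2 a3 a4 pE; set y := (r n)%:R / n%:R in b1 b2 b3 b4 b1' rE.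
have x7 : gp * 7 / 8 * n%:R <= x * n%:R by rewrite ler_wpM2r ?ler0n//; lra.
have gn : 0 < gp * n%:R by rewrite mulr_gt0.
have r0 : 0 <= (r n)%:R :> R by rewrite ler0n.
split.
- by rewrite natrD pE rE -mulrDl ler_wpM2r ?ler0n//; lra.
- rewrite -(@ler_nat R) natrD natrM rE mulrA pE.
  have : m%:R * y * n%:R <= (gp / 2 + gp / 8) * n%:R by rewrite ler_wpM2r ?ler0n//; lra.
  lra.
- by rewrite -(@ler_nat R) pE; lra.
- by rewrite natrD pE; lra.
Unshelve. all: by end_near.
Qed.

Section small_augmentation.
Context {R : realType}.

(** If the objective did not decrease from [d] to [d + 1], the exceptional events
    and the deviations of the objective function at [d] and [d + 1] would cover the
    probability space, but their probabilities add up to less than 1. *)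
Lemma objective_decreases (sigma2 Lam gpmin gpmax : R) (d : nat) :
  0 < sigma2 -> 0 <= Lam -> 0 < gpmin ->
  exists2 rho : R, 0 < rho & forall (lam : seq R) (gp gr : R) (phi : nat -> R),
    size lam = d -> (forall l, l \in lam -> 0 < l <= Lam) ->
    gpmin <= gp <= gpmax -> 0 < gr < rho ->
    limiting_objective lam sigma2 gp gr phi -> phi d.+1 < phi d.
Proof.
move=> s0 Lam0 gpm0.
wlog mm : gpmax / gpmin <= gpmax => [wl|].
  have [/wl//|lt] := leP gpmin gpmax; exists 1 => // lam gp gr phi _ _ /andP[h1 h2].
  by have := le_lt_trans (le_trans h1 h2) lt; rewrite ltxx.
(* [p + r <= kappa * n] eventually; [K1] bounds the squared operator norm divided
   by [n], [S0] the sum of the leading eigenvalues and [a0] the last of them *)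
pose kappa : R := gpmax + 2; pose K1 : R := 16 * (19 + 18 * kappa).
have K10 : 0 < K1 by rewrite /K1 /kappa; lra.
have Ls : 0 < Lam + sigma2 by lra.
pose S0 : R := d.+1%:R * (K1 * (Lam + sigma2)).
have S00 : 0 < S0 by apply: mulr_gt0 (mulr_gt0 K10 Ls); rewrite ltr0n.
pose a0 := sigma2 / 32; have a00 : 0 < a0 by rewrite divr_gt0.
pose K : R := Num.sqrt S0; have K0 : 0 < K by rewrite sqrtr_gt0.
pose c := eigen_gap a0 S0; have c0 : 0 < c by exact: eigen_gap_gt0 a00 (ltW S00).
(* an augmentation mass of [c / 2] is a pairing of at least [e] with the
   subgradient *)
pose e := a0 * (c / 2) / K.
have e0 : 0 < e by apply: divr_gt0 K0; apply: mulr_gt0 a00 _; exact: divr_gt0.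
have [m m0 mK] : exists2 m : nat, (0 < m)%N & K / (e * m%:R) <= 1 / 20.
  have q0 : 0 <= 20 * K / e by apply/ltW/divr_gt0 => //; exact: mulr_gt0.
  have h := archi_boundP q0; rewrite ltr_pdivrMr// in h.
  exists (Num.bound (20 * K / e)).+1 => //.
  have m1 : 0 < (Num.bound (20 * K / e)).+1%:R :> R by rewrite ltr0n.
  rewrite ler_pdivrMr ?(mulr_gt0 e0 m1)// -[X in e * X]natr1.
  lra.
have eK : e * Num.sqrt S0 <= a0 * (c / 2) by rewrite /e divfK// gt_eqF.
have [cE S0E KE] : [/\ c = eigen_gap a0 S0, S0 = d.+1%:R * (K1 * (Lam + sigma2))
  & K = Num.sqrt S0] by [].
clearbody e c K S0.
have mR : 0 < m%:R :> R by rewrite ltr0n.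
exists (Num.min 1 (gpmin / 2 / m%:R)); first by rewrite lt_min ltr01 !divr_gt0.
move=> lam gp gr phi sz lamL /andP[gpl gpu] /andP[gr0]; rewrite lt_min => /andP[gr1 grm].
move=> [M Mlim]; subst d.
have lam0 l : l \in lam -> 0 < l by move=> /lamL/andP[].
have lamLe l : l \in lam -> l <= Lam by move=> /lamL/andP[].
rewrite ltNge; apply/negP => phile.
have gp0 := lt_le_trans gpm0 gpl.
have B0 : 0 <= 32 * (K1 + S0 / sigma2) by rewrite mulr_ge0// addr_ge0 ?divr_ge0 ?(ltW K10) ?(ltW S00) ?(ltW s0).
have grm' : m%:R * gr <= gp / 2.
  by move: grm; rewrite ltr_pdivlMr// mulrC; lra.
have dims := dimensions_near (size lam) (am_p_lim M) (am_r_lim M) gp0 m0 (ltW gr1) grm' B0.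
have c8 : 0 < c / 8 by rewrite divr_gt0.
have small : (0 < (1 / 20 : R)%:E)%E by rewrite lte_fin; lra.
have near_dev k : \forall n \near \oo,
    (mu_ext (am_P M) [set t | (c / 8 < `|objective M k n t - phi k|)%R] < (1 / 20 : R)%:E)%E.
  exact: (Mlim k _ c8 _ (open_ereal_lt' small)).
suff : \forall n \near \oo, False.
  by move=> [n _ /(_ n (leqnn n))].
near=> n.
have [dim1 dim2 dim3 dim4] : [/\ (am_p M n + am_r M n)%:R <= (gp + 2) * n%:R :> R,
    (size lam + m * am_r M n <= am_p M n)%N, (size lam < am_p M n)%N
    & 32 * (K1 + S0 / sigma2) <= (am_p M n + am_r M n)%:R] by near: n.
have dev1 : (mu_ext (am_P M) [set t | (c / 8 < `|objective M (size lam) n t - phi (size lam)|)%R]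
    < (1 / 20 : R)%:E)%E by near: n; exact: near_dev.
have dev2 : (mu_ext (am_P M) [set t | (c / 8 < `|objective M (size lam).+1 n t - phi (size lam).+1|)%R]
    < (1 / 20 : R)%:E)%E by near: n; exact: near_dev.
have n6 : (5 < n)%N by near: n; exact: nbhs_infty_gt.
have n0 : (0 < n)%N by exact: leq_trans n6.
have [Q [g [iidg oQ Qaug SE]]] := model_normal M n0 s0 lam0.
have dimk : (am_p M n + am_r M n)%:R <= kappa * n%:R :> R.
  by apply: le_trans dim1 _; rewrite ler_wpM2r ?ler0n// /kappa lerD2r.
have [Bad [mBad PBad Badok]] := op_bound_probability n0 dimk iidg.
have I0 : (0 < #|{: 'I_n * 'I_(am_p M n + am_r M n)}|)%N.
  by rewrite card_prod !card_ord muln_gt0 n0 (leq_trans _ (leq_addr _ _))// (leq_trans _ dim3).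
have [Low [mLow PLow Lowok]] := energy_probability I0 iidg.
have Psens := sensitive_augmentation n0 dim3 iidg oQ SE m0 dim2 (ltW K0) e0.
set Sens := [set t | _] in Psens.
have mSens : measurable Sens.
  rewrite -[X in measurable X]setTI; apply: (measurable_vec iidg.1 measurableT).
  apply: measurable_sensitive; apply: seminorm_ky_fan; exact: leq_trans dim3 (leq_addr _ _).
have fU (X Y : set (am_T M)) : measurable X -> measurable Y ->
    fine (am_P M (X `|` Y)) <= fine (am_P M X) + fine (am_P M Y).
  move=> mX mY; rewrite -fineD ?fin_num_measure// fine_le ?fin_numD ?fin_num_measure//.
  - exact: measurableU.
  - exact: measureU2.
have PA : fine (am_P M (Bad `|` Low `|` Sens)) <= 1 / 20 + 2 / 3 + 1 / 20.
  have := fU _ _ (measurableU _ _ mBad mLow) mSens; have := fU _ _ mBad mLow.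
  have : 2 * 2^-1 ^+ n <= 1 / 20 :> R.
    have : 2^-1 ^+ n <= 2^-1 ^+ 6 :> R by apply: ler_wiXn2l => //; lra.
    by rewrite !exprS expr0; lra.
  by move: PBad PLow Psens mK; lra.
have tot : 1 / 20 + 2 / 3 + 1 / 20 + 1 / 20 + 1 / 20 <= 1 :> R by lra.
have [t [ntA nt1 nt2]] := outer_avoid
  (measurableU _ _ (measurableU _ _ mBad mLow) mSens) PA dev1 dev2 tot.
have [nB nL nS] : [/\ ~ Bad t, ~ Low t & ~ Sens t].
  by split=> h; apply: ntA; [left; left|left; right|right].
have ysq := Lowok t nL; rewrite card_prod !card_ord natrM in ysq.
subst K c S0.
have := objective_gap n0 s0 lam0 dim3 oQ Qaug SE K10 Lam0 lamLe (Badok t nB) ysq dim4 eK nS.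
move/negP: nt1; move/negP: nt2; rewrite -!leNgt !ler_norml => /andP[u1 u2] /andP[v1 v2].
lra.
Unshelve. all: by end_near.
Qed.

End small_augmentation.

(** * The three parameter regimes *)

Lemma bounded_seq {R : realType} (s : seq R) :
  exists2 b : R, 0 <= b & forall l, l \in s -> l <= b.
Proof.
elim: s => [|x s [b b0 h]]; first by exists 0.
exists (Num.max x b); first by rewrite le_max b0 orbT.
move=> l; rewrite inE le_max => /orP[/eqP->|/h->]; first by rewrite lexx.
by rewrite orbT.
Qed.

Lemma sorted_rcons_gt0 {R : realType} (s : seq R) x : 0 < x ->
  sorted >%R (rcons s x) -> forall l, l \in rcons s x -> 0 < l.
Proof.
move=> x0; rewrite -cats1 => so l.
rewrite mem_cat inE => /orP[ls|/eqP->//]; apply: lt_trans x0 _.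
move: so; rewrite sorted_pairwise; last by move=> ? ? ? h1 h2; exact: lt_trans h2 h1.
by rewrite pairwise_cat => /andP[/allrelP/(_ l x ls)]; rewrite inE eqxx => /(_ isT).
Qed.

Lemma sorted_rcons_last {R : realType} (s : seq R) x :
  sorted >%R s -> (s != [::] -> x < s`_(size s).-1) -> sorted >%R (rcons s x).
Proof.
case: s => // y s; rewrite /= rcons_path => -> /(_ isT) h /=.
by move: h; rewrite nth_last.
Qed.

(* lam lists lambda_1, ..., lambda_(d-1); ld is lambda_d. *)
Theorem theorem3 (R : realType) (d : nat) (hd : (0 < d)%N)
    (sigma2 : R) (hsigma2 : 0 < sigma2) (lam : (d.-1).-tuple R) :
  [/\ (* (i) *)
      forall ld gp : R,
        0 < ld -> sorted >%R (rcons lam ld) -> 0 < gp ->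
        sigma2 * Num.sqrt gp < ld ->
        exists gr0 : R,
          0 < gr0 < ld ^+ 2 / sigma2 ^+ 2 - gp /\
          forall gr : R, 0 < gr < gr0 ->
          forall phi : nat -> R,
            limiting_objective (rcons lam ld) sigma2 gp gr phi ->
            phi d > phi d.+1,
      (* (ii) *)
      forall gp : R,
        0 < gp -> sorted >%R lam ->
        ((1 < d)%N -> sigma2 * Num.sqrt gp < lam`_d.-2) ->
        exists ld : R,
          [/\ sigma2 * Num.sqrt gp < ld, sorted >%R (rcons lam ld) &
          forall gr : R, 0 < gr < ld ^+ 2 / sigma2 ^+ 2 - gp ->
          forall phi : nat -> R,
            limiting_objective (rcons lam ld) sigma2 gp gr phi ->
            phi d > phi d.+1]
    & (* (iii) *)
      forall ld : R,
        0 < ld -> sorted >%R (rcons lam ld) ->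
        exists gp : R,
          0 < gp < ld ^+ 2 / sigma2 ^+ 2 /\
          forall gr : R, 0 < gr < ld ^+ 2 / sigma2 ^+ 2 - gp ->
          forall phi : nat -> R,
            limiting_objective (rcons lam ld) sigma2 gp gr phi ->
            phi d > phi d.+1].
Proof.
have size_lam ld : size (rcons lam ld) = d by rewrite size_rcons size_tuple prednK.
have s2 : 0 < sigma2 ^+ 2 by rewrite exprn_gt0.
split.
- move=> ld gp ld0 so gp0 sup.
  have gap : 0 < ld ^+ 2 / sigma2 ^+ 2 - gp.
    rewrite subr_gt0 ltr_pdivlMr// -[X in X * _](sqr_sqrtr (ltW gp0)) -exprMn mulrC.
    by rewrite ltr_pXn2r// nnegrE ?(ltW ld0)// mulr_ge0 ?sqrtr_ge0 ?(ltW hsigma2).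
  have [Lam Lam0 lamL] := bounded_seq (rcons lam ld).
  have [rho rho0 dec] := objective_decreases gp d hsigma2 Lam0 gp0.
  exists (Num.min rho ((ld ^+ 2 / sigma2 ^+ 2 - gp) / 2)); split.
    by rewrite lt_min rho0 gt_min; apply/andP; split; [lra|apply/orP; right; lra].
  move=> gr /andP[gr0]; rewrite lt_min => /andP[grr _] phi.
  apply: dec; rewrite ?size_lam ?lexx ?gr0//.
  by move=> l ll; rewrite (sorted_rcons_gt0 ld0 so) ?lamL.
- move=> gp gp0 so lamgp.
  pose q := sigma2 * Num.sqrt gp.
  have q0 : 0 < q by rewrite mulr_gt0 ?sqrtr_gt0.
  have [Lam0 Lam00 lamL] := bounded_seq (rcons lam (q + 1)).
  have [rho rho0 dec] := objective_decreases gp d hsigma2 Lam00 gp0.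
  (* [ld] exceeds [q] by [x], which is so small that [ld] stays below the other
     signal eigenvalues and the admissible [gr] stay below [rho] *)
  pose room := if (1 < d)%N then lam`_d.-2 - q else 1.
  have room0 : 0 < room by rewrite /room; case: ifP => // /lamgp; rewrite subr_gt0.
  (* (q + x)^2 - q^2 = x (2 q + x) < x (2 q + 1) for 0 < x < 1 *)
  pose x := Num.min (Num.min 1 room) (rho * sigma2 ^+ 2 / (2 * q + 1)) / 2.
  have w0 : 0 < 2 * q + 1 by lra.
  have x0 : 0 < x.
    by rewrite divr_gt0// !lt_min ltr01 room0/=; apply: divr_gt0 w0; exact: mulr_gt0.
  have [x1 xroom xrho] : [/\ x < 1, x < room & x * (2 * q + 1) < rho * sigma2 ^+ 2].
    have y2 : x < x * 2 by lra.
    have : x * 2 <= Num.min (Num.min 1 room) (rho * sigma2 ^+ 2 / (2 * q + 1)).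
      by rewrite divfK// gt_eqF.
    rewrite !le_min => /andP[/andP[h1 h2] h3]; split; try exact: lt_le_trans y2 _.
    by rewrite -ltr_pdivlMr//; exact: lt_le_trans y2 _.
  have ld0 : 0 < q + x by lra.
  have sold : sorted >%R (rcons lam (q + x)).
    apply: sorted_rcons_last => //; rewrite size_tuple -size_eq0 size_tuple => dn.
    by move: xroom; rewrite /room ifT ?ltrBrDl//; lia.
  exists (q + x); split=> //; first by rewrite -/q ltrDl.
  move=> gr /andP[gr0 grlt] phi; apply: dec; rewrite ?size_lam ?lexx ?gr0//.
    move=> l; move=> ll; rewrite (sorted_rcons_gt0 ld0 sold)//=.
    move: ll; rewrite mem_rcons inE => /orP[/eqP->|ll]; last first.
      by apply: lamL; rewrite mem_rcons inE ll orbT.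
    apply: (@le_trans _ _ (q + 1)); first by rewrite lerD2l ltW.
    by apply: lamL; rewrite mem_rcons inE eqxx.
  apply: lt_trans grlt _; rewrite ltrBlDr ltr_pdivrMr// mulrDl.
  have qq : gp * sigma2 ^+ 2 = q ^+ 2 by rewrite exprMn sqr_sqrtr ?(ltW gp0)// mulrC.
  have : x * x < x * 1 by rewrite ltr_pM2l.
  rewrite qq; lra.
(* [gp] is so close to the threshold [g0] that the admissible [gr] stay below
   [rho]; being at least [g0 / 2], it is bounded away from 0 *)
move=> ld ld0 so.
pose g0 := ld ^+ 2 / sigma2 ^+ 2.
have g00 : 0 < g0 by rewrite divr_gt0// exprn_gt0.
have [Lam Lam0 lamL] := bounded_seq (rcons lam ld).
have g2 : 0 < g0 / 2 by rewrite divr_gt0.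
have [rho rho0 dec] := objective_decreases g0 d hsigma2 Lam0 g2.
pose h := Num.min rho (g0 / 2).
have h0 : 0 < h by rewrite lt_min rho0.
have [hr hg] : h <= rho /\ h <= g0 / 2 by rewrite /h !ge_min !lexx orbT.
exists (g0 - h); split; first by rewrite -/g0; apply/andP; split; lra.
move=> gr /andP[gr0 grlt] phi.
apply: dec; rewrite ?size_lam ?gr0//=.
- by move=> l ll; rewrite (sorted_rcons_gt0 ld0 so) ?lamL.
- by apply/andP; split; lra.
- by move: grlt; rewrite -/g0; lra.
Qed.
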